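(* Let $d\ge2$. For every $g\in I_d\smallsetminus(f^{(d)})$, $\xi_g(\mathcal R_\infty)=X_{f^{(d)}}$. Furthermore, the shift action $\sigma_{\mathcal R_\infty}$ of $\mathbb Z^d$ on $\mathcal R_\infty$ has topological entropy $$h_{\mathrm{top}}(\sigma_{\mathcal R_\infty})=\lim_{N\to\infty}\frac1{|Q_N|}\log|\pi_{Q_N}(\mathcal R_\infty)|=\int_0^1\!\!\cdots\!\int_0^1\log\Bigl(2d-2\sum_{j=1}^d\cos(2\pi t_j)\Bigr)dt_1\cdots dt_d=h_{\mathrm{top}}(\alpha_{f^{(d)}}).$$
   Context: $R_d=\mathbb Z[u_1^{\pm1},\dots,u_d^{\pm1}]$; sequences identified with formal series; $(a\cdot b)_{\mathbf n}=\sum_{\mathbf k}a_{\mathbf k}b_{\mathbf n-\mathbf k}$; $w^*_{\mathbf n}=w_{-\mathbf n}$. $f^{(d)}=2d-\sum_i(u_i+u_i^{-1})$, $(f^{(d)})=f^{(d)}R_d$. $w^{(2)}_{\mathbf n}=\int_{\mathbb T^2}(e^{-2\pi i\langle\mathbf n,\mathbf t\rangle}-1)/F^{(2)}(\mathbf t)\,d\mathbf t$; for $d\ge3$, $w^{(d)}_{\mathbf n}=\int_{\mathbb T^d}e^{-2\pi i\langle\mathbf n,\mathbf t\rangle}/F^{(d)}(\mathbf t)\,d\mathbf t$, $F^{(d)}(\mathbf t)=2d-2\sum_j\cos(2\pi t_j)$. $I_d=\{g\in R_d:g\cdot w^{(d)}\in\ell^1(\mathbb Z^d)\}$. $\rho$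 = reduction mod 1. $X_{f^{(d)}}=\{x\in\mathbb T^{\mathbb Z^d}:2d\,x_{\mathbf n}-\sum_j(x_{\mathbf n+\mathbf e^{(j)}}+x_{\mathbf n-\mathbf e^{(j)}})=0\ \forall\mathbf n\}$ with shift action $(\alpha^{\mathbf m}x)_{\mathbf n}=x_{\mathbf m+\mathbf n}$, denoted $\alpha_{f^{(d)}}$. For $g\in I_d$ and $v\in\ell^\infty(\mathbb Z^d,\mathbb Z)$, $\xi_g(v)=\rho((g^*\cdot w^{(d)})\cdot v)$. $Q_N=\{-N,\dots,N\}^d$ and $\pi_{Q_N}$ is the restriction to coordinates in $Q_N$. For nonempty $F\subset\mathbb Z^d$, $\mathsf N_F(\mathbf n)=|F\cap\{\mathbf n\pm\mathbf e^{(i)}\}|$. $\mathcal R_\infty=\{v\in\{0,\dots,2d-1\}^{\mathbb Z^d}:$ for every finite nonempty $F$ there is $\mathbf n\in F$ with $v_{\mathbf n}\ge\mathsf N_F(\mathbf n)\}$, with shift action $(\sigma^{\mathbf m}v)_{\mathbf n}=v_{\mathbf m+\mathbf n}$. *)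

(* Defs.v *)
From HB Require Import structures.
From mathcomp Require Import all_boot all_order all_algebra.
From mathcomp Require Import all_classical all_reals all_analysis.
Set Implicit Arguments. Unset Strict Implicit. Unset Printing Implicit Defensive.
Import Order.TTheory GRing.Theory Num.Theory.
Import numFieldNormedType.Exports.
Local Open Scope classical_set_scope.
Local Open Scope ring_scope.

Section Defs.
Variable R : realType.
Variable d : nat.

Definition Zd := {ffun 'I_d -> int}.
Definition evec (i : 'I_d) : Zd := [ffun j => ((j == i) : nat)%:Z].
Definition supnorm (n : Zd) : nat := \max_(i < d) `|n i|%N.

(* Laurent polynomials in R_d, as finite formal sums  sum_(k,c) c u^k *)
Definition lpoly := seq (Zd * int).
Definition coef (p : lpoly) (n : Zd) : int := \sum_(kc <- p | kc.1 == n) kc.2.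
Definition lmul (p q : lpoly) : lpoly := [seq (a.1 + b.1, a.2 * b.2) | a <- p, b <- q].
Definition lstar (p : lpoly) : lpoly := [seq (- a.1, a.2) | a <- p].
Definition fpoly : lpoly :=
  (0, (2 * d)%:Z) :: flatten [seq [:: (evec i, -1); (- evec i, -1)] | i <- enum 'I_d].
Definition in_ideal_f (g : lpoly) : Prop :=
  exists h : lpoly, forall n, coef g n = coef (lmul fpoly h) n.

Definition conv (p : lpoly) (x : Zd -> R) (n : Zd) : R :=
  \sum_(kc <- p) kc.2%:~R * x (n - kc.1).

Definition ell1 (a : Zd -> R) : Prop :=
  (\esum_(n in [set: Zd]) (`|a n|)%:E < +oo)%E.

(* boxes Q_N = {-N..N}^d, enumerated by the finite type  {ffun 'I_d -> 'I_(2N+1)} *)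
Definition boxT (N : nat) := {ffun 'I_d -> 'I_(N.*2.+1)}.
Definition bpt (N : nat) (c : boxT N) : Zd := [ffun i => (c i)%:Z - N%:Z].
Definition boxcard (N : nat) : nat := (N.*2.+1) ^ d.

(* sum over Z^d of an absolutely summable family, as the limit of box sums *)
Definition zsum (a : Zd -> R) : R := limn (fun N => \sum_(c : boxT N) a (bpt c)).

(* reduction mod 1: T = R/Z represented by [0,1) *)
Definition rho (r : R) : R := r - (Num.floor r)%:~R.

Fixpoint iint (k : nat) (F : (nat -> R) -> R) : R :=
  match k with
  | 0 => F (fun _ => 0)
  | k'.+1 => Rintegral (@lebesgue_measure R) `[0%R, 1%R]
               (fun s => iint k' (fun t => F (fun j => if j == k' then s else t j)))
  end.

Definition dotnt (n : Zd) (t : nat -> R) : R := \sum_(i < d) (n i)%:~R * t i.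
Definition Ffun (t : nat -> R) : R := (2 * d)%:R - 2 * \sum_(j < d) cos (2 * pi * t j).

Definition w (n : Zd) : R :=
  if d == 2%N then iint d (fun t => (cos (2 * pi * dotnt n t) - 1) / Ffun t)
  else iint d (fun t => cos (2 * pi * dotnt n t) / Ffun t).

Definition in_Id (g : lpoly) : Prop := ell1 (conv g w).

Definition xi (g : lpoly) (v : Zd -> int) : Zd -> R :=
  fun n => rho (zsum (fun k => conv (lstar g) w k * (v (n - k))%:~R)).

Definition Xf : set (Zd -> R) :=
  [set x | (forall n, 0 <= x n < 1) /\
           (forall n, rho ((2 * d)%:R * x n
              - \sum_(j < d) (x (n + evec j) + x (n - evec j))) = 0)].

Definition NF (F : seq Zd) (n : Zd) : nat :=
  \sum_(i < d) addn (nat_of_bool ((n + evec i)%R \in F)) (nat_of_bool ((n - evec i)%R \in F)).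

Definition Rinf : set (Zd -> nat) :=
  [set v | (forall n, v n <= (2 * d).-1)%N /\
           (forall F : seq Zd, F != [::] -> exists2 n, n \in F & (NF F n <= v n)%N)].

Definition npat (N : nat) : nat :=
  #|[set p : {ffun boxT N -> 'I_(2 * d)} |
     `[< exists2 v, Rinf v & forall c, (p c : nat) = v (bpt c) >] ]|.

Definition shift (T : Type) (m : Zd) (x : Zd -> T) : Zd -> T := fun n => x (m + n).

(* compatible metric on T^(Z^d) from a coordinate distance delta <= 1 *)
Definition pdist (T : Type) (delta : T -> T -> R) (x y : Zd -> T) : R :=
  sup [set r | exists n, r = (2^-1) ^+ supnorm n * delta (x n) (y n)].
Definition bowen_dist (T : Type) (delta : T -> T -> R) (N : nat) (x y : Zd -> T) : R :=
  \big[Num.max/0]_(c : boxT N) pdist delta (shift (bpt c) x) (shift (bpt c) y).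
Definition sepnum (T : Type) (X : set (Zd -> T)) (delta : T -> T -> R) (N : nat) (eps : R) : R :=
  sup [set k%:R | k in [set k : nat | exists p : 'I_k -> (Zd -> T),
          (forall i, X (p i)) /\ (forall i j, i != j -> eps < bowen_dist delta N (p i) (p j))]].
Definition htop (T : Type) (X : set (Zd -> T)) (delta : T -> T -> R) : \bar R :=
  ereal_sup [set limn_esup (fun N => (ln (sepnum X delta N eps) / (boxcard N)%:R)%:E)
            | eps in [set e : R | 0 < e]].

Definition discr_dist (a b : nat) : R := if a == b then 0 else 1.
Definition circ_dist (a b : R) : R := Num.min (rho (a - b)) (1 - rho (a - b)).

End Defs.

(* Main.v *)
(* Summability of W = g^* w and lap W = g^* give xi_g (lap x) = g^* x mod 1.  As f is prime and does not
   divide g, multiplication by g^* maps X_f onto itself: write x = g^* x' mod 1.  Toppling the bounded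
   integer configuration lap x' inside a box yields a recurrent configuration u = lap x' - lap h there;
   W * lap h is integral, and what remains lives outside the box, grows linearly in its size on the
   first layer and is bounded further out, so that summability of W makes it negligible for suitable
   arbitrarily large boxes.  A limit of these u is a preimage of x in R_infinity.

   The recurrent patterns on a box B represent the cokernel of the Dirichlet Laplacian on Z^B, so their
   number is its determinant, and the logarithm of the determinant is a Riemann sum for the Mahler
   measure of f.  By the maximum principle, a point x of X_f is determined on B up to a small error by
   its values next to B and by the recurrent class of lap x; conversely, the Dirichlet solutions y of
   lap y = u, with u a recurrent pattern, extend to points of X_f that are uniformly separated. *)

(* Modulo 1, a point of X_f is a character of R_d/(f). Hence g^* is onto as soon as multiplication
   by g is injective on R_d/(f), because R/Z is divisible. Primality of f comes from evaluation: f
   is quadratic in one variable, so a remainder modulo f has degree at most 1 in it, and at zeros of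
   f with that variable nonreal and the others real both coefficients of the remainder vanish.

   The boxes must be selected because summability of W says only that the weights of the successive
   layers have a finite sum; they are small compared with 1/N for infinitely many N, not for all N.

   All integrals are iterated, and 1/F and log F are singular at the origin. Every estimate is
   arranged so that the inner integrands are Lipschitz and only the outermost variable meets a
   singularity, with majorant s^(-2/3) + (1-s)^(-2/3). The exponent 1/3 fits twice: the power -1/3
   of 2 - 2 cos(2 pi s) is integrable, and three such powers from three variables absorb 1/F. The
   logarithm loses only a cube root when F is replaced by F + e, in the integral and in its Riemann
   sums alike. *)
Require Import Defs.
From HB Require Import structures.
From mathcomp Require Import all_boot all_order all_algebra.
From mathcomp Require Import all_classical all_reals all_analysis.
From mathcomp Require Import measurable_realfun complex zify ring lra.
Set Implicit Arguments. Unset Strict Implicit. Unset Printing Implicit Defensive.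
Import Order.TTheory GRing.Theory Num.Theory.
Import numFieldNormedType.Exports.
Local Open Scope classical_set_scope.
Local Open Scope ring_scope.

(** * The lattice Laplacian *)

Section LatticeAction.
Variable d : nat.
Local Notation Zd := (Zd d).
Local Notation lpoly := (lpoly d).
Local Notation evec := (@evec d).

(** Formulated over any abelian group, so that one calculus serves integer coefficients, real
    configurations and complex characters. *)
Definition act (V : zmodType) (p : lpoly) (x : Zd -> V) (n : Zd) : V :=
  \sum_(kc <- p) x (n - kc.1) *~ kc.2.

Definition lap (V : zmodType) (x : Zd -> V) (n : Zd) : V :=
  x n *+ (2 * d) - \sum_(j < d) (x (n + evec j) + x (n - evec j)).

Definition zdelta (n : Zd) : int := (n == 0)%:Z.

Lemma eq_act (V : zmodType) p (x y : Zd -> V) : x =1 y -> act p x =1 act p y.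
Proof. by move=> e n; apply: eq_bigr => kc _; rewrite e. Qed.

Lemma eq_lap (V : zmodType) (x y : Zd -> V) : x =1 y -> lap x =1 lap y.
Proof. by move=> e n; rewrite /lap e; congr (_ - _); apply: eq_bigr => j _; rewrite !e. Qed.

Lemma act_cat (V : zmodType) p q (x : Zd -> V) n : act (p ++ q) x n = act p x n + act q x n.
Proof. by rewrite /act big_cat. Qed.

Lemma act_lmul (V : zmodType) p q (x : Zd -> V) n : act (lmul p q) x n = act p (act q x) n.
Proof.
rewrite /act /lmul big_allpairs_dep /=; apply: eq_bigr => a _.
rewrite mulrz_suml; apply: eq_bigr => b _ /=.
by rewrite opprD addrA -mulrzA [b.2 * a.2]mulrC.
Qed.

Lemma act_comm (V : zmodType) p q (x : Zd -> V) n : act p (act q x) n = act q (act p x) n.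
Proof.
rewrite -!act_lmul /act /lmul !big_allpairs_dep /= exchange_big /=.
by apply: eq_bigr => b _; apply: eq_bigr => a _; rewrite [a.1 + _]addrC [a.2 * _]mulrC.
Qed.

Lemma actB (V : zmodType) p (x y : Zd -> V) n : act p (fun k => x k - y k) n = act p x n - act p y n.
Proof. by rewrite /act -sumrB; apply: eq_bigr => kc _; rewrite mulrzBl. Qed.

Lemma actMl (V : pzRingType) p (x : Zd -> V) a n : act p (fun k => a * x k) n = a * act p x n.
Proof. by rewrite /act mulr_sumr; apply: eq_bigr => kc _; rewrite mulrzAr. Qed.

Lemma act_morph (U V : zmodType) (f : {additive U -> V}) p (x : Zd -> U) n :
  act p (fun k => f (x k)) n = f (act p x n).
Proof. by rewrite /act raddf_sum; apply: eq_bigr => kc _; rewrite raddfMz. Qed.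

Lemma lap_morph (U V : zmodType) (f : {additive U -> V}) (x : Zd -> U) n :
  lap (fun k => f (x k)) n = f (lap x n).
Proof.
rewrite /lap [RHS]raddfB [X in _ = X - _]raddfMn [X in _ = _ - X]raddf_sum; congr (_ - _).
by apply: eq_bigr => j _; rewrite raddfD.
Qed.

Lemma lapD (V : zmodType) (x y : Zd -> V) n : lap (fun k => x k + y k) n = lap x n + lap y n.
Proof.
rewrite /lap mulrnDl addrACA -opprD -big_split /=.
by congr (_ - _); apply: eq_bigr => j _; rewrite addrACA.
Qed.

Lemma lapN (V : zmodType) (x : Zd -> V) n : lap (fun k => - x k) n = - lap x n.
Proof.
rewrite /lap mulNrn opprD; congr +%R; congr -%R.
by rewrite -sumrN; apply: eq_bigr => j _; rewrite opprD.
Qed.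

Lemma lapB (V : zmodType) (x y : Zd -> V) n : lap (fun k => x k - y k) n = lap x n - lap y n.
Proof. by rewrite lapD lapN. Qed.

Lemma lapMl (V : pzRingType) (x : Zd -> V) a n : lap (fun k => a * x k) n = a * lap x n.
Proof.
rewrite /lap mulrBr mulrnAr mulr_sumr; congr (_ - _).
by apply: eq_bigr => j _; rewrite mulrDr.
Qed.

Lemma act_fpoly (V : zmodType) (x : Zd -> V) n : act (fpoly d) x n = lap x n.
Proof.
rewrite /act /fpoly big_cons subr0 /= /lap; congr (_ + _).
rewrite big_flatten /= big_map -sumrN big_enum /=; apply: eq_bigr => j _.
by rewrite !big_cons big_nil /= addr0 opprK !mulrNz !mulr1z opprD addrC.
Qed.

Lemma coefE (p : lpoly) n : coef p n = act p zdelta n.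
Proof.
rewrite /coef /act big_mkcond; apply: eq_bigr => kc _.
rewrite /zdelta subr_eq0 eq_sym; case: eqP => _; first by rewrite intz.
by rewrite mul0rz.
Qed.

Lemma coef_lmul (p q : lpoly) n : coef (lmul p q) n = act p (coef q) n.
Proof. by rewrite coefE act_lmul; apply: eq_act => k; rewrite coefE. Qed.

Lemma coef_cat (p q : lpoly) n : coef (p ++ q) n = coef p n + coef q n.
Proof. by rewrite !coefE act_cat. Qed.

Lemma coef_notin (p : lpoly) n : n \notin map fst p -> coef p n = 0.
Proof.
move=> h; rewrite /coef big_seq_cond big_pred0 // => kc.
by apply/negbTE/negP => /andP[i /eqP e]; move/negP: h; apply; rewrite -e map_f.
Qed.

Lemma act_coef (V : zmodType) p (x : Zd -> V) n s :
  uniq s -> {subset map fst p <= s} -> act p x n = \sum_(k <- s) x (n - k) *~ coef p k.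
Proof.
move=> us; elim: p => [_|[m c] p IH sub].
  by rewrite /act big_nil big1 // => k _; rewrite /coef big_nil mulr0z.
rewrite /act big_cons -/(act p x n) IH; last by move=> z i; apply: sub; rewrite inE i orbT.
have ms : m \in s by apply: sub; rewrite inE eqxx.
rewrite (bigD1_seq m) //= [RHS](bigD1_seq m) //= addrA; congr (_ + _).
  by rewrite /coef big_cons /= eqxx mulrzDr.
by apply: eq_bigr => k km; rewrite /coef big_cons /= eq_sym (negbTE km).
Qed.

(** An [lpoly] may repeat exponents, so different lists can represent one polynomial; regrouping
    over a duplicate-free list of exponents removes the dependence on the list. *)
Lemma eq_coef_act (V : zmodType) p q : coef p =1 coef q -> forall (x : Zd -> V) n, act p x n = act q x n.
Proof.
move=> e x n; pose s := undup (map fst (p ++ q)).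
rewrite (@act_coef _ p x n s) ?undup_uniq //; last first.
  by move=> z i; rewrite mem_undup map_cat mem_cat i.
rewrite (@act_coef _ q x n s) ?undup_uniq //; last first.
  by move=> z i; rewrite mem_undup map_cat mem_cat i orbT.
by apply: eq_bigr => k _; rewrite e.
Qed.

Lemma act_lstar (V : zmodType) p (x : Zd -> V) n :
  act (lstar p) x n = \sum_(kc <- p) x (n + kc.1) *~ kc.2.
Proof. by rewrite /act big_map; apply: eq_bigr => kc _ /=; rewrite opprK. Qed.

Lemma convE (R : realType) (p : lpoly) (x : Zd -> R) n : Defs.conv p x n = act p x n.
Proof. by apply: eq_bigr => kc _; rewrite mulrzl. Qed.

End LatticeAction.

(** * Boxes and the maximum principle *)

Section Boxes.
Variable d : nat.
Local Notation Zd := (Zd d).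
Local Notation evec := (@evec d).

Definition inbox (N : nat) (n : Zd) : bool := (supnorm n <= N)%N.

Lemma inboxP N (n : Zd) : reflect (forall i, `|n i|%N <= N)%N (inbox N n).
Proof. by apply: (iffP (bigmax_leqP _ _ _)) => h i //; apply: h. Qed.

Lemma inbox_intP N (n : Zd) : reflect (forall i, - N%:Z <= n i <= N%:Z) (inbox N n).
Proof. by apply: (iffP (inboxP N n)) => h i; have := h i; lia. Qed.

Lemma inboxS N M n : (N <= M)%N -> inbox N n -> inbox M n.
Proof. by move=> NM h; apply: leq_trans NM. Qed.

Lemma supnorm_tri (m n : Zd) : (supnorm (m + n)%R <= supnorm m + supnorm n)%N.
Proof.
apply/bigmax_leqP => i _; rewrite ffunE.
have h1 := leq_bigmax (F := fun i => `|m i|%N) i.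
have h2 := leq_bigmax (F := fun i => `|n i|%N) i.
by apply: leq_trans (leq_add h1 h2); rewrite -lez_nat PoszD !abszE ler_normD.
Qed.

Lemma supnormN (n : Zd) : supnorm (- n) = supnorm n.
Proof. by apply: eq_bigr => i _; rewrite ffunE abszN. Qed.

Lemma inboxD N M m n : inbox N m -> inbox M n -> inbox (N + M)%N (m + n).
Proof. by move=> a b; rewrite /inbox (leq_trans (supnorm_tri _ _)) // leq_add. Qed.

Lemma inboxN N (n : Zd) : inbox N (- n) = inbox N n.
Proof. by rewrite /inbox supnormN. Qed.

Lemma inbox_evec j : inbox 1 (evec j).
Proof. by apply/inboxP => i; rewrite ffunE; case: eqP. Qed.

Lemma inbox_addS N n j : inbox N n -> inbox N.+1 (n + evec j).
Proof. by move=> h; rewrite -addn1 inboxD ?inbox_evec. Qed.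

Lemma inbox_subS N n j : inbox N n -> inbox N.+1 (n - evec j).
Proof. by move=> h; rewrite -addn1 inboxD ?inboxN ?inbox_evec. Qed.

Lemma inbox_bpt N (c : boxT d N) : inbox N (bpt c).
Proof. by apply/inbox_intP => i; rewrite ffunE; have := ltn_ord (c i); lia. Qed.

Lemma bpt_inj N : injective (@bpt d N).
Proof.
move=> c c' /ffunP h; apply/ffunP => i; apply/val_inj.
by have := h i; rewrite !ffunE /=; lia.
Qed.

Lemma bpt_surj N n : inbox N n -> exists c : boxT d N, bpt c = n.
Proof.
move/inbox_intP => h; exists [ffun i => inord `|(n i + N%:Z)%R|%N].
apply/ffunP => i; rewrite !ffunE; move: (h i); move: (n i) => z hz; rewrite inordK; lia.
Qed.

Definition box (N : nat) : seq Zd := [seq bpt c | c <- enum (boxT d N)].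

Lemma mem_box N n : (n \in box N) = inbox N n.
Proof.
apply/mapP/idP => [[c _ ->]|/bpt_surj[c <-]]; first exact: inbox_bpt.
by exists c; rewrite ?mem_enum.
Qed.

Lemma box_uniq N : uniq (box N).
Proof. by rewrite map_inj_uniq ?enum_uniq //; exact: bpt_inj. Qed.

Lemma size_box N : size (box N) = boxcard d N.
Proof. by rewrite size_map -cardE card_ffun !card_ord. Qed.

Lemma big_box (V : zmodType) N (f : Zd -> V) : \sum_(c : boxT d N) f (bpt c) = \sum_(n <- box N) f n.
Proof. by rewrite big_map big_enum. Qed.

Lemma lapE (V : zmodType) (x : Zd -> V) n :
  lap x n = \sum_(j < d) ((x n - x (n + evec j)) + (x n - x (n - evec j))).
Proof.
have -> : lap x n = \sum_(j < d) (x n *+ 2) - \sum_(j < d) (x (n + evec j) + x (n - evec j)).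
  by rewrite sumr_const card_ord -mulrnA.
by rewrite -sumrB; apply: eq_bigr => j _; rewrite addrACA -opprD.
Qed.

Lemma addevecE (n : Zd) j k : (n + evec j) k = n k + (k == j)%:Z.
Proof. by rewrite !ffunE. Qed.

Lemma subevecE (n : Zd) j k : (n - evec j) k = n k - (k == j)%:Z.
Proof. by rewrite !ffunE. Qed.

Lemma lap_coord (V : zmodType) (f : int -> V) i n :
  lap (fun m : Zd => f (m i)) n = (f (n i) - f (n i + 1)) + (f (n i) - f (n i - 1)).
Proof.
rewrite lapE (bigD1 i) //= addevecE subevecE eqxx big1 ?addr0 // => j ji.
have ij : (i == j) = false by rewrite eq_sym (negbTE ji).
by rewrite addevecE subevecE ij oppr0 addr0 !subrr addr0.
Qed.

Lemma lap_sq (V : comPzRingType) i n : lap (fun m : Zd => (m i)%:~R ^+ 2 : V) n = - 2.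
Proof. by rewrite (lap_coord (fun k => k%:~R ^+ 2 : V)) intrD intrB; ring. Qed.

Lemma seq_argmax (V : realDomainType) (T : eqType) (f : T -> V) (s : seq T) :
  s != [::] -> exists2 x, x \in s & forall y, y \in s -> f y <= f x.
Proof.
elim: s => // a s IH _; have [->|/IH [x xs hx]] := eqVneq s [::].
  by exists a; rewrite ?mem_head // => y; rewrite inE => /eqP ->.
have [le|lt] := leP (f a) (f x).
  by exists x; rewrite ?inE ?xs ?orbT // => y; rewrite inE => /orP[/eqP ->//|/hx].
exists a; rewrite ?mem_head // => y; rewrite inE => /orP[/eqP ->//|/hx h].
exact: le_trans h (ltW lt).
Qed.

(* Among the maximisers of [z] take one with largest [i]-th coordinate: its neighbour in
   direction [i] is strictly smaller, which contradicts superharmonicity of [-z]. *)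
Lemma max_principle (V : realDomainType) (D : seq Zd) (z : Zd -> V) B (i : 'I_d) :
  (forall n, n \in D -> lap z n <= 0) ->
  (forall n j, n \in D -> (n + evec j \notin D -> z (n + evec j) <= B) /\
                          (n - evec j \notin D -> z (n - evec j) <= B)) ->
  forall n, n \in D -> z n <= B.
Proof.
move=> hl hb n nD; rewrite leNgt; apply/negP => ltB.
have [|n0 n0D max0] := @seq_argmax _ _ z D; first by case: D nD {hl hb}.
have lt0 : B < z n0 by apply: lt_le_trans ltB (max0 _ nD).
have [|n1] := @seq_argmax _ _ (fun m : Zd => m i) [seq m <- D | z m == z n0].
  by rewrite -has_filter; apply/hasP; exists n0.
rewrite mem_filter => /andP[/eqP e1 n1D] max1.
suff : 0 < lap z n1 by rewrite ltNge hl.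
have le1 m : (m \notin D -> z m <= B) -> z m <= z n0.
  by case: (boolP (m \in D)) => [/max0//|_ /(_ isT) h]; exact: le_trans h (ltW lt0).
have leP j : 0 <= z n1 - z (n1 + evec j).
  by rewrite subr_ge0 e1 le1 //; case: (hb n1 j n1D).
have leM j : 0 <= z n1 - z (n1 - evec j).
  by rewrite subr_ge0 e1 le1 //; case: (hb n1 j n1D).
rewrite lapE (bigD1 i) //= ltr_pwDl //; last first.
  by apply: sumr_ge0 => j _; rewrite addr_ge0.
rewrite ltr_pwDl // subr_gt0 e1; have [iD|iD] := boolP (n1 + evec i \in D).
  rewrite lt_neqAle max0 // andbT; apply/negP => /eqP ez.
  have := max1 (n1 + evec i); rewrite mem_filter ez eqxx iD => /(_ isT).
  by rewrite addevecE eqxx; lia.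
by apply: le_lt_trans lt0; case: (hb n1 i n1D) => /(_ iD).
Qed.

(** Adding C n_i^2, whose Laplacian is -2C, turns the hypothesis into that of [max_principle]; just
    outside the box the added term is at most C (N+1)^2. *)
Lemma box_bound (V : realDomainType) N (z : Zd -> V) B C (i : 'I_d) : 0 <= C ->
  (forall n, inbox N n -> lap z n <= C * 2) ->
  (forall n, ~~ inbox N n -> inbox N.+1 n -> z n <= B) ->
  forall n, inbox N n -> z n + C * (n i)%:~R ^+ 2 <= B + C * N.+1%:R ^+ 2.
Proof.
move=> C0 hl hb n nN.
have sqle m : inbox N.+1 m -> C * (m i)%:~R ^+ 2 <= C * N.+1%:R ^+ 2.
  move=> /inbox_intP /(_ i) h; apply: ler_wpM2l => //.
  by rewrite -[N.+1%:R]/((N.+1%:Z)%:~R) -!rmorphXn /= ler_int; nia.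
have out m : m \notin box N -> inbox N.+1 m -> z m + C * (m i)%:~R ^+ 2 <= B + C * N.+1%:R ^+ 2.
  by rewrite mem_box => a b; rewrite lerD ?hb ?sqle.
apply: (@max_principle _ (box N) (fun m => z m + C * (m i)%:~R ^+ 2) _ i).
- move=> m; rewrite mem_box => mN.
  rewrite lapD (lapMl (fun m : Zd => (m i)%:~R ^+ 2)) lap_sq mulrN subr_le0.
  exact: hl.
- by move=> m j; rewrite mem_box => mN; split => h; apply: out; rewrite ?inbox_addS ?inbox_subS.
- by rewrite mem_box.
Qed.

Lemma box_bound_abs (V : realDomainType) N (z : Zd -> V) B C (i : 'I_d) : 0 <= C ->
  (forall n, inbox N n -> `|lap z n| <= C * 2) ->
  (forall n, ~~ inbox N n -> inbox N.+1 n -> `|z n| <= B) ->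
  forall n, inbox N n -> `|z n| + C * (n i)%:~R ^+ 2 <= B + C * N.+1%:R ^+ 2.
Proof.
move=> C0 hl hb n nN; rewrite -lerBrDr ler_norml lerNl !lerBrDr; apply/andP; split; last first.
  apply: (box_bound i C0) nN => m mN; first by have := hl m mN; rewrite ler_norml => /andP[].
  by move=> /(hb m mN); rewrite ler_norml => /andP[].
apply: (@box_bound _ N (fun m => - z m) B C i C0 _ _ n nN) => m mN.
  by rewrite lapN lerNl; have := hl m mN; rewrite ler_norml => /andP[].
by move=> /(hb m mN); rewrite lerNl ler_norml => /andP[].
Qed.

(** Vanishing off the box leaves no boundary terms: both sides are the same sum over pairs of box
    points that differ by [e]. *)
Lemma box_shift (V : comPzRingType) N (x y : Zd -> V) e :
  (forall n, ~~ inbox N n -> x n = 0) -> (forall n, ~~ inbox N n -> y n = 0) ->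
  \sum_(c : boxT d N) x (bpt c) * y (bpt c + e) = \sum_(c : boxT d N) y (bpt c) * x (bpt c - e).
Proof.
move=> hx hy.
have pt (z : Zd -> V) m : (forall n, ~~ inbox N n -> z n = 0) ->
    z m = \sum_(c : boxT d N | bpt c == m) z (bpt c).
  move=> hz; have [/bpt_surj[c <-]|o] := boolP (inbox N m).
    by rewrite (big_pred1 c) // => c'; rewrite /= (inj_eq (@bpt_inj N)).
  by rewrite big_pred0 ?hz // => c; apply/negP => /eqP e'; rewrite -e' inbox_bpt in o.
under eq_bigr => c _ do rewrite (pt y _ hy) mulr_sumr.
under [RHS]eq_bigr => c _ do rewrite (pt x _ hx) mulr_sumr.
rewrite (exchange_big_dep predT) //=; apply: eq_bigr => c _.
by apply: eq_big => [c'|c' _]; rewrite ?[_ == bpt c - e]eq_sym ?subr_eq // mulrC.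
Qed.

Lemma lap_sym (V : comPzRingType) N (x y : Zd -> V) :
  (forall n, ~~ inbox N n -> x n = 0) -> (forall n, ~~ inbox N n -> y n = 0) ->
  \sum_(c : boxT d N) x (bpt c) * lap y (bpt c) = \sum_(c : boxT d N) y (bpt c) * lap x (bpt c).
Proof.
move=> hx hy; rewrite /lap.
under eq_bigr => c _ do rewrite mulrBr mulrnAr mulr_sumr.
under [RHS]eq_bigr => c _ do rewrite mulrBr mulrnAr mulr_sumr [y _ * _]mulrC.
rewrite !sumrB; congr (_ - _); rewrite exchange_big [RHS]exchange_big /=; apply: eq_bigr => j _.
under eq_bigr => c _ do rewrite mulrDr.
under [RHS]eq_bigr => c _ do rewrite mulrDr.
rewrite !big_split /= (box_shift (evec j) hx hy) (box_shift (- evec j) hx hy) addrC.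
by under [X in X + _]eq_bigr => c _ do rewrite opprK.
Qed.

End Boxes.

(** * Superstable configurations *)

Section Superstable.
Variable d : nat.
Local Notation Zd := (Zd d).
Local Notation evec := (@evec d).

Definition supp (V : zmodType) N (h : Zd -> V) := forall n, ~~ inbox N n -> h n = 0.
Definition ind (F : seq Zd) (n : Zd) : int := (n \in F)%:Z.

(** The superstable configurations (parking functions) of the box with its complement as sink:
    firing any nonempty set once makes one of its sites negative. *)
Definition superstable N (p : Zd -> int) :=
  (forall n, inbox N n -> 0 <= p n) /\
  (forall F : seq Zd, F != [::] -> {subset F <= box d N} -> exists2 n, n \in F & p n < lap (ind F) n).

Lemma lap_ind F n : n \in F -> lap (ind F) n = (2 * d)%:Z - (NF F n)%:Z.
Proof.
move=> nF; rewrite /lap /ind nF; congr (_ - _).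
  by rewrite -mulr_natr mul1r natz.
rewrite /NF -!natz natr_sum; apply: eq_bigr => j _.
by rewrite natrD !natz.
Qed.

Lemma lap_ind_out F n : n \notin F -> lap (ind F) n <= 0.
Proof.
move=> nF; rewrite lapE; apply: sumr_le0 => j _.
by rewrite /ind (negbTE nF) !sub0r -opprD oppr_le0 addr_ge0.
Qed.

Definition wbarrier N (i : 'I_d) (n : Zd) : int :=
  if inbox N n then N.+1%:Z ^+ 2 - (n i) ^+ 2 else 0.

(** The uncut quadratic [q] has Laplacian 2. Cutting it to 0 outside the box only lowers values at
    neighbours, which can only raise the Laplacian inside. *)
Lemma lap_wbarrier N i n : inbox N n -> 2 <= lap (wbarrier N i) n.
Proof.
move=> nN; pose q := fun m : Zd => N.+1%:Z ^+ 2 - (m i) ^+ 2.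
have q2 : lap q n = 2 by rewrite (lap_coord (fun k => N.+1%:Z ^+ 2 - k ^+ 2) i); ring.
rewrite -q2 !lapE; apply: ler_sum => j _.
have le m : inbox N.+1 m -> wbarrier N i m <= q m.
  rewrite /wbarrier /q; case: ifP => // _ /inbox_intP /(_ i); nia.
have e : wbarrier N i n = q n by rewrite /wbarrier nN.
by rewrite e lerD // lerB // le // ?inbox_addS ?inbox_subS.
Qed.

Lemma wbarrier_ge0 N i n : 0 <= wbarrier N i n.
Proof. by rewrite /wbarrier; case: ifP => // /inbox_intP /(_ i); nia. Qed.

Lemma supp_wbarrier N i : supp N (wbarrier N i).
Proof. by move=> n h; rewrite /wbarrier (negbTE h). Qed.

Lemma supp_ind N F : {subset F <= box d N} -> supp N (ind F).
Proof.
move=> sF n nN; rewrite /ind; case: (boolP (n \in F)) => // /sF.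
by rewrite mem_box (negbTE nN).
Qed.

(* Firing a set [F] that keeps the configuration nonnegative strictly lowers its pairing with a
   function [wbarrier] having positive Laplacian, so the process of such firings terminates. *)
Lemma superstable_exists_aux (N : nat) (i : 'I_d) (v : Zd -> int) (m : nat) (h : Zd -> int) :
  supp N h -> (forall n, inbox N n -> 0 <= v n - lap h n) ->
  \sum_(c : boxT d N) wbarrier N i (bpt c) * (v (bpt c) - lap h (bpt c)) < m%:Z ->
  exists2 h', supp N h' & superstable N (fun n => v n - lap h' n).
Proof.
elim: m h => [|m IH] h sh ph lt.
  move: lt; rewrite ltNge sumr_ge0 // => c _.
  by rewrite mulr_ge0 ?wbarrier_ge0 ?ph ?inbox_bpt.
have [ss|nss] := pselect (superstable N (fun n => v n - lap h n)); first by exists h.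
have [F [F0 sF hF]] : exists F : seq Zd, [/\ F != [::], {subset F <= box d N} &
    forall n, n \in F -> lap (ind F) n <= v n - lap h n].
  apply: contra_notP nss => nF; split => // F F0 sF; apply: contra_notP nF => nF.
  exists F; split => // n nF'; rewrite leNgt; apply/negP => lt'; apply: nF; by exists n.
apply: (IH (fun n => h n + ind F n)) => [n nN|n nN|].
- by rewrite sh // (supp_ind sF) // addr0.
- rewrite lapD opprD addrA subr_ge0; have [nF|nF] := boolP (n \in F); first exact: hF.
  by apply: le_trans (lap_ind_out nF) (ph _ nN).
under eq_bigr => c _ do rewrite lapD opprD addrA mulrBr.
rewrite sumrB (lap_sym (@supp_wbarrier N i) (supp_ind sF)).
have : 1 <= \sum_(c : boxT d N) ind F (bpt c) * lap (wbarrier N i) (bpt c).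
  have ge0 (c : boxT d N) : 0 <= ind F (bpt c) * lap (wbarrier N i) (bpt c).
    rewrite mulr_ge0 ?(le_trans _ (lap_wbarrier i _)) ?inbox_bpt //.
  case: F F0 sF hF ge0 => // f F _ sF _ ge0.
  have [c cf] : exists c : boxT d N, bpt c = f.
    by apply: bpt_surj; rewrite -mem_box sF // mem_head.
  rewrite (bigD1 c) //= -[1]addr0 lerD ?sumr_ge0 //.
  rewrite /ind {1}cf mem_head mul1r.
  by apply: le_trans (lap_wbarrier i _); rewrite ?inbox_bpt.
by rewrite ltrBlDr => T1; apply: lt_le_trans lt _; rewrite intS addrC lerD2l.
Qed.

Lemma superstable_exists (N : nat) (i : 'I_d) (v : Zd -> int) :
  exists2 h, supp N h & superstable N (fun n => v n - lap h n).
Proof.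
pose K := \sum_(c : boxT d N) `|v (bpt c)|.
(* This start adds at least [K] to every site of the box, which outweighs the negative values of
   [v]. *)
pose h n := - K * wbarrier N i n.
have K0 : 0 <= K by apply: sumr_ge0.
have lapv n : inbox N n -> 0 <= v n - lap h n.
  move=> nN; rewrite lapMl mulNr opprK; have [c cn] := bpt_surj nN.
  have : `|v n| <= K by rewrite /K (bigD1 c) //= cn lerDl sumr_ge0.
  rewrite ler_norml => /andP[lb _].
  by rewrite -[0](addNr K) lerD // ler_peMr // (le_trans _ (lap_wbarrier i nN)).
pose S := \sum_(c : boxT d N) wbarrier N i (bpt c) * (v (bpt c) - lap h (bpt c)).
apply: (@superstable_exists_aux N i v `|S|.+1 h) => //; last by rewrite -/S; lia.
by move=> n nN; rewrite /h supp_wbarrier // mulr0.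
Qed.

(** If [h] were positive somewhere, let F be the set where it is maximal. Being integral, [h] drops
    by at least 1 on leaving F, so [lap (ind F) <= lap h <= p] on F, and F could be fired. *)
Lemma superstable_le0 N (p h : Zd -> int) : supp N h ->
  superstable N p -> (forall n, inbox N n -> 0 <= p n - lap h n) -> forall n, h n <= 0.
Proof.
move=> sh [_ ss] pos n; rewrite leNgt; apply/negP => hn.
have nN : n \in box d N.
  by rewrite mem_box; apply: contraLR hn => /sh ->; rewrite ltxx.
have [|m mN max] := @seq_argmax _ _ h (box d N); first by case: (box d N) nN.
have hm : 0 < h m by apply: lt_le_trans hn (max _ nN).
pose F := [seq k <- box d N | h k == h m].
have F0 : F != [::] by rewrite -has_filter; apply/hasP; exists m.
have sF : {subset F <= box d N} by move=> k; rewrite mem_filter => /andP[].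
have [k kF] := ss F F0 sF; rewrite ltNge => /negP; apply.
have /andP[/eqP ek kN] : (h k == h m) && (k \in box d N) by move: kF; rewrite mem_filter.
have := pos k; rewrite -mem_box kN subr_ge0 => /(_ isT); apply: le_trans.
rewrite !lapE; apply: ler_sum => j _.
have key l : ind F k - ind F l <= h k - h l.
  rewrite /ind kF; have [lF|lF] := boolP (l \in F).
    by move: lF; rewrite mem_filter ek => /andP[/eqP -> _]; lia.
  have [lN|lN] := boolP (l \in box d N); last first.
    by rewrite (sh l) -?mem_box // ek; lia.
  have := max l lN; move: lF; rewrite mem_filter lN andbT ek; lia.
by rewrite lerD ?key.
Qed.

Lemma superstable_unique N (p p' h : Zd -> int) : supp N h ->
  superstable N p -> superstable N p' -> (forall n, inbox N n -> p' n = p n - lap h n) ->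
  forall n, h n = 0.
Proof.
move=> sh sp sp' e n; apply/eqP; rewrite eq_le; apply/andP; split.
  by apply: (superstable_le0 sh sp) => k kN; rewrite -e //; case: sp' => /(_ k kN).
rewrite -oppr_le0; apply: (@superstable_le0 N p' (fun n => - h n)) => //.
  by move=> k /sh ->; rewrite oppr0.
by move=> k kN; rewrite lapN opprK e // subrK; case: sp => /(_ k kN).
Qed.

Definition recurrent N (u : Zd -> nat) :=
  (forall n, inbox N n -> (u n <= (2 * d).-1)%N) /\
  (forall F : seq Zd, F != [::] -> {subset F <= box d N} -> exists2 n, n \in F & (NF F n <= u n)%N).

(** Duality of recurrent and superstable configurations under u -> 2d-1-u: on F the Laplacian of its
    indicator is [2 * d - NF F], so the two inequalities are the same. *)
Lemma recurrent_superstable N u : (0 < d)%N -> recurrent N u ->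
  superstable N (fun n => ((2 * d).-1)%:Z - (u n)%:Z).
Proof.
move=> d0 [hu hF]; split=> [n /hu|F F0 sF]; first by rewrite subr_ge0 lez_nat.
have [n nF le] := hF F F0 sF; exists n => //; rewrite lap_ind //; move: le; lia.
Qed.

Lemma superstable_recurrent N p : (0 < d)%N -> superstable N p ->
  exists2 u, recurrent N u & forall n, inbox N n -> p n = ((2 * d).-1)%:Z - (u n)%:Z.
Proof.
move=> d0 [hp hF].
(* The one-point sets give the upper bound. *)
have lt n : inbox N n -> p n < (2 * d)%:Z.
  move=> nN; have [||m] := hF [:: n] => //.
    by move=> k; rewrite inE => /eqP ->; rewrite mem_box.
  rewrite inE => /eqP ->; rewrite lap_ind ?mem_head //; lia.
have e n : inbox N n -> p n = ((2 * d).-1)%:Z - `|((2 * d).-1)%:Z - p n|%:Z.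
  by move=> nN; have := lt n nN; have := hp n nN; lia.
exists (fun n => `|((2 * d).-1)%:Z - p n|%N) => //; split=> [n nN|F F0 sF].
  by have := lt n nN; have := hp n nN; lia.
have [n nF ltn] := hF F F0 sF; exists n => //.
have nN : inbox N n by rewrite -mem_box sF.
by move: ltn; rewrite lap_ind //; have := e n nN; have := lt n nN; have := hp n nN; lia.
Qed.

Lemma recurrent_exists N (i : 'I_d) (v : Zd -> int) :
  exists h u, [/\ supp N h, recurrent N u & forall n, inbox N n -> (u n)%:Z = v n - lap h n].
Proof.
have d0 : (0 < d)%N by case: i => ? /(leq_trans _); apply.
have [h sh /(superstable_recurrent d0)[u ru e]] :=
  superstable_exists N i (fun n => ((2 * d).-1)%:Z - v n).
exists (fun n => - h n), u; split=> // [n /sh ->|n nN]; rewrite ?oppr0 // lapN.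
by have := e n nN; lia.
Qed.

Lemma recurrent_unique N (i : 'I_d) u u' h : supp N h -> recurrent N u -> recurrent N u' ->
  (forall n, inbox N n -> (u' n)%:Z = (u n)%:Z - lap h n) -> forall n, h n = 0.
Proof.
have d0 : (0 < d)%N by case: i => ? /(leq_trans _); apply.
move=> sh /(recurrent_superstable d0) s1 /(recurrent_superstable d0) s2 e n.
apply: oppr_inj; rewrite oppr0.
apply: (@superstable_unique N _ _ (fun n => - h n) _ s1 s2) => [k /sh ->|k kN]; first by rewrite oppr0.
by rewrite lapN e //; lia.
Qed.

Lemma Rinf_recurrent N v : Rinf v -> recurrent N v.
Proof. by move=> [h1 h2]; split=> [n _|F F0 _]; [exact: h1|exact: h2]. Qed.

(** Outside the box the value is maximal. If F leaves the box along coordinate j, a point of F with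
    largest |n_j| lies outside the box and lacks at least one neighbour in F, so it has at most 2d-1
    of them. *)
Lemma recurrent_extend N (i : 'I_d) u : recurrent N u ->
  Rinf (fun n => if inbox N n then u n else (2 * d).-1).
Proof.
move=> [h1 h2]; split=> [n|F F0]; first by case: ifP => // /h1.
have [sF|] := pselect ({subset F <= box d N}).
  by have [n nF le] := h2 F F0 sF; exists n => //; rewrite -mem_box sF.
move=> /existsNP[n /not_implyP[nF /negP]]; rewrite mem_box => nN.
have [j nj] : exists j, (N < `|n j|)%N.
  apply: contrapT => /forallNP h; move/negP: nN; apply; apply/inboxP => j.
  by rewrite leqNgt; apply/negP.
have [|m] := @seq_argmax _ _ (fun m : Zd => (`|m j|)%:Z) F => //.
move=> mF max; have mN : ~~ inbox N m.
  apply/negP => /inboxP /(_ j) mj; have := max n nF; rewrite lez_nat => le.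
  by have := leq_trans nj (leq_trans le mj); rewrite ltnn.
exists m => //; rewrite (negbTE mN).
have : (NF F m < 2 * d)%N; last by lia.
have -> : (2 * d = \sum_(k < d) 2)%N by rewrite sum_nat_const card_ord mulnC.
rewrite /NF (bigD1 j) //= [X in (_ < X)%N](bigD1 j) //=.
rewrite -addSn leq_add //; last by apply: leq_sum => k _; do 2 case: (_ \in _).
have : ((m + evec j)%R \notin F) || ((m - evec j)%R \notin F); last first.
  by do 2 case: (_ \in _).
rewrite -negb_and; apply/negP => /andP[a b].
by have := max _ a; have := max _ b; rewrite addevecE subevecE eqxx; lia.
Qed.

End Superstable.

(** * Counting recurrent patterns *)

Section SmithCount.

Lemma absz_det_unit n (A : 'M[int]_n) : A \in unitmx -> `|\det A|%N = 1%N.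
Proof.
move=> Au; have := congr1 (fun B => `|\det B|%N) (mulmxV Au).
by rewrite /= det_mulmx det1 abszM => /eqP; rewrite muln_eq1 => /andP[/eqP].
Qed.

(** The hypotheses make [s] a system of representatives of the cokernel of [A]; Smith normal form
    turns this cokernel into a product of cyclic groups. *)
Lemma card_smith_reps (T : finType) n (A : 'M[int]_n) (s : T -> 'cV[int]_n) :
  \det A != 0 ->
  (forall v, exists t h, v = s t + A *m h) ->
  (forall t t' h, s t = s t' + A *m h -> t = t') ->
  #|T| = `|\det A|%N.
Proof.
move=> detA sur inj; have [L Lu [U Uu [e _ eA]]] := int_Smith_normal_form A.
set D := \matrix_(i, j) _ in eA; pose dd (i : 'I_n) : int := e`_i.
have eD : D = diag_mx (\row_i dd i) by apply/matrixP => i j; rewrite !mxE.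
have detD : `|\det A|%N = (\prod_(i < n) `|dd i|%N)%N.
  rewrite eA !det_mulmx !abszM (absz_det_unit Lu) (absz_det_unit Uu) mul1n muln1 eD det_diag.
  by elim/big_rec2: _ => //= i y z _ <-; rewrite mxE abszM.
have e0 (i : 'I_n) : dd i != 0.
  have : (0 < `|\det A|)%N by rewrite absz_gt0.
  by rewrite detD (bigD1 i) //= muln_gt0 absz_gt0 => /andP[].
pose K := (\max_(i < n) `|dd i|)%N.
(* In the Smith coordinates the residues modulo the diagonal entries form a complete invariant of
   the class of [v]. *)
pose r (v : 'cV[int]_n) (i : 'I_n) := ((invmx L *m v) i 0%R %% dd i)%Z.
have r_ge0 v i : 0 <= r v i by rewrite modz_ge0.
have r_lt v i : (`|r v i| < `|dd i|)%N by have := ltz_mod ((invmx L *m v) i 0) (e0 i); have := r_ge0 v i; rewrite /r; lia.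
have leK (i : 'I_n) : (`|dd i| <= K)%N by exact: (@leq_bigmax _ (fun i : 'I_n => `|dd i|%N) i).
have rA v h i : r (v + A *m h) i = r v i.
  rewrite /r eA mulmxDr -!mulmxA mulKmx // mxE eD mul_diag_mx [X in _ + X]mxE [(\row_i _) _ _]mxE.
  by rewrite addrC mulrC modzMDl.
have rP v v' : (forall i, r v i = r v' i) -> exists h, v = v' + A *m h.
  move=> h; pose z := \col_i (((invmx L *m v) i 0%R - (invmx L *m v') i 0%R) %/ dd i)%Z.
  exists (invmx U *m z); rewrite eA -!mulmxA mulKVmx //.
  have e' : invmx L *m v = invmx L *m v' + D *m z.
    apply/colP => i; rewrite [RHS]mxE eD mul_diag_mx [(\matrix_(_, _) _) i 0]mxE [(\row_i _) 0 i]mxE [z i 0]mxE.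
    rewrite mulrC divzK; first by rewrite addrC subrK.
    by rewrite -eqz_mod_dvd; apply/eqP; exact: h.
  by rewrite -{1}[v](mulKVmx Lu) e' mulmxDr mulKVmx.
pose f t : {ffun 'I_n -> 'I_K.+1} := [ffun i => inord `|r (s t) i|%N].
have fE t i : f t i = `|r (s t) i|%N :> nat by rewrite ffunE inordK // ltnS (leq_trans (ltnW (r_lt _ _))).
have finj : injective f.
  move=> t t' ff; have [|h hh] := rP (s t) (s t'); last exact: inj hh.
  move=> i; have := fE t i; rewrite ff fE.
  by have := r_ge0 (s t) i; have := r_ge0 (s t') i; lia.
pose F (i : 'I_n) := [pred x : 'I_K.+1 | (x < `|dd i|)%N].
have -> : #|T| = #|family F|.
  rewrite -(card_codom finj); apply: eq_card => g; apply/codomP/familyP.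
    by case=> t -> i; rewrite inE fE r_lt.
  move=> gF; have [t [h eh]] := sur (L *m \col_i (g i)%:Z).
  exists t; apply/ffunP => i; apply/val_inj; rewrite /= fE.
  have := rA (s t) h i; rewrite -eh /r mulKmx // mxE => <-.
  rewrite -modz_abs modz_small //; have := gF i; rewrite inE; lia.
rewrite card_family detD -[RHS]big_enum /= foldrE big_map big_enum /= big_enum.
apply: eq_bigr => i _; rewrite -sum1_card big_ord_narrow; first exact: leqW (leK i).
by rewrite sum1_card card_ord.
Qed.

End SmithCount.

(** * The Dirichlet Laplacian of a box as a matrix *)

Section LaplacianMatrix.
Variable d : nat.
Local Notation Zd := (Zd d).
Local Notation evec := (@evec d).

Lemma lap_sum (V : zmodType) (I : finType) (F : I -> Zd -> V) n :
  lap (fun m => \sum_i F i m) n = \sum_i lap (F i) n.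
Proof.
rewrite /lap sumrB sumrMnl; congr (_ - _); rewrite exchange_big /=.
by apply: eq_bigr => j _; rewrite big_split.
Qed.

Definition bidx N (i : 'I_#|boxT d N|) : Zd := bpt (enum_val i).

Definition colv (V : zmodType) N (h : Zd -> V) : 'cV[V]_#|boxT d N| := \col_i h (bidx i).

(** The point masses are 0 off the box, which imposes zero boundary values. *)
Definition lapmx (V : nzRingType) N : 'M[V]_#|boxT d N| :=
  \matrix_(i, j) lap (fun m => (m == bidx j)%:R) (bidx i).

Lemma bidx_inbox N (i : 'I_#|boxT d N|) : inbox N (bidx i).
Proof. exact: inbox_bpt. Qed.

Lemma bidx_surj N n : inbox N n -> exists i : 'I_#|boxT d N|, bidx i = n.
Proof. by move/bpt_surj => [c <-]; exists (enum_rank c); rewrite /bidx enum_rankK. Qed.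

Lemma bidx_inj N : injective (@bidx N).
Proof. by move=> i j /bpt_inj /enum_val_inj. Qed.

Lemma supp_sum (V : comNzRingType) N (h : Zd -> V) : supp N h ->
  forall n, h n = \sum_(j < #|boxT d N|) h (bidx j) * (n == bidx j)%:R.
Proof.
move=> sh n; have [/bidx_surj[i <-]|o] := boolP (inbox N n).
  rewrite (bigD1 i) //= eqxx mulr1 big1 ?addr0 // => j ji.
  by rewrite (inj_eq (@bidx_inj N)) eq_sym (negbTE ji) mulr0.
rewrite sh // big1 // => j _; case: eqP => [e|]; last by rewrite mulr0.
by rewrite e bidx_inbox in o.
Qed.

Lemma lapmx_colv (V : comNzRingType) N (h : Zd -> V) : supp N h ->
  lapmx V N *m colv N h = colv N (lap h).
Proof.
move=> sh; apply/colP => i; rewrite !mxE.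
rewrite (eq_lap (supp_sum sh)) lap_sum; apply: eq_bigr => j _.
by rewrite !mxE mulrC -lapMl.
Qed.

Lemma map_lapmx (V : nzRingType) N : map_mx (fun z : int => z%:~R : V) (lapmx int N) = lapmx V N.
Proof.
apply/matrixP => i j; rewrite !mxE -(lap_morph (intr : int -> V)).
by apply: eq_lap => m; case: eqP.
Qed.

Definition extv (V : zmodType) N (x : 'cV[V]_#|boxT d N|) (n : Zd) : V :=
  \sum_(i | bidx i == n) x i 0.

Lemma extv_bidx (V : zmodType) N (x : 'cV[V]_#|boxT d N|) i : extv x (bidx i) = x i 0.
Proof. by rewrite /extv (big_pred1 i) // => j; rewrite /= (inj_eq (@bidx_inj N)). Qed.

Lemma supp_extv (V : zmodType) N (x : 'cV[V]_#|boxT d N|) : supp N (extv x).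
Proof.
move=> n nN; rewrite /extv big_pred0 // => j.
by apply/negP => /eqP e; rewrite -e bidx_inbox in nN.
Qed.

Lemma colv_extv (V : zmodType) N (x : 'cV[V]_#|boxT d N|) : colv N (extv x) = x.
Proof. by apply/colP => i; rewrite mxE extv_bidx. Qed.

End LaplacianMatrix.

(** * Diagonalisation of the Dirichlet Laplacian by products of sines *)

Section Eigen.
Variables (R : realType) (d : nat) (N : nat).
Local Notation Zd := (Zd d).
Local Notation evec := (@evec d).
Local Notation M := (N.*2.+1).

(** Chosen so that [sin (ang a * m)] vanishes at m = 0 and m = 2N+2, which are the coordinates -N-1
    and N+1 after the shift by N+1. *)
Definition ang (a : nat) : R := pi * a.+1%:R / M.+1%:R.

Lemma ang_itv (a : 'I_M) : 0 < ang a < pi.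
Proof.
rewrite /ang; apply/andP; split; first by rewrite divr_gt0 ?mulr_gt0 ?pi_gt0 ?ltr0n.
by rewrite ltr_pdivrMr ?ltr0n // ltr_pM2l ?pi_gt0 // ltr_nat ltnS.
Qed.

Lemma ang_inj (a b : 'I_M) : cos (ang a) = cos (ang b) -> a = b.
Proof.
have ia := ang_itv a; have ib := ang_itv b.
move=> /cos_inj; rewrite !in_itv /= => h.
have {h} : ang a = ang b.
  by apply: h; [move: ia|move: ib] => /andP[/ltW -> /ltW ->].
rewrite /ang => /(divIf _) h; apply/val_inj/eqP; rewrite /= -eqSS -(eqr_nat R).
have {}h : pi * a.+1%:R = pi * b.+1%:R :> R by apply: h; rewrite pnatr_eq0.
by move/mulfI: h => -> //; rewrite gt_eqF ?pi_gt0.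
Qed.

Definition wave (a : nat) (m : nat) : R := sin (ang a * m%:R).

Lemma wave0 a : wave a 0 = 0.
Proof. by rewrite /wave mulr0 sin0. Qed.

Lemma sin_natpi k : sin (pi * k%:R : R) = 0.
Proof.
elim: k => [|k IH]; first by rewrite mulr0 sin0.
by rewrite -natr1 mulrDr mulr1 sinD IH sinpi mul0r mulr0 addr0.
Qed.

Lemma waveL a : wave a M.+1 = 0.
Proof. by rewrite /wave /ang divfK ?pnatr_eq0 // sin_natpi. Qed.

Lemma sin_second (t x : R) : (sin x - sin (x + t)) + (sin x - sin (x - t)) = (2 - 2 * cos t) * sin x.
Proof. by rewrite sinD sinB; ring. Qed.

Lemma wave_second a m :
  (wave a m.+1 - wave a m.+2) + (wave a m.+1 - wave a m) = (2 - 2 * cos (ang a)) * wave a m.+1.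
Proof.
rewrite /wave -sin_second; congr (_ - sin _ + (_ - sin _)).
  by rewrite -(natr1 m.+1); ring.
by rewrite -(natr1 m); ring.
Qed.

(** Discrete Green identity: the difference of the eigenvalues times the scalar product telescopes
    to boundary values of the Wronskian [W], which are 0, and the eigenvalues differ. *)
Lemma wave_orth (a b : 'I_M) : a != b -> \sum_(i < M) wave a i.+1 * wave b i.+1 = 0.
Proof.
move=> ab; pose W i := wave a i.+1 * wave b i - wave a i * wave b i.+1.
have e : ((2 - 2 * cos (ang a)) - (2 - 2 * cos (ang b))) * (\sum_(i < M) wave a i.+1 * wave b i.+1)
    = \sum_(i < M) (W i - W i.+1).
  rewrite mulr_sumr; apply: eq_bigr => i _; rewrite mulrBl mulrA -wave_second.
  by rewrite [wave a _ * _]mulrC [in X in _ - X]mulrA -wave_second /W; ring.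
have {e} := e; rewrite -(big_mkord xpredT (fun i => W i - W i.+1)).
have -> : \sum_(0 <= i < M) (W i - W i.+1) = 0.
  under eq_bigr => i _ do rewrite -opprB.
  by rewrite sumrN telescope_sumr // /W !wave0 !waveL; ring.
move/eqP; rewrite mulf_eq0 => /orP[|/eqP //].
rewrite subr_eq0 => /eqP h; case/eqP: ab; apply: ang_inj; lra.
Qed.

Lemma wave_sq_gt0 (a : 'I_M) : 0 < \sum_(i < M) wave a i.+1 * wave a i.+1.
Proof.
rewrite (bigD1 ord0) //= ltr_pwDl ?sumr_ge0 // => [|i _]; last by rewrite -expr2 sqr_ge0.
by rewrite -expr2 exprn_gt0 // /wave mulr1 sin_gt0_pi // ang_itv.
Qed.

Definition eigval (k : boxT d N) : R := \sum_(j < d) (2 - 2 * cos (ang (k j))).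

Definition sfun (k : boxT d N) (n : Zd) : R :=
  \prod_(j < d) sin (ang (k j) * (n j + N.+1%:Z)%:~R).

Lemma lap_sfun k n : lap (sfun k) n = eigval k * sfun k n.
Proof.
rewrite lapE /eigval mulr_suml; apply: eq_bigr => j _.
have e (m : Zd) : sfun k m = sin (ang (k j) * (m j + N.+1%:Z)%:~R) *
    \prod_(l < d | l != j) sin (ang (k l) * (m l + N.+1%:Z)%:~R) by rewrite /sfun (bigD1 j).
have ep (e' : int) (m : Zd) : (forall l, l != j -> m l = n l) ->
    \prod_(l < d | l != j) sin (ang (k l) * (m l + N.+1%:Z)%:~R) =
    \prod_(l < d | l != j) sin (ang (k l) * (n l + N.+1%:Z)%:~R).
  by move=> h; apply: eq_bigr => l lj; rewrite h.
rewrite !e (ep 1 (n + _)); last by move=> l lj; rewrite addevecE (negbTE lj) addr0.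
rewrite (ep 1 (n - _)); last by move=> l lj; rewrite subevecE (negbTE lj) subr0.
rewrite addevecE subevecE eqxx mulrA -sin_second /=.
rewrite -!mulrBl -mulrDl; congr ((_ - sin _ + (_ - sin _)) * _).
  by rewrite !intrD; ring.
by rewrite !intrD; ring.
Qed.

Lemma sfun_border k n : ~~ inbox N n -> inbox N.+1 n -> sfun k n = 0.
Proof.
move=> nN /inbox_intP nS.
have [j nj] : exists j, (n j = N.+1%:Z) \/ (n j = - N.+1%:Z).
  apply: contrapT => /forallNP h; move/negP: nN; apply; apply/inbox_intP => j.
  by have := h j; have := nS j; lia.
rewrite /sfun (bigD1 j) //=; case: nj => ->.
  have -> : (N.+1%:Z + N.+1%:Z)%:~R = M.+1%:R :> R.
    by rewrite -[RHS]/((M.+1%:Z)%:~R); congr (_%:~R); lia.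
  by have := waveL (k j); rewrite /wave => ->; rewrite mul0r.
by rewrite addNr mulr0 sin0 mul0r.
Qed.

Lemma sfun_bpt k (c : boxT d N) : sfun k (bpt c) = \prod_(j < d) wave (k j) (c j).+1.
Proof.
apply: eq_bigr => j _; rewrite /wave; congr (sin (_ * _)).
by rewrite -[RHS]/(((c j).+1%:Z)%:~R); congr (_%:~R); rewrite ffunE; lia.
Qed.

Lemma sfun_orth k l : k != l -> \sum_(c : boxT d N) sfun k (bpt c) * sfun l (bpt c) = 0.
Proof.
move=> kl; have [j kj] : exists j, k j != l j.
  apply: contrapT => /forallNP h; case/eqP: kl; apply/ffunP => j; apply/eqP.
  by apply: contrapT => /negP; exact: h.
under eq_bigr => c _ do rewrite !sfun_bpt -big_split /=.
rewrite -(bigA_distr_bigA (fun j (i : 'I_M) => wave (k j) i.+1 * wave (l j) i.+1)).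
by rewrite (bigD1 j) //= wave_orth // mul0r.
Qed.

Lemma sfun_norm k : 0 < \sum_(c : boxT d N) sfun k (bpt c) * sfun k (bpt c).
Proof.
under eq_bigr => c _ do rewrite !sfun_bpt -big_split /=.
rewrite -(bigA_distr_bigA (fun j (i : 'I_M) => wave (k j) i.+1 * wave (k j) i.+1)).
by apply: prodr_gt0 => j _; exact: wave_sq_gt0.
Qed.

Definition sinmx : 'M[R]_#|boxT d N| := \matrix_(i, k) sfun (enum_val k) (bidx i).

Lemma det_sinmx : \det sinmx != 0.
Proof.
have e : sinmx^T *m sinmx = diag_mx (\row_k \sum_(c : boxT d N) sfun (enum_val k) (bpt c) ^+ 2).
  apply/matrixP => k l; rewrite !mxE.
  have -> : \sum_j sinmx^T k j * sinmx j l =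
      \sum_(c : boxT d N) sfun (enum_val k) (bpt c) * sfun (enum_val l) (bpt c).
    rewrite [RHS](reindex (fun i : 'I_#|boxT d N| => enum_val i)) /=; last first.
      by apply: onW_bij; exact: enum_val_bij.
    by apply: eq_bigr => i _; rewrite !mxE.
  have [<-|kl] := eqVneq k l; first by rewrite mulr1n; apply: eq_bigr => c _; rewrite expr2.
  by rewrite mulr0n sfun_orth // (inj_eq enum_val_inj).
have : \det (sinmx^T *m sinmx) != 0.
  rewrite e det_diag prodf_seq_neq0; apply/allP => k _ /=; rewrite mxE.
  by under eq_bigr => c _ do rewrite expr2; rewrite gt_eqF // sfun_norm.
by rewrite det_mulmx mulf_eq0 negb_or => /andP[].
Qed.

Lemma det_lapmx : \det (lapmx d R N) = \prod_(k : boxT d N) eigval k.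
Proof.
have e : lapmx d R N *m sinmx = sinmx *m diag_mx (\row_k eigval (enum_val k)).
  apply/matrixP => i k; rewrite mul_mx_diag [RHS]mxE !mxE.
  (* Truncation to the box does not change the Laplacian inside it, because [sfun] already vanishes
     on the first layer outside. *)
  pose h n := if inbox N n then sfun (enum_val k) n else 0.
  have sh : supp N h by move=> n nN; rewrite /h (negbTE nN).
  have := congr1 (fun x : 'cV_ _ => x i 0) (lapmx_colv sh); rewrite !mxE => e.
  have hl : lap h (bidx i) = lap (sfun (enum_val k)) (bidx i).
    have iN := bidx_inbox i.
    have hS n : inbox N.+1 n -> h n = sfun (enum_val k) n.
      by move=> nS; rewrite /h; case: ifPn => // nN; rewrite sfun_border.
    rewrite !lapE; apply: eq_bigr => j _.
    by rewrite !hS ?inbox_addS ?inbox_subS ?(inboxS (leqnSn N)).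
  rewrite hl lap_sfun in e; rewrite mulrC -e; apply: eq_bigr => j _.
  by rewrite !mxE /h bidx_inbox.
have := congr1 determinant e; rewrite !det_mulmx det_diag mulrC => /(mulfI det_sinmx) ->.
rewrite [RHS](reindex (fun i : 'I_#|boxT d N| => enum_val i)) /=; last first.
  by apply: onW_bij; exact: enum_val_bij.
by apply: eq_bigr => k _; rewrite mxE.
Qed.

Lemma eigval_gt0 k : (0 < d)%N -> 0 < eigval k.
Proof.
move=> d0; have pos (j : 'I_d) : 0 < 2 - 2 * cos (ang (k j)).
  have /andP[a0 api] := ang_itv (k j).
  have : cos (ang (k j)) < cos 0.
    by rewrite ltr_cos ?in_itv /= ?lexx ?pi_ge0 ?ltW.
  by rewrite cos0; lra.
rewrite /eigval (bigD1 (Ordinal d0)) //= ltr_pwDl // sumr_ge0 // => j _; exact: ltW.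
Qed.

Lemma det_lapmx_gt0 : (0 < d)%N -> 0 < \det (lapmx d R N).
Proof. by move=> d0; rewrite det_lapmx prodr_gt0 // => k _; exact: eigval_gt0. Qed.

Lemma det_lapmx_int : \det (lapmx d R N) = (\det (lapmx d int N))%:~R.
Proof. by rewrite -map_lapmx det_map_mx. Qed.

Lemma ln_prod (I : finType) (f : I -> R) : (forall i, 0 < f i) -> ln (\prod_i f i) = \sum_i ln (f i).
Proof.
move=> f0; suff [] : 0 < \prod_i f i /\ ln (\prod_i f i) = \sum_i ln (f i) by [].
elim/big_ind2: _ => [|x1 x2 y1 y2 [a ea] [b eb]|i _]; rewrite ?ln1 //.
by rewrite mulr_gt0 // lnM // ea eb.
Qed.

End Eigen.

(** * Recurrent patterns and the determinant *)

Section PatternCount.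
Variables (R : realType) (d : nat) (N : nat).
Hypothesis d0 : (0 < d)%N.
Local Notation Zd := (Zd d).
Local Notation K := (2 * d)%N.

Definition patfun (p : {ffun boxT d N -> 'I_K}) (n : Zd) : nat := \sum_(c | bpt c == n) p c.

Lemma patfun_bpt p c : patfun p (bpt c) = p c.
Proof. by rewrite /patfun (big_pred1 c) // => c'; rewrite /= (inj_eq (@bpt_inj d N)). Qed.

Definition is_recpat (p : {ffun boxT d N -> 'I_K}) : bool := `[< recurrent N (patfun p) >].

Lemma recurrent_ext u u' : (forall n, inbox N n -> u n = u' n) -> @recurrent d N u -> recurrent N u'.
Proof.
move=> e [h1 h2]; split=> [n nN|F F0 sF]; first by rewrite -e // h1.
by have [n nF le] := h2 F F0 sF; exists n => //; rewrite -e // -mem_box sF.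
Qed.

(** The global condition defining [Rinf] restricts to the box, and conversely [recurrent_extend]
    completes any recurrent pattern to a point of [Rinf]. *)
Lemma npatE : npat d N = #|[pred p | is_recpat p]|.
Proof.
apply: eq_card => p; rewrite [RHS]inE; apply/idP/asboolP.
  move=> /set_mem /= /asboolP[v vR e].
  apply: (@recurrent_ext v); last exact: Rinf_recurrent.
  by move=> n /bpt_surj[c <-]; rewrite patfun_bpt e.
move=> pr; apply/mem_set/asboolP.
exists (fun n => if inbox N n then patfun p n else (2 * d).-1).
  exact: (recurrent_extend (Ordinal d0)).
by move=> c; rewrite inbox_bpt patfun_bpt.
Qed.

Lemma recurrent_pattern u : recurrent N u ->
  exists2 p, is_recpat p & forall c : boxT d N, (p c : nat) = u (bpt c).
Proof.
move=> ru; have lt (c : boxT d N) : (u (bpt c) < K)%N.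
  by case: ru => h _; have := h (bpt c) (inbox_bpt c); lia.
pose p : {ffun boxT d N -> 'I_K} := [ffun c => Ordinal (lt c)].
have e (c : boxT d N) : patfun p (bpt c) = u (bpt c) by rewrite patfun_bpt ffunE.
exists p; last by move=> c; rewrite ffunE.
by apply/asboolP; apply: recurrent_ext ru => n /bpt_surj[c <-]; rewrite e.
Qed.

(** Each class modulo the image of [lapmx] contains a recurrent pattern by [recurrent_exists], and
    only one by [recurrent_unique]. *)
Lemma npat_det : npat d N = `|\det (lapmx d int N)|%N.
Proof.
rewrite npatE -card_sig.
pose s (t : {p | is_recpat p}) : 'cV[int]_#|boxT d N| := colv N (fun n => (patfun (val t) n)%:Z).
apply: (@card_smith_reps _ _ _ s).
- have := det_lapmx_gt0 R N d0; rewrite det_lapmx_int.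
  by rewrite ltr0z => /gt_eqF ->.
- move=> v; have [h [u [sh ru e]]] := recurrent_exists N (Ordinal d0) (extv v).
  have [p pr ep] := recurrent_pattern ru.
  exists (exist _ p pr), (colv N h); rewrite lapmx_colv //; apply/colP => i; rewrite !mxE /=.
  by rewrite patfun_bpt ep e ?bidx_inbox // extv_bidx subrK.
- move=> [t rt] [t' rt'] h /= e; apply/val_inj => /=.
  have sh := supp_extv h.
  have e' n : inbox N n -> (patfun t n)%:Z = (patfun t' n)%:Z - lap (fun n => - extv h n) n.
    move=> /bidx_surj[i <-]; rewrite lapN opprK.
    have := congr1 (fun x : 'cV_ _ => x i 0) e.
    have := lapmx_colv sh; rewrite colv_extv => ->.
    by rewrite !mxE.
  have h0 : forall n, - extv h n = 0.
    apply: (recurrent_unique (Ordinal d0) _ _ _ e'); [|exact/asboolP|exact/asboolP].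
    by move=> n /sh ->; rewrite oppr0.
  apply/ffunP => c; apply/val_inj; rewrite /= -!patfun_bpt.
  have := e' _ (inbox_bpt c); rewrite lapE big1 ?subr0 => [[]//|j _].
  by rewrite !h0 !subrr.
Qed.

Lemma npat_gt0 : (0 < npat d N)%N.
Proof.
rewrite npat_det absz_gt0; have := det_lapmx_gt0 R N d0; rewrite det_lapmx_int.
by rewrite ltr0z => /gt_eqF ->.
Qed.

Lemma ln_npat : ln ((npat d N)%:R : R) = \sum_(k : boxT d N) ln (eigval R k).
Proof.
rewrite -ln_prod; last by move=> k; exact: eigval_gt0.
rewrite -det_lapmx det_lapmx_int npat_det; congr ln.
have := det_lapmx_gt0 R N d0; rewrite det_lapmx_int ltr0z => h.
by rewrite natr_absz gtr0_norm.
Qed.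

Lemma dirichlet_solve (u : Zd -> R) :
  exists2 y : Zd -> R, supp N y & forall n, inbox N n -> lap y n = u n.
Proof.
have lu : lapmx d R N \in unitmx by rewrite unitmxE unitfE gt_eqF // det_lapmx_gt0.
exists (extv (invmx (lapmx d R N) *m colv N u)); first exact: supp_extv.
move=> n /bidx_surj[i <-].
have := congr1 (fun x : 'cV_ _ => x i 0) (lapmx_colv (supp_extv (invmx (lapmx d R N) *m colv N u))).
by rewrite colv_extv mulKVmx // !mxE.
Qed.

End PatternCount.

(** * One-dimensional integrals *)

Section UnitInterval.
Variable R : realType.
Notation mu := (@lebesgue_measure R).
Implicit Types (f g : R -> R) (s t : R).

Definition I01 f : R := Rintegral mu `[0%R, 1%R] f.
(** The interval is open so that integrands may be singular at 0 and 1, where their values are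
    arbitrary; [I01_open] shows that the endpoints do not affect [I01]. *)
Definition int01 f : Prop := mu.-integrable `]0%R, 1%R[ (EFin \o f).

Lemma lip_continuous f K (A : set R) : open A ->
  (forall s t, A s -> A t -> `|f s - f t| <= K * `|s - t|) -> {in A, continuous f}.
Proof.
move=> oA h s /set_mem As; apply/cvgrPdist_le => /= e e0.
have K0 : 0 < `|K| + 1 by rewrite ltr_wpDl.
have nA : nbhs s A by apply: open_nbhs_nbhs.
near=> t.
apply: le_trans (h _ _ As _) _; first by near: t; exact: nA.
apply: (@le_trans _ _ ((`|K| + 1) * `|s - t|)).
  by rewrite ler_wpM2r // (le_trans (ler_norm K)) // lerDl.
rewrite mulrC -ler_pdivlMr //; near: t.
have e1 : 0 < e / (`|K| + 1) by rewrite divr_gt0.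
by apply: filterS (nbhsx_ballx s _ e1) => x; rewrite /ball /= => /ltW.
Unshelve. all: by end_near. Qed.

Lemma lip_cont f K : (forall s t, `|f s - f t| <= K * `|s - t|) -> continuous f.
Proof.
move=> h s; have := @lip_continuous f K setT openT (fun s t _ _ => h s t).
by move/(_ s); apply; rewrite in_setT.
Qed.

Lemma cont_int01 f : continuous f -> int01 f.
Proof.
move=> cf; apply: (@integrableS _ _ _ _ (`[0%R, 1%R]%classic : set (measurableTypeR R))) => //.
  exact: subset_itv_oo_cc.
apply: continuous_compact_integrable; first exact: segment_compact.
exact: continuous_subspaceT.
Qed.

Lemma lip_int01 f K : (forall s t, `|f s - f t| <= K * `|s - t|) -> int01 f.
Proof. by move=> h; apply/cont_int01/lip_cont/h. Qed.

Lemma I01_cst c : I01 (fun=> c) = c.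
Proof. by rewrite /I01 Rintegral_cst //= lebesgue_measure_itv /= lte01 oppr0 adde0 mulr1. Qed.

Lemma int01_measurable f : int01 f -> measurable_fun (`]0%R, 1%R[ : set R) f.
Proof. by move=> /measurable_int /measurable_EFinP. Qed.

Lemma I01_open f : measurable_fun (`]0%R, 1%R[ : set R) f -> I01 f = Rintegral mu `]0%R, 1%R[ f.
Proof.
move=> mf; rewrite /I01 /Rintegral; congr fine.
rewrite integral_itv_bndo_bndc; last exact/measurable_EFinP.
rewrite integral_itv_obnd_cbnd //; apply/measurable_EFinP.
exact/measurable_fun_itv_bndo_bndcP.
Qed.

Lemma I01_int f : int01 f -> I01 f = Rintegral mu `]0%R, 1%R[ f.
Proof. by move/int01_measurable/I01_open. Qed.

Lemma int01D f g : int01 f -> int01 g -> int01 (fun s => f s + g s).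
Proof. by move=> hf hg; exact: integrableD hf hg. Qed.

Lemma int01Z f c : int01 f -> int01 (fun s => c * f s).
Proof. by move=> hf; exact: (integrableZl _ _ hf). Qed.

Lemma int01B f g : int01 f -> int01 g -> int01 (fun s => f s - g s).
Proof. by move=> hf hg; exact: integrableB hf hg. Qed.

Lemma int01_cst c : int01 (fun=> c).
Proof. by apply: (@lip_int01 _ 0) => s t; rewrite subrr normr0 mul0r. Qed.

Lemma I01D f g : int01 f -> int01 g -> I01 (fun s => f s + g s) = I01 f + I01 g.
Proof. by move=> hf hg; rewrite (I01_int hf) (I01_int hg) I01_int ?RintegralD //; exact: int01D. Qed.

Lemma I01B f g : int01 f -> int01 g -> I01 (fun s => f s - g s) = I01 f - I01 g.
Proof. by move=> hf hg; rewrite (I01_int hf) (I01_int hg) I01_int ?RintegralB //; exact: int01B. Qed.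

Lemma I01Z f c : int01 f -> I01 (fun s => c * f s) = c * I01 f.
Proof. by move=> hf; rewrite (I01_int hf) I01_int ?RintegralZl //; exact: int01Z. Qed.

Lemma oo01P s : (`]0%R, 1%R[ : set R)%classic s <-> 0 < s < 1.
Proof. by rewrite /= in_itv. Qed.

Lemma eq_int01 f g : (forall s, 0 < s < 1 -> f s = g s) -> int01 f -> int01 g.
Proof.
move=> h; apply: eq_integrable => //= s; rewrite inE => /oo01P hs.
by rewrite h.
Qed.

Lemma eq_I01 f g : (forall s, 0 < s < 1 -> f s = g s) -> int01 f -> I01 f = I01 g.
Proof.
move=> h hf; rewrite !I01_int //; last exact: eq_int01 hf.
by apply: eq_Rintegral => s; rewrite inE => /oo01P; exact: h.
Qed.

Lemma le_I01 f g : int01 f -> int01 g -> (forall s, 0 < s < 1 -> f s <= g s) -> I01 f <= I01 g.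
Proof.
move=> hf hg h; rewrite !I01_int //.
by apply: le_Rintegral => // s /oo01P; exact: h.
Qed.

Lemma norm_I01 f g : int01 f -> int01 g -> (forall s, 0 < s < 1 -> `|f s| <= g s) -> `|I01 f| <= I01 g.
Proof.
move=> hf hg h; rewrite ler_norml; apply/andP; split; last first.
  by apply: le_I01 => // s /h; apply: le_trans; exact: ler_norm.
rewrite -mulN1r -I01Z //; apply: le_I01 => //; first exact: int01Z.
by move=> s /h; rewrite mulN1r lerNl; apply: le_trans; rewrite -normrN ler_norm.
Qed.

Lemma dom_int01 f g : measurable_fun (`]0%R, 1%R[ : set R) f -> int01 g ->
  (forall s, 0 < s < 1 -> `|f s| <= g s) -> int01 f.
Proof.
move=> mf hg h; apply: (@le_integrable _ _ _ mu _ _ (EFin \o f) (EFin \o g)) => //.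
  exact/measurable_EFinP.
move=> s /oo01P hs /=; rewrite lee_fin; apply: le_trans (h _ hs) _; exact: ler_norm.
Qed.

Lemma I01_FTC f F : continuous f -> (forall s, is_derive s 1 F (f s)) -> I01 f = F 1 - F 0.
Proof.
move=> cf dF; rewrite /I01 /Rintegral (@continuous_FTC2 _ f F) //.
- exact: continuous_subspaceT.
- have cF s : {for s, continuous F}.
    by apply: differentiable_continuous; apply/derivable1_diffP; case: (dF s).
  split=> [s _||]; first by case: (dF s).
  + by apply: cvg_at_right_filter; exact: cF.
  + by apply: cvg_at_left_filter; exact: cF.
- by move=> s _; rewrite derive1E; case: (dF s).
Qed.

(* Cube roots bring in the integrable singularities [x^(-1/3)] and [x^(-2/3)]. *)
Definition cbrt (x : R) : R := x `^ 3^-1.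

Lemma cbrt_gt0 x : 0 < x -> 0 < cbrt x.
Proof. exact: powR_gt0. Qed.

Lemma cbrtK x : 0 <= x -> cbrt x ^+ 3 = x.
Proof. by move=> x0; rewrite -powR_mulrn ?powR_ge0 // -powRrM mulVf ?powRr1 // pnatr_eq0. Qed.

Lemma cbrt1 : cbrt 1 = 1.
Proof. by rewrite /cbrt powR1. Qed.

Lemma le_cbrt x y : 0 <= x -> x <= y -> cbrt x <= cbrt y.
Proof.
move=> x0 xy; apply: ge0_ler_powR; rewrite ?invr_ge0 ?nnegrE //.
exact: le_trans xy.
Qed.

(** Common majorant of the singularities: [aa] vanishes quadratically at 0 and 1, so its power -1/3
    is of the order of these powers -2/3. *)
Definition kern (s : R) : R := (cbrt s ^+ 2)^-1 + (cbrt (1 - s) ^+ 2)^-1.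

Lemma kern_ge0 s : 0 <= kern s.
Proof. by rewrite addr_ge0 // invr_ge0 sqr_ge0. Qed.

Definition kprim (s : R) : R := 3 * cbrt s - 3 * cbrt (1 - s).

Lemma is_derive_cbrt (x : R) : 0 < x -> is_derive x 1 cbrt (3^-1 * (cbrt x ^+ 2)^-1).
Proof.
move=> x0; have := @is_derive1_powR R 3^-1 x x0.
suff -> : x `^ (3^-1 - 1) = (cbrt x ^+ 2)^-1 by [].
rewrite -powR_mulrn ?powR_ge0 // -powRrM -powRN; congr (_ `^ _); by field.
Qed.

Lemma is_derive_kprim s : 0 < s < 1 -> is_derive s 1 kprim (kern s).
Proof.
move=> /andP[s0 s1]; have d1 := is_derive_cbrt s0.
have s1' : 0 < 1 - s by rewrite subr_gt0.
have d2 := is_derive_cbrt s1'.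
have d3 : is_derive s 1 (fun s => 1 - s) (-1).
  by rewrite -[-1]sub0r; apply: is_deriveB.
have d4 : is_derive s 1 (cbrt \o (fun s => 1 - s)) (3^-1 * (cbrt (1 - s) ^+ 2)^-1 * -1).
  exact: is_derive1_comp.
have d5 := is_deriveB (is_deriveZ 3 d1) (is_deriveZ 3 d4).
apply: (is_derive_eq d5).
by rewrite /kern /GRing.scale /=; field; rewrite !gt_eqF // ?exprn_gt0 ?cbrt_gt0.
Qed.

Lemma kern_cont s : 0 < s < 1 -> {for s, continuous kern}.
Proof.
move=> /andP[s0 s1].
have c1 x : 0 < x -> {for x, continuous cbrt}.
  by move=> x0; apply: differentiable_continuous; apply/derivable1_diffP; case: (is_derive_cbrt x0).
have c2 x : 0 < x -> {for x, continuous (fun y => (cbrt y ^+ 2)^-1)}.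
  move=> x0; apply: cvgV; first by rewrite expf_neq0 // gt_eqF ?cbrt_gt0.
  exact: cvgM (c1 x x0) (c1 x x0).
apply: cvgD; first exact: c2.
have c3 : {for s, continuous (fun s : R => 1 - s)} by apply: cvgB; [exact: cvg_cst|exact: cvg_id].
apply: (@continuous_comp _ _ _ (fun s : R => 1 - s) (fun y : R => (cbrt y ^+ 2)^-1) s c3).
by apply: c2; rewrite subr_gt0.
Qed.

Lemma cbrt_le1 x : 0 <= x <= 1 -> cbrt x <= 1.
Proof. by move=> /andP[x0 x1]; rewrite -[1]cbrt1 le_cbrt. Qed.

Lemma kprim_bound s : 0 <= s <= 1 -> `|kprim s| <= 3.
Proof.
move=> /andP[s0 s1]; have a := @cbrt_le1 s; have b := @cbrt_le1 (1 - s).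
have a0 := powR_ge0 s 3^-1; have b0 := powR_ge0 (1 - s) 3^-1.
rewrite /kprim ler_norml; move: a b; rewrite -/(cbrt s) -/(cbrt (1 - s)) in a0 b0 *.
have h1 : 0 <= s <= 1 by lra.
have h2 : 0 <= 1 - s <= 1 by lra.
by move=> /(_ h1) a /(_ h2) b; lra.
Qed.

Lemma kern_integral : (\int[mu]_(s in `]0%R, 1%R[) (kern s)%:E <= 6%:E)%E.
Proof.
(* The offset 3 keeps every interval [e i, 1 - e i] nondegenerate. On each of them the integral is a
   difference of two values of [kprim], which lie in [-3, 3]; hence the bound 6. *)
pose e i : R := i.+3%:R^-1.
have e0 i : 0 < e i by rewrite invr_gt0.
have e2 i : e i <= 3^-1 by rewrite lef_pV2 ?posrE // ler_nat.
pose F i := (`[e i, 1 - e i] : set R)%classic.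
have FU : \bigcup_i F i = (`]0%R, 1%R[ : set R)%classic.
  apply/seteqP; split=> [s [i _]|s]; rewrite /F /= !in_itv /=.
    by move=> /andP[a b]; have := e0 i; lra.
  move=> /andP[s0 s1]; have m0 : 0 < Num.min s (1 - s) by rewrite lt_min s0 subr_gt0.
  have [i hi] : exists i, e i <= Num.min s (1 - s).
    exists (Num.truncn (Num.min s (1 - s))^-1); rewrite /e invf_ple ?posrE //.
    apply: ltW; apply: lt_trans (truncnS_gt _) _; by rewrite ltr_nat.
  by exists i => //=; rewrite in_itv /=; move: hi; rewrite le_min => /andP[-> h]; lra.
have Fin i s : F i s -> 0 < s < 1.
  by rewrite /F /= in_itv /= => /andP[a b]; have := e0 i; lra.
have mk : measurable_fun (`]0%R, 1%R[ : set R)%classic (EFin \o kern).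
  apply/measurable_EFinP; apply: open_continuous_measurable_fun; first exact: interval_open.
  by move=> s; rewrite inE => /oo01P; exact: kern_cont.
have := @ge0_nondecreasing_set_cvg_integral _ (measurableTypeR R) _ F (EFin \o kern) (@lebesgue_measure R).
rewrite FU => cv.
have {}cv : (\int[mu]_(x in F i) (EFin \o kern) x)%E @[i --> \oo] -->
    (\int[mu]_(x in `]0%R, 1%R[) (EFin \o kern) x)%E.
  apply: cv.
  - move=> i j ij; apply/subsetPset => s; rewrite /F /= !in_itv /= => /andP[a b].
    have : e j <= e i by rewrite lef_pV2 ?posrE // ler_nat.
    by move=> h; apply/andP; split; lra.
  - by move=> i; exact: measurable_itv.
  - move=> i; apply: measurable_funS mk => //.
    by move=> s /Fin h; apply/oo01P.
  - by move=> i s _; rewrite /= lee_fin kern_ge0.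
have <- := cvg_lim (@ereal_hausdorff R) cv.
apply: lime_le; first by apply/cvg_ex; eexists; exact: cv.
apply: nearW => i; rewrite (@continuous_FTC2 _ kern kprim).
- have h x : 0 <= x <= 1 -> `|kprim x| <= 3 := @kprim_bound x.
  rewrite -EFinB lee_fin; have := h (e i); have := h (1 - e i).
  rewrite !ler_norml; have := e0 i; have := e2 i => p q a b.
  have {}a := a ltac:(lra); have {}b := b ltac:(lra); lra.
- by have := e2 i; have := e0 i; lra.
- apply: continuous_in_subspaceT => s; rewrite inE => /Fin; exact: kern_cont.
- have dk s : 0 < s < 1 -> derivable kprim s 1 by move=> /is_derive_kprim [].
  have ck s : 0 < s < 1 -> {for s, continuous kprim}.
    by move=> /dk h; apply: differentiable_continuous; apply/derivable1_diffP.
  have a1 : 0 < e i < 1 by have := e2 i; have := e0 i; lra.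
  have b1 : 0 < 1 - e i < 1 by have := e2 i; have := e0 i; lra.
  split=> [s|| ].
  + by rewrite in_itv /= => /andP[a b]; apply: dk; have := e0 i; lra.
  + by apply: cvg_at_right_filter; exact: ck.
  + by apply: cvg_at_left_filter; exact: ck.
- move=> s; rewrite in_itv /= => /andP[a b].
  have s1 : 0 < s < 1 by have := e0 i; lra.
  by rewrite derive1E; case: (is_derive_kprim s1).
Qed.

Lemma int01_kern : int01 kern.
Proof.
apply/integrableP; split.
  apply/measurable_EFinP; apply: open_continuous_measurable_fun; first exact: interval_open.
  by move=> s; rewrite inE => /oo01P; exact: kern_cont.
apply: le_lt_trans (ltry 6); apply: le_trans kern_integral.
under eq_integral => s _ do rewrite /= ger0_norm ?kern_ge0 //.
exact: lexx.
Qed.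

Lemma I01_kern_le : I01 kern <= 6.
Proof.
rewrite (I01_int int01_kern) /Rintegral -lee_fin fineK ?kern_integral //.
exact: integrable_fin_num int01_kern.
Qed.

End UnitInterval.

(** * Iterated integrals *)

Section Iterated.
Variable R : realType.
Implicit Types (Phi Psi : (nat -> R) -> R) (s : R) (t : nat -> R) (P : (nat -> R) -> Prop).

Definition upd (k : nat) s t : nat -> R := fun j => if j == k then s else t j.

(** The iterated integral with the remaining coordinates kept as parameters, so that inductions can
    stop at an inner integral. *)
Fixpoint J (k : nat) Phi t : R :=
  if k is k'.+1 then I01 (fun s => J k' Phi (upd k' s t)) else Phi t.

Lemma upd_comm k l s s' t : k != l -> upd k s (upd l s' t) = upd l s' (upd k s t).
Proof.
move=> kl; apply/funext => j; rewrite /upd; case: eqP => [->|//].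
by rewrite (negbTE kl).
Qed.

Lemma updE k s t : upd k s t k = s.
Proof. by rewrite /upd eqxx. Qed.

Lemma updN k s t j : j != k -> upd k s t j = t j.
Proof. by rewrite /upd => /negbTE ->. Qed.

Lemma J_upd k l s Phi t : (k <= l)%N -> J k (fun t => Phi (upd l s t)) t = J k Phi (upd l s t).
Proof.
elim: k t => //= k IH t kl; congr I01; apply/funext => s'.
by rewrite IH ?(ltnW kl) // upd_comm // gtn_eqF.
Qed.

Lemma iintE k Phi : iint k Phi = J k Phi (fun=> 0).
Proof.
elim: k Phi => //= k IH Phi; congr Rintegral; apply/funext => s.
by rewrite IH -J_upd.
Qed.

Lemma J_cst k c t : J k (fun=> c) t = c.
Proof.
elim: k t => //= k IH t; rewrite -[RHS](@I01_cst R); congr I01.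
by apply/funext => s; rewrite IH.
Qed.

Variable d : nat.

Definition dist t t' : R := \sum_(j < d) `|t j - t' j|.

Lemma dist_upd k s t t' : dist (upd k s t) (upd k s t') <= dist t t'.
Proof. by apply: ler_sum => j _; rewrite /upd; case: ifP => // _; rewrite subrr normr0. Qed.

Lemma dist_upd1 k s s' t : dist (upd k s t) (upd k s' t) <= `|s - s'|.
Proof.
have [kd|kd] := ltnP k d.
  rewrite /dist (bigD1 (Ordinal kd)) //= !updE big1 ?addr0 // => j jk.
  by rewrite !updN ?subrr ?normr0.
rewrite /dist big1 ?normr_ge0 // => j _; rewrite !updN ?subrr ?normr0 //.
  by rewrite ltn_eqF // (leq_trans (ltn_ord j)).
by rewrite ltn_eqF // (leq_trans (ltn_ord j)).
Qed.

(** Holds for regions described by coordinates of index at least [m]; these are preserved while the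
    first [m] variables are integrated. *)
Definition stable P m := forall k s t, (k < m)%N -> P t -> P (upd k s t).
Definition lipOn P K Phi := forall t t', P t -> P t' -> `|Phi t - Phi t'| <= K * dist t t'.

Section Regular.
Variables (P : (nat -> R) -> Prop) (m : nat).
Hypothesis sP : stable P m.

Lemma slice_lip K Psi k t : 0 <= K -> lipOn P K Psi -> (k < m)%N -> P t ->
  forall s s', `|Psi (upd k s t) - Psi (upd k s' t)| <= K * `|s - s'|.
Proof.
move=> K0 hL km Pt s s'; apply: le_trans (hL _ _ (sP _ km Pt) (sP _ km Pt)) _.
by rewrite ler_wpM2l // dist_upd1.
Qed.

Lemma slice_int K Psi k t : 0 <= K -> lipOn P K Psi -> (k < m)%N -> P t ->
  int01 (fun s => Psi (upd k s t)).
Proof. by move=> K0 hL km Pt; apply: (@lip_int01 _ _ K); exact: slice_lip. Qed.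

Lemma lip_J K Phi k : 0 <= K -> lipOn P K Phi -> (k <= m)%N -> lipOn P K (J k Phi).
Proof.
move=> K0 hL; elim: k => // k IH km t t' Pt Pt' /=.
have {}IH := IH (ltnW km).
have i1 := slice_int K0 IH km Pt; have i2 := slice_int K0 IH km Pt'.
rewrite -I01B // -[X in _ <= X](@I01_cst R); apply: norm_I01 => [||s _].
- exact: int01B.
- exact: int01_cst.
- apply: le_trans (IH _ _ (sP _ km Pt) (sP _ km Pt')) _.
  by rewrite ler_wpM2l // dist_upd.
Qed.

Lemma J_int K Phi k t : 0 <= K -> lipOn P K Phi -> (k < m)%N -> P t ->
  int01 (fun s => J k Phi (upd k s t)).
Proof. by move=> K0 hL km Pt; exact: (slice_int K0 (lip_J K0 hL (ltnW km)) km Pt). Qed.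

Lemma JD K L Phi Psi k t : 0 <= K -> 0 <= L -> lipOn P K Phi -> lipOn P L Psi -> (k <= m)%N -> P t ->
  J k (fun t => Phi t + Psi t) t = J k Phi t + J k Psi t.
Proof.
move=> K0 L0 hK hL; elim: k t => //= k IH t km Pt.
rewrite -I01D; [|exact: (J_int K0)|exact: (J_int L0)].
by congr I01; apply/funext => s; rewrite IH ?(ltnW km) //; exact: sP.
Qed.

Lemma JZ K c Phi k t : 0 <= K -> lipOn P K Phi -> (k <= m)%N -> P t ->
  J k (fun t => c * Phi t) t = c * J k Phi t.
Proof.
move=> K0 hK; elim: k t => //= k IH t km Pt.
rewrite -I01Z; last exact: (J_int K0).
by congr I01; apply/funext => s; rewrite IH ?(ltnW km) //; exact: sP.
Qed.

Lemma J_eq Phi Psi k t : (forall t, P t -> Phi t = Psi t) -> (k <= m)%N -> P t -> J k Phi t = J k Psi t.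
Proof.
move=> e; elim: k t => [|k IH] t km Pt /=; first exact: e.
by congr I01; apply/funext => s; rewrite IH ?(ltnW km) //; exact: sP.
Qed.

Lemma J_bound K B Phi k t : 0 <= K -> lipOn P K Phi ->
  (forall t, P t -> `|Phi t| <= B t) -> (forall k s t, (k < m)%N -> B (upd k s t) = B t) ->
  (k <= m)%N -> P t -> `|J k Phi t| <= B t.
Proof.
move=> K0 hK hB iB; elim: k t => [|k IH] t km Pt /=; first exact: hB.
rewrite -[X in _ <= X](@I01_cst R); apply: norm_I01 => [||s _].
- exact: (J_int K0).
- exact: int01_cst.
- by apply: le_trans (IH _ (ltnW km) (sP _ km Pt)) _; rewrite iB.
Qed.

End Regular.

Lemma cos_dist (x y : R) : `|cos x - cos y| <= `|x - y|.
Proof.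
wlog xy : x y / x < y.
  move=> h; have [|yx|->] := ltgtP x y; first exact: h.
    by rewrite distrC [X in _ <= X]distrC h.
  by rewrite !subrr.
have [z _ e] := @MVT R cos (fun z => - sin z) x y xy
  (fun z _ => is_derive_cos z) (continuous_subspaceT (@continuous_cos R)).
by rewrite distrC e normrM normrN [X in _ <= X]distrC ler_piMl ?sin_max.
Qed.

Definition aa s : R := 2 - 2 * cos (2 * pi * s).

Lemma aaE s : aa s = 4 * sin (pi * s) ^+ 2.
Proof.
rewrite /aa (_ : 2 * pi * s = pi * s + pi * s); last by ring.
by rewrite cosD; have := cos2Dsin2 (pi * s); move: (cos _) (sin _) => c z; lra.
Qed.

Lemma aa_ge0 s : 0 <= aa s.
Proof. by rewrite aaE mulr_ge0 ?sqr_ge0. Qed.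

Lemma aa_le4 s : aa s <= 4.
Proof. by rewrite /aa; have := cos_geN1 (2 * pi * s); lra. Qed.

Lemma aa_sym s : aa (1 - s) = aa s.
Proof.
rewrite !aaE mulrBr mulr1 sinB sinpi cospi; ring.
Qed.

Lemma aa_dist s s' : `|aa s - aa s'| <= 4 * pi * `|s - s'|.
Proof.
have -> : aa s - aa s' = - 2 * (cos (2 * pi * s) - cos (2 * pi * s')) by rewrite /aa; ring.
rewrite normrM normrN (ger0_norm (ler0n _ 2)).
apply: (@le_trans _ _ (2 * `|2 * pi * s - 2 * pi * s'|)).
  by rewrite ler_pM2l // cos_dist.
rewrite -mulrBr normrM ger0_norm ?mulr_ge0 ?pi_ge0 //.
by rewrite (_ : 2 * (2 * pi * _) = 4 * pi * `|s - s'|) //; ring.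
Qed.

Lemma sin_lower (x : R) : 0 <= x <= pi / 2 -> x / 4 <= sin x.
Proof.
move=> /andP[x0 x2]; have [->|xn0] := eqVneq x 0; first by rewrite sin0 mul0r.
have xp : 0 < x by rewrite lt_neqAle eq_sym xn0.
have p2 : (pi : R) / 2 <= 2 by have := @pihalf_02 R => /andP[_ /ltW].
have pp := pi_gt0 R.
have s0 : 0 <= sin x by apply: sin_ge0_pi; lra.
(* If cos x is at least 1/4, the mean value theorem gives the bound; otherwise sin x is close to 1
   while x is at most 2. *)
have [cx|cx] := ltP (cos x) 4^-1; last first.
  have [z] := @MVT R sin cos 0 x xp (fun z _ => is_derive_sin z) (continuous_subspaceT (@continuous_sin R)).
  rewrite in_itv /= sin0 !subr0 => /andP[z0 zx] ->.
  have : cos x < cos z by rewrite ltr_cos ?in_itv /=; lra.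
  by nra.
have c0 : 0 <= cos x by apply: cos_ge0_pihalf; lra.
have := cos2Dsin2 x; nra.
Qed.

Lemma aa_lower s : 0 <= s <= 2^-1 -> s ^+ 2 <= aa s.
Proof.
move=> /andP[s0 s1]; have pp := pi_gt0 R; have p2 := @pi_ge2 R.
have := @sin_lower (pi * s); rewrite aaE => h.
have {}h : pi * s / 4 <= sin (pi * s) by apply: h; nra.
have h2 : s / 2 <= sin (pi * s) by nra.
by nra.
Qed.

Lemma aa_gt0 s : 0 < s < 1 -> 0 < aa s.
Proof.
move=> /andP[s0 s1]; have [h|h] := leP s 2^-1.
  by apply: lt_le_trans (aa_lower _); rewrite ?exprn_gt0 ?(ltW s0).
rewrite -aa_sym; apply: lt_le_trans (aa_lower _); last by lra.
by rewrite exprn_gt0 // subr_gt0.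
Qed.

Definition icbrt (x : R) : R := (cbrt x)^-1.

Lemma icbrt_ge0 x : 0 <= icbrt x.
Proof. by rewrite invr_ge0 powR_ge0. Qed.

Lemma le_icbrt x y : 0 < x -> x <= y -> icbrt y <= icbrt x.
Proof.
by move=> x0 xy; rewrite lef_pV2 ?posrE ?cbrt_gt0 ?(lt_le_trans x0 xy) // le_cbrt // ltW.
Qed.

Lemma icbrt_sq x : 0 < x -> icbrt (x ^+ 2) = (cbrt x ^+ 2)^-1.
Proof. by move=> x0; rewrite /icbrt /cbrt expr2 powRM ?ltW // -expr2. Qed.

Lemma icbrt_aa s : 0 < s < 1 -> icbrt (aa s) <= kern s.
Proof.
move=> /andP[s0 s1]; have s1' : 0 < 1 - s by rewrite subr_gt0.
have [h|h] := leP s 2^-1.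
  apply: (@le_trans _ _ (icbrt (s ^+ 2))).
    by apply: le_icbrt; rewrite ?exprn_gt0 // aa_lower // h ltW.
  by rewrite icbrt_sq // /kern lerDl invr_ge0 sqr_ge0.
apply: (@le_trans _ _ (icbrt ((1 - s) ^+ 2))).
  by apply: le_icbrt; rewrite ?exprn_gt0 // -aa_sym aa_lower //; lra.
by rewrite icbrt_sq // /kern lerDr invr_ge0 sqr_ge0.
Qed.

Variable m : nat.

Definition Pout (e : R) t : Prop := e <= aa (t m).

Lemma stable_Pout e : stable (Pout e) m.
Proof. by move=> k s t km; rewrite /Pout updN // gtn_eqF. Qed.

(** The inner [m] integrals as a function of the outermost variable, the only one in which a
    singularity is allowed. *)
Definition outer Phi s : R := J m Phi (upd m s (fun=> 0)).

(* The regularity class: Lipschitz away from the singular slice [aa (t m) = 0], with integrable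
   partial integral. *)
Definition good Phi :=
  (forall e, 0 < e -> exists2 K, 0 <= K & lipOn (Pout e) K Phi) /\
  (exists2 C, 0 <= C & forall s, 0 < s < 1 -> `|outer Phi s| <= C * kern s).

Lemma outer_cont Phi : (forall e, 0 < e -> exists2 K, 0 <= K & lipOn (Pout e) K Phi) ->
  forall s, 0 < aa s -> {for s, continuous (outer Phi)}.
Proof.
move=> hP s as0; have e0 : 0 < aa s / 2 by rewrite divr_gt0.
have [K K0 hK] := hP _ e0.
have hJ := lip_J (@stable_Pout _) K0 hK (leqnn m).
pose A : set R := [set x | aa s / 2 < aa x].
have caa : continuous aa by apply: (@lip_cont _ _ (4 * pi)); exact: aa_dist.
have oA : open A.
  have -> : A = aa @^-1` [set x | aa s / 2 < x] by [].
  by apply: open_comp => [x _|]; [exact: caa|exact: open_gt].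
have hA : {in A, continuous (outer Phi)}.
  apply: (@lip_continuous _ _ K) => // x y Ax Ay.
  apply: le_trans (hJ _ _ _ _) _; rewrite /Pout ?updE; try exact: ltW.
  by rewrite ler_wpM2l // dist_upd1.
by apply: hA; rewrite inE /A /= ltr_pdivrMr // mulr_natr mulr2n ltrDl.
Qed.

Lemma good_int Phi : good Phi -> int01 (outer Phi).
Proof.
move=> [hL [C C0 hC]]; apply: (@dom_int01 _ _ (fun s => C * kern s)) => //.
  apply: open_continuous_measurable_fun; first exact: interval_open.
  by move=> s; rewrite inE => /oo01P hs; apply: outer_cont => //; exact: aa_gt0.
by apply: int01Z; exact: int01_kern.
Qed.

Lemma Jout Phi : J m.+1 Phi (fun=> 0) = I01 (outer Phi).
Proof. by []. Qed.

Lemma outer_D Phi Psi s : good Phi -> good Psi -> 0 < s < 1 ->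
  outer (fun t => Phi t + Psi t) s = outer Phi s + outer Psi s.
Proof.
move=> [h1 _] [h2 _] hs; have a0 := aa_gt0 hs.
have [K K0 hK] := h1 _ a0; have [L L0 hL] := h2 _ a0.
by apply: (JD (@stable_Pout _) K0 L0 hK hL); rewrite // /Pout updE.
Qed.

Lemma outer_Z Phi c s : good Phi -> 0 < s < 1 ->
  outer (fun t => c * Phi t) s = c * outer Phi s.
Proof.
move=> [h1 _] hs; have a0 := aa_gt0 hs; have [K K0 hK] := h1 _ a0.
by apply: (JZ (@stable_Pout _) c K0 hK); rewrite // /Pout updE.
Qed.

Lemma outer_eq Phi Psi s : (forall t, 0 < aa (t m) -> Phi t = Psi t) -> 0 < s < 1 ->
  outer Phi s = outer Psi s.
Proof.
move=> e hs; apply: (@J_eq (fun t => 0 < aa (t m)) m) => //; last by rewrite updE aa_gt0.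
by move=> k x t km; rewrite updN // gtn_eqF.
Qed.

Lemma good_D Phi Psi : good Phi -> good Psi -> good (fun t => Phi t + Psi t).
Proof.
move=> g1 g2; split; last first.
  have [_ [C C0 hC]] := g1; have [_ [D D0 hD]] := g2.
  exists (C + D); first exact: addr_ge0.
  move=> s hs; rewrite outer_D // mulrDl; apply: le_trans (ler_normD _ _) _.
  by rewrite lerD ?hC ?hD.
move=> e e0; have [K K0 hK] := g1.1 e e0; have [L L0 hL] := g2.1 e e0.
exists (K + L); first exact: addr_ge0.
move=> t t' Pt Pt'; rewrite opprD addrACA mulrDl.
by apply: le_trans (ler_normD _ _) _; rewrite lerD ?hK ?hL.
Qed.

Lemma good_Z Phi c : good Phi -> good (fun t => c * Phi t).
Proof.
move=> g1; split; last first.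
  have [_ [C C0 hC]] := g1; exists (`|c| * C); first exact: mulr_ge0.
  by move=> s hs; rewrite outer_Z // normrM -mulrA ler_wpM2l // hC.
move=> e e0; have [K K0 hK] := g1.1 e e0; exists (`|c| * K); first exact: mulr_ge0.
by move=> t t' Pt Pt'; rewrite -mulrBr normrM -mulrA ler_wpM2l // hK.
Qed.

Lemma good_sum (I : Type) (r : seq I) (Phi : I -> (nat -> R) -> R) : (forall i, good (Phi i)) ->
  good (fun t => \sum_(i <- r) Phi i t).
Proof.
move=> hg; elim: r => [|i r IH].
  have -> : (fun t => \sum_(i <- [::]) Phi i t) = (fun t : nat -> R => 0 * (0 : R)).
    by apply/funext => t; rewrite big_nil mul0r.
  have lip0 e : lipOn (Pout e) 0 (fun t : nat -> R => 0 * (0 : R)).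
    by move=> t t' _ _; rewrite subrr normr0 mul0r.
  split=> [e e0|]; first by exists 0.
  exists 0 => // s hs; rewrite mul0r.
  by rewrite /outer J_cst mul0r normr0.
have -> : (fun t => \sum_(j <- i :: r) Phi j t) = (fun t => Phi i t + \sum_(j <- r) Phi j t).
  by apply/funext => t; rewrite big_cons.
exact: good_D.
Qed.

Lemma Jgood_D Phi Psi : good Phi -> good Psi ->
  J m.+1 (fun t => Phi t + Psi t) (fun=> 0) = J m.+1 Phi (fun=> 0) + J m.+1 Psi (fun=> 0).
Proof.
move=> g1 g2; rewrite !Jout -I01D; [|exact: good_int..].
apply: eq_I01; last by apply: good_int; exact: good_D.
by move=> s hs; rewrite outer_D.
Qed.

Lemma Jgood_Z Phi c : good Phi ->
  J m.+1 (fun t => c * Phi t) (fun=> 0) = c * J m.+1 Phi (fun=> 0).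
Proof.
move=> g1; rewrite !Jout -I01Z; last exact: good_int.
apply: eq_I01; last by apply: good_int; exact: good_Z.
by move=> s hs; rewrite outer_Z.
Qed.

Lemma Jgood_eq Phi Psi : good Phi -> (forall t, 0 < aa (t m) -> Phi t = Psi t) ->
  J m.+1 Phi (fun=> 0) = J m.+1 Psi (fun=> 0).
Proof.
move=> g1 e; rewrite !Jout; apply: eq_I01; last exact: good_int.
by move=> s hs; exact: outer_eq.
Qed.

Lemma Jgood_sum (I : Type) (r : seq I) (Phi : I -> (nat -> R) -> R) : (forall i, good (Phi i)) ->
  J m.+1 (fun t => \sum_(i <- r) Phi i t) (fun=> 0) = \sum_(i <- r) J m.+1 (Phi i) (fun=> 0).
Proof.
move=> hg; elim: r => [|i r IH].
  rewrite big_nil -[RHS](@J_cst m.+1 0 (fun=> 0)); congr J.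
  by apply/funext => t; rewrite big_nil.
rewrite big_cons -IH -Jgood_D //; last exact: good_sum.
by apply: Jgood_eq; [exact: good_sum|move=> t _; rewrite big_cons].
Qed.

Lemma Jgood_bound Phi C : good Phi -> 0 <= C -> (forall s, 0 < s < 1 -> `|outer Phi s| <= C * kern s) ->
  `|J m.+1 Phi (fun=> 0)| <= 6 * C.
Proof.
move=> g1 C0 hC; rewrite Jout; apply: le_trans (norm_I01 (good_int g1) _ hC) _.
  by apply: int01Z; exact: int01_kern.
by rewrite (I01Z C (int01_kern R)) mulrC ler_wpM2r ?I01_kern_le.
Qed.

(** A bound that involves only the outermost variable is constant for the inner integrals and passes
    through them. *)
Lemma good_bounded Phi C : (forall e, 0 < e -> exists2 K, 0 <= K & lipOn (Pout e) K Phi) ->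
  (forall t, 0 < aa (t m) -> `|Phi t| <= C * icbrt (aa (t m))) -> 0 <= C ->
  forall s, 0 < s < 1 -> `|outer Phi s| <= C * kern s.
Proof.
move=> hL hC C0 s hs; have a0 := aa_gt0 hs; have [K K0 hK] := hL _ a0.
apply: (@le_trans _ _ (C * icbrt (aa s))); last by rewrite ler_wpM2l // icbrt_aa.
have := J_bound (@stable_Pout (aa s)) K0 hK (B := fun t => C * icbrt (aa (t m))) (k := m)
  (t := upd m s (fun=> 0)); rewrite updE; apply => //.
- by move=> t Pt; apply: hC; exact: lt_le_trans Pt.
- by move=> k x t km; rewrite updN // gtn_eqF.
- by rewrite /Pout updE.
Qed.

End Iterated.

(** * The fundamental solution *)

Section Characters.
Variables (R : realType) (d : nat).
Local Notation Zd := (Zd d).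
Local Notation evec := (@evec d).
Implicit Types (t : nat -> R) (n : Zd).

Lemma FfunE t : Ffun d t = \sum_(j < d) aa (t j).
Proof.
rewrite /Ffun /aa sumrB -mulr_sumr sumr_const card_ord; congr (_ - _).
by rewrite natrM mulr_natr.
Qed.

Lemma aa_le_F t (j : 'I_d) : aa (t j) <= Ffun d t.
Proof. by rewrite FfunE (bigD1 j) //= lerDl sumr_ge0 // => i _; exact: aa_ge0. Qed.

Lemma F_le t : Ffun d t <= (4 * d)%:R.
Proof.
rewrite FfunE natrM -[d in _ * d%:R]card_ord mulr_natr -sumr_const.
by apply: ler_sum => j _; exact: aa_le4.
Qed.

Lemma F_lip (P : (nat -> R) -> Prop) : lipOn d P (4 * pi) (Ffun d).
Proof.
move=> t t' _ _; rewrite !FfunE -sumrB /dist mulr_sumr.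
by apply: le_trans (ler_norm_sum _ _ _) _; apply: ler_sum => j _; exact: aa_dist.
Qed.

Definition nsize n : R := \sum_(i < d) `|(n i)%:~R|.

Lemma nsize_ge0 n : 0 <= nsize n.
Proof. exact: sumr_ge0. Qed.

Lemma dotnt_lip n t t' : `|dotnt n t - dotnt n t'| <= nsize n * dist d t t'.
Proof.
rewrite /dotnt -sumrB; apply: le_trans (ler_norm_sum _ _ _) _.
rewrite /dist mulr_sumr; apply: ler_sum => j _; rewrite -mulrBr normrM ler_wpM2r //.
by rewrite /nsize (bigD1 j) //= lerDl sumr_ge0.
Qed.

Definition Cn n t : R := cos (2 * pi * dotnt n t).

Lemma Cn_lip (P : (nat -> R) -> Prop) n : lipOn d P (2 * pi * nsize n) (Cn n).
Proof.
move=> t t' _ _; apply: le_trans (cos_dist _ _) _; rewrite -mulrBr normrM.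
rewrite ger0_norm ?mulr_ge0 ?pi_ge0 // -mulrA ler_wpM2l ?mulr_ge0 ?pi_ge0 //.
exact: dotnt_lip.
Qed.

Lemma Cn_le1 n t : `|Cn n t| <= 1.
Proof. by rewrite ler_norml cos_geN1 cos_le1. Qed.

Lemma dotntD n n' t : dotnt (n + n') t = dotnt n t + dotnt n' t.
Proof. by rewrite /dotnt -big_split; apply: eq_bigr => i _; rewrite ffunE intrD mulrDl. Qed.

Lemma dotntN n t : dotnt (- n) t = - dotnt n t.
Proof. by rewrite /dotnt -sumrN; apply: eq_bigr => i _; rewrite ffunE intrN mulNr. Qed.

Lemma dotnt_evec j t : dotnt (evec j) t = t j.
Proof.
rewrite /dotnt (bigD1 j) //= ffunE eqxx mul1r big1 ?addr0 // => i ij.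
by rewrite ffunE (negbTE ij) mul0r.
Qed.

Lemma Cn_second n j t : Cn (n + evec j) t + Cn (n - evec j) t = 2 * cos (2 * pi * t j) * Cn n t.
Proof.
rewrite /Cn !dotntD dotntN dotnt_evec mulrDr mulrBr cosD cosB; ring.
Qed.

Lemma CnN n t : Cn (- n) t = Cn n t.
Proof. by rewrite /Cn dotntN mulrN cosN. Qed.

Lemma w_even n : w R (- n) = w R n.
Proof.
rewrite /w; case: eqP => _; congr iint; apply/funext => t.
  by congr ((_ - _) / _); exact: CnN.
by congr (_ / _); exact: CnN.
Qed.

Lemma dotnt_upd n (k : 'I_d) s t : dotnt n (upd k s t) = (n k)%:~R * s + \sum_(i < d | i != k) (n i)%:~R * t i.
Proof.
rewrite /dotnt (bigD1 k) //= updE; congr (_ + _); apply: eq_bigr => i ik.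
by rewrite updN.
Qed.

Lemma I01_cos (a : int) (c : R) : a != 0 -> I01 (fun s => cos (2 * pi * (a%:~R * s + c))) = 0.
Proof.
move=> a0; have ar0 : a%:~R != 0 :> R by rewrite intr_eq0.
have p0 : (pi : R) != 0 by rewrite gt_eqF ?pi_gt0.
pose b : R := 2 * pi * a%:~R; have b0 : b != 0 by rewrite /b !mulf_neq0.
pose e : R := 2 * pi * c.
have hb s : 2 * pi * (a%:~R * s + c) = b * s + e by rewrite /b /e; ring.
have dl (s : R) : is_derive s 1 (fun s : R => b * s + e) b.
  have d1 : is_derive s 1 ((b *: (@id R)) + cst e) (b *: (1 : R) + 0) by apply: is_deriveD.
  by apply: (is_derive_eq d1); rewrite addr0 /GRing.scale /= mulr1.
have cf : continuous (fun s : R => cos (2 * pi * (a%:~R * s + c))).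
  apply: (@lip_cont _ _ `|b|) => s s'; apply: le_trans (cos_dist _ _) _.
  by rewrite !hb opprD addrACA subrr addr0 -mulrBr normrM.
have dF (s : R) : is_derive s 1 (fun s => b^-1 * sin (2 * pi * (a%:~R * s + c)))
    (cos (2 * pi * (a%:~R * s + c))).
  have ds : is_derive s 1 (sin \o (fun s => b * s + e)) (cos (b * s + e) * b).
    exact: is_derive1_comp.
  have -> : (fun s : R => b^-1 * sin (2 * pi * (a%:~R * s + c))) = b^-1 \*: (sin \o (fun s => b * s + e)).
    by apply/funext => x; rewrite /= hb.
  by apply: (is_derive_eq (is_deriveZ b^-1 ds)); rewrite hb /GRing.scale /=; field.
rewrite (I01_FTC cf dF).
have -> : 2 * pi * (a%:~R * 1 + c) = 2 * pi * (a%:~R * 0 + c) + a%:~R * (2 * pi) by ring.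
have sper k (x : R) : sin (x + k%:R * (2 * pi)) = sin x.
  elim: k x => [|k IH] x; first by rewrite mul0r addr0.
  have -> : x + k.+1%:R * (2 * pi) = x + k%:R * (2 * pi) + pi + pi by rewrite -natr1; ring.
  by rewrite !sinDpi opprK IH.
have sperz (x : R) : sin (x + a%:~R * (2 * pi)) = sin x.
  case: (intP a) => [|k|k]; first by rewrite mul0r addr0.
    exact: sper.
  by rewrite -[in LHS](sper k.+1) -addrA -mulrDl intrN addNr mul0r addr0.
by rewrite sperz subrr.
Qed.

Lemma J_Cn n k t : (k <= d)%N ->
  J k (Cn n) t = if [forall i : 'I_d, (i < k)%N ==> (n i == 0)] then Cn n t else 0.
Proof.
elim: k t => [|k IH] t kd /=; first by case: forallP => // -[] i; rewrite ltn0.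
pose kk := Ordinal kd.
have -> : (fun s => J k (Cn n) (upd k s t)) =
  (fun s => if [forall i : 'I_d, (i < k)%N ==> (n i == 0)] then Cn n (upd k s t) else 0).
  by apply/funext => s; rewrite IH // ltnW.
case: forallP => h; last first.
  rewrite I01_cst; case: forallP => // h'; case: h => i; apply/implyP => ik.
  by have /implyP := h' i; apply; exact: ltnW.
have [nk|nk] := eqVneq (n kk) 0; last first.
  case: forallP => [/(_ kk)|_]; first by rewrite ltnSn (negbTE nk).
  have -> : (fun s => Cn n (upd k s t)) = (fun s => cos (2 * pi * ((n kk)%:~R * s + \sum_(i < d | i != kk) (n i)%:~R * t i))).
    by apply/funext => s; rewrite /Cn (dotnt_upd n kk).
  exact: I01_cos.
have -> : (fun s => Cn n (upd k s t)) = (fun s => Cn n t).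
  apply/funext => s; rewrite /Cn (dotnt_upd n kk) nk mul0r add0r; congr (cos (_ * _)).
  by rewrite /dotnt [RHS](bigD1 kk) //= nk mul0r add0r.
rewrite I01_cst; case: forallP => // -[] i; apply/implyP; rewrite ltnS leq_eqVlt => /orP[/eqP ik|ik].
  by have -> : i = kk; [exact/val_inj|rewrite nk].
by have /implyP := h i; exact.
Qed.

Lemma J_Cn_full n : J d (Cn n) (fun=> 0) = (n == 0)%:R.
Proof.
rewrite J_Cn //; case: forallP => h.
  have -> : n = 0 by apply/ffunP => i; rewrite ffunE; apply/eqP; have /implyP := h i; apply.
  by rewrite eqxx /Cn /dotnt big1 ?mulr0 ?cos0 // => i _; rewrite mulr0.
by case: eqP => // n0; case: h => i; apply/implyP => _; rewrite n0 ffunE.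
Qed.

Lemma lip_div (P : (nat -> R) -> Prop) N D K L B e : 0 <= K -> 0 <= L -> 0 <= B -> 0 < e ->
  lipOn d P K N -> lipOn d P L D -> (forall t, P t -> `|N t| <= B) -> (forall t, P t -> e <= D t) ->
  lipOn d P (K / e + B * L / e ^+ 2) (fun t => N t / D t).
Proof.
move=> K0 L0 B0 e0 hN hD hB he t t' Pt Pt'.
have Dt := lt_le_trans e0 (he _ Pt); have Dt' := lt_le_trans e0 (he _ Pt').
have -> : N t / D t - N t' / D t' = (N t - N t') / D t + N t' * (D t' - D t) / (D t * D t').
  by field; rewrite !gt_eqF.
apply: le_trans (ler_normD _ _) _; rewrite [X in _ <= X]mulrDl lerD //.
  rewrite normrM normfV (gtr0_norm Dt) mulrAC ler_pM ?invr_ge0 ?(ltW Dt) ?hN //.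
  by rewrite lef_pV2 ?posrE // he.
rewrite !normrM normfV (gtr0_norm (mulr_gt0 Dt Dt')).
have -> : B * L / e ^+ 2 * dist d t t' = B * (L * dist d t t') / e ^+ 2 by ring.
rewrite ler_pM ?mulr_ge0 ?invr_ge0 ?(ltW (mulr_gt0 Dt Dt')) //.
  by rewrite ler_pM ?hB // distrC hD.
by rewrite lef_pV2 ?posrE ?mulr_gt0 ?exprn_gt0 // expr2 ler_pM ?he ?ltW.
Qed.

Lemma aaD (x y : R) : aa (x + y) <= 2 * aa x + 2 * aa y.
Proof.
rewrite !aaE mulrDr sinD.
have := cos2Dsin2 (pi * x); have := cos2Dsin2 (pi * y).
move: (cos (pi * x)) (cos (pi * y)) (sin (pi * x)) (sin (pi * y)) => a b u v h1 h2.
have h3 : (u * b + a * v) ^+ 2 <= 2 * (u * b) ^+ 2 + 2 * (a * v) ^+ 2.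
  by rewrite -subr_ge0 (_ : _ - _ = (u * b - a * v) ^+ 2) ?sqr_ge0 //; ring.
have h4 : (u * b) ^+ 2 <= u ^+ 2 by rewrite exprMn ler_piMr ?sqr_ge0 //; have := sqr_ge0 v; lra.
have h5 : (a * v) ^+ 2 <= v ^+ 2 by rewrite exprMn ler_piMl ?sqr_ge0 //; have := sqr_ge0 u; lra.
lra.
Qed.

Lemma aa0 : aa (0 : R) = 0.
Proof. by rewrite /aa mulr0 cos0; ring. Qed.

Lemma aaN (x : R) : aa (- x) = aa x.
Proof. by rewrite /aa mulrN cosN. Qed.

Lemma aa_mulz (k : int) : exists2 C : R, 0 <= C & forall x, aa (k%:~R * x) <= C * aa x.
Proof.
have hn (n : nat) : exists2 C : R, 0 <= C & forall x, aa (n%:R * x) <= C * aa x.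
  elim: n => [|n [C C0 hC]]; first by exists 0 => // x; rewrite !mul0r aa0.
  exists (2 * C + 2); first by rewrite addr_ge0 ?mulr_ge0.
  move=> x; rewrite -natr1 mulrDl mul1r; apply: le_trans (aaD _ _) _.
  by rewrite [X in _ <= X]mulrDl lerD // -mulrA ler_wpM2l.
case: (intP k) => [|n|n].
- by have [C C0 hC] := hn 0%N; exists C.
- by have [C C0 hC] := hn n.+1; exists C.
- have [C C0 hC] := hn n.+1; exists C => // x.
  by rewrite intrN mulNr aaN; exact: hC.
Qed.

(** Since [aa] of the phase is 2 - 2 cos, this makes the numerator cos - 1 of the two-dimensional
    integrand comparable with its denominator, and the quotient bounded. *)
Lemma aa_dotnt n : exists2 C : R, 0 <= C & forall t, aa (dotnt n t) <= C * Ffun d t.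
Proof.
have hs (r : seq 'I_d) : exists2 C : R, 0 <= C &
    forall t, aa (\sum_(i <- r) (n i)%:~R * t i) <= C * Ffun d t.
  elim: r => [|i r [C C0 hC]]; first by exists 0 => // t; rewrite big_nil aa0 mul0r.
  have [D D0 hD] := aa_mulz (n i).
  exists (2 * D + 2 * C); first by rewrite addr_ge0 ?mulr_ge0.
  move=> t; rewrite big_cons; apply: le_trans (aaD _ _) _.
  rewrite [X in _ <= X]mulrDl -!mulrA lerD ?ler_wpM2l //; apply: le_trans (hD _) _.
  by rewrite ler_wpM2l // aa_le_F.
by have [C C0 hC] := hs (index_enum 'I_d); exists C.
Qed.

End Characters.

Section FundamentalSolution.
Variables (R : realType) (m : nat).
Hypothesis m0 : (0 < m)%N.
Local Notation d := m.+1.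
Local Notation Zd := (Zd d).
Local Notation evec := (@evec d).
Implicit Types (t : nat -> R) (n : Zd).

(** One integrand for all dimensions: [c] is 1 in dimension 2, where the constant must be
    subtracted, and 0 in higher dimensions. *)
Definition wint (c : R) n t : R := (Cn n t - c) / Ffun d t.

Lemma F_gt0 t : 0 < aa (t m) -> 0 < Ffun d t.
Proof. by move=> h; apply: lt_le_trans h _; exact: (aa_le_F t (@ord_max m)). Qed.

Lemma Pout_F (e : R) t : Pout m e t -> e <= Ffun d t.
Proof. by move=> h; apply: le_trans h _; exact: (aa_le_F t (@ord_max m)). Qed.

Lemma wint_lip (c e : R) n : 0 < e -> exists2 K, 0 <= K & lipOn d (Pout m e) K (wint c n).
Proof.
move=> e0; have K0 : 0 <= 2 * pi * nsize R n by rewrite !mulr_ge0 ?pi_ge0 ?nsize_ge0.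
have L0 : 0 <= 4 * pi :> R by rewrite mulr_ge0 ?pi_ge0.
have B0 : 0 <= 1 + `|c| by rewrite addr_ge0.
eexists; last apply: (lip_div K0 L0 B0 e0) => //.
- by rewrite addr_ge0 // !mulr_ge0 ?invr_ge0 ?exprn_ge0 ?pi_ge0 ?nsize_ge0 ?(ltW e0).
- move=> t t' Pt Pt'; have := @Cn_lip R d (Pout m e) n t t' Pt Pt'.
  by rewrite opprB addrA subrK.
- exact: F_lip.
- by move=> t _; apply: le_trans (ler_normB _ _) _; rewrite lerD2r Cn_le1.
- by move=> t; exact: Pout_F.
Qed.

(** The cube root of 4 is less than 2. As [aa] is at most 4, constants can thus be absorbed in the
    singular majorant. *)
Lemma icbrt_le4 (x : R) : 0 < x -> x <= 4 -> 1 <= 2 * icbrt x.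
Proof.
move=> x0 x4; have c0 := cbrt_gt0 x0.
rewrite /icbrt ler_pdivlMr // mul1r leNgt; apply/negP => h.
have := cbrtK (ltW x0); move: (cbrt x) c0 h => z z0 h e.
have : 4 < z ^+ 2 by rewrite expr2; nra.
by move=> h2; move: e; rewrite exprS; nra.
Qed.

Lemma wint_good2 n : good d m (wint 1 n).
Proof.
have hL := @wint_lip 1 ^~ n; split; first by move=> e e0; exact: hL.
have [C C0 hC] := @aa_dotnt R d n.
exists C => //; apply: good_bounded => //; first by move=> e e0; exact: hL.
move=> t at0; have F0 := F_gt0 at0.
have h1 : `|wint 1 n t| <= C / 2.
  rewrite /wint normrM normfV (gtr0_norm F0) ler_pdivrMr //.
  have := hC t; rewrite /aa -/(Cn n t) => h.
  have h2 : Cn n t <= 1 by have := Cn_le1 n t; rewrite ler_norml => /andP[].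
  by rewrite ler0_norm; lra.
apply: le_trans h1 _; rewrite ler_wpM2l //.
by have := icbrt_le4 at0 (aa_le4 (t m)); lra.
Qed.

Definition frest k t : R := \sum_(j < d | (k <= j)%N) aa (t j).

Lemma frest_upd (k : nat) s t : (k < d)%N -> frest k (upd k s t) = aa s + frest k.+1 t.
Proof.
move=> kd; rewrite /frest (bigD1 (Ordinal kd)) //= updE; congr (_ + _).
apply: eq_big => [j|j /andP[_ jk]]; first by rewrite ltn_neqAle andbC eq_sym.
by rewrite updN.
Qed.

Lemma frest_ge k t : (k <= m)%N -> aa (t m) <= frest k t.
Proof.
move=> km; rewrite /frest (bigD1 (@ord_max m)) //= lerDl sumr_ge0 // => j _; exact: aa_ge0.
Qed.

(** For the cube roots u and v this is u v^2 <= u^3 + v^3. It splits 1/F into a factor integrable in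
    the first variable and a power of the remaining sum. *)
Lemma inv_add_le (x y : R) : 0 < x -> 0 < y -> (x + y)^-1 <= icbrt x * icbrt y ^+ 2.
Proof.
move=> x0 y0; rewrite /icbrt exprVn -invfM lef_pV2 ?posrE ?mulr_gt0 ?exprn_gt0 ?cbrt_gt0 ?addr_gt0 //.
have := cbrtK (ltW x0); have := cbrtK (ltW y0); have := cbrt_gt0 x0; have := cbrt_gt0 y0.
move: (cbrt x) (cbrt y) => u v v0 u0 <- <-.
have u3 : 0 <= u ^+ 3 by rewrite exprn_ge0 // ltW.
have v3 : 0 <= v ^+ 3 by rewrite exprn_ge0 // ltW.
have v2 : 0 <= v ^+ 2 by rewrite exprn_ge0 // ltW.
have [uv|vu] := leP u v.
  have : u * v ^+ 2 <= v ^+ 3 by rewrite [v ^+ 3]exprS ler_wpM2r.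
  lra.
have : u * v ^+ 2 <= u ^+ 3 by rewrite [u ^+ 3]exprS ler_wpM2l ?(ltW u0) // lerXn2r ?nnegrE ?ltW.
lra.
Qed.

Lemma icbrt_add_le (x y : R) : 0 < x -> 0 < y -> icbrt (x + y) ^+ 2 <= icbrt x * icbrt y.
Proof.
move=> x0 y0; rewrite expr2 ler_pM ?icbrt_ge0 // le_icbrt //; lra.
Qed.

(** The first integration turns 1/F into the power -2/3 of the sum over the other variables, the
    second lowers this to the power -1/3, which the outermost variable can bear. Each of the two
    costs the integral of [kern], hence 6 * 6; two inner variables are available because [m] exceeds
    1. *)
Lemma wint_good3 n : (1 < m)%N -> good d m (wint 0 n).
Proof.
move=> m1; have hL := @wint_lip 0 ^~ n; split; first by move=> e e0; exact: hL.
exists (6 * 6) => // s hs; rewrite /outer; set t0 := upd m s _.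
have at0 : 0 < aa (t0 m) by rewrite /t0 updE aa_gt0.
have [K K0 hK] := hL _ at0; set P := Pout m _ in hK.
have sP : stable P m by exact: stable_Pout.
have Pgt t : P t -> 0 < aa (t m) by exact: lt_le_trans.
have Fgt k t : P t -> (k <= m)%N -> 0 < frest k t.
  by move=> Pt km; apply: lt_le_trans (frest_ge _ km); exact: Pgt.
have s1 t : P t -> `|J 1 (wint 0 n) t| <= 6 * icbrt (frest 1 t) ^+ 2.
  move=> Pt; apply: (@le_trans _ _ (I01 (fun s => icbrt (frest 1 t) ^+ 2 * kern s))); last first.
    by rewrite (I01Z _ (int01_kern R)) mulrC ler_wpM2r ?exprn_ge0 ?icbrt_ge0 ?I01_kern_le.
  apply: norm_I01; first exact: (J_int sP K0 hK m0 Pt).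
    by apply: int01Z; exact: int01_kern.
  move=> x hx; have ax := aa_gt0 hx; have rt : 0 < frest 1 t by apply: Fgt.
  have e : Ffun d (upd 0 x t) = aa x + frest 1 t.
    by rewrite -frest_upd // FfunE /frest; apply: eq_bigl.
  rewrite /wint subr0 normrM normfV e (gtr0_norm (addr_gt0 ax rt)).
  apply: (@le_trans _ _ (aa x + frest 1 t)^-1).
    by rewrite ler_piMl ?Cn_le1 // invr_ge0 ltW // addr_gt0.
  apply: le_trans (inv_add_le ax rt) _; rewrite mulrC ler_wpM2l ?exprn_ge0 ?icbrt_ge0 //.
  exact: icbrt_aa.
have s2 k t : (1 < k)%N -> (k <= m)%N -> P t -> `|J k (wint 0 n) t| <= 6 * 6 * icbrt (frest k t).
  elim: k t => // k IH t; rewrite ltnS => k0 km Pt.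
  have rt : 0 < frest k.+1 t by apply: Fgt.
  have iJ := J_int sP K0 hK km Pt.
  have [k1|k1] := leqP k 1.
    have {k0}k1 : k = 1%N by lia.
    rewrite {}k1 in km rt iJ *.
    apply: (@le_trans _ _ (I01 (fun s => 6 * icbrt (frest 2 t) * kern s))); last first.
      rewrite (I01Z _ (int01_kern R)) mulrC -!mulrA.
      by rewrite ler_pM ?I01_kern_le // ?mulr_ge0 ?icbrt_ge0 // ; apply: Rintegral_ge0 => x _; exact: kern_ge0.
    apply: (norm_I01 iJ); first by apply: int01Z; exact: int01_kern.
    move=> x hx; have ax := aa_gt0 hx.
    apply: le_trans (s1 _ (sP _ _ _ km Pt)) _; rewrite frest_upd // -mulrA ler_pM2l //.
    apply: le_trans (icbrt_add_le ax rt) _; rewrite mulrC ler_wpM2l ?icbrt_ge0 //.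
    exact: icbrt_aa.
  apply: (@le_trans _ _ (I01 (fun s => 6 * 6 * icbrt (frest k.+1 t)))); last by rewrite I01_cst.
  apply: (norm_I01 iJ); first exact: int01_cst.
  move=> x hx; apply: le_trans (IH _ k1 (ltnW km) (sP _ _ _ km Pt)) _.
  rewrite ler_wpM2l ?mulr_ge0 //; apply: le_icbrt => //.
  by rewrite frest_upd ?(ltn_trans km) // lerDr aa_ge0.
have Pt0 : P t0 by rewrite /P /Pout.
apply: le_trans (s2 m t0 m1 (leqnn m) Pt0) _; rewrite ler_wpM2l ?mulr_ge0 //.
apply: le_trans (icbrt_aa hs); apply: le_icbrt; first exact: aa_gt0.
by have := frest_ge t0 (leqnn m); rewrite /t0 updE.
Qed.

Lemma wE : exists2 c : R, (forall n, good d m (wint c n)) &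
  forall n, w R n = J d (wint c n) (fun=> 0).
Proof.
have [e|ne] := eqVneq m 1%N; [exists 1|exists 0] => n.
- exact: wint_good2.
- by rewrite /w ifT -?iintE // e.
- by apply: wint_good3; lia.
- rewrite /w eqSS (negbTE ne) -iintE; congr iint; apply/funext => t.
  by rewrite /wint subr0.
Qed.

(** The Laplacian multiplies a character by [Ffun], which cancels the denominator, and the constant
    [c] drops out of the second differences; what remains is the integral of a character. *)
Lemma lap_w n : lap (@w R d) n = (n == 0)%:R.
Proof.
have [c gc ew] := wE; rewrite -J_Cn_full.
pose Phi (j : 'I_d) t := wint c n t *+ 2 + -1 * (wint c (n + evec j) t + wint c (n - evec j) t).
have gPhi j : good d m (Phi j).
  have -> : Phi j = (fun t => 2 * wint c n t + -1 * (wint c (n + evec j) t + wint c (n - evec j) t)).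
    by apply/funext => t; rewrite /Phi mulr_natl.
  by apply: good_D; apply: good_Z => //; exact: good_D.
have -> : lap (@w R d) n = \sum_(j < d) J d (Phi j) (fun=> 0).
  rewrite lapE; apply: eq_bigr => j _.
  have -> : Phi j = (fun t => 2 * wint c n t + -1 * (wint c (n + evec j) t + wint c (n - evec j) t)).
    by apply/funext => t; rewrite /Phi mulr_natl.
  rewrite (@Jgood_D _ d m); [|exact: good_Z|by apply: good_Z; exact: good_D].
  rewrite (@Jgood_Z _ d m) // (@Jgood_Z _ d m); last exact: good_D.
  by rewrite (@Jgood_D _ d m) // -!ew; ring.
rewrite -(@Jgood_sum _ d m) //; apply: (@Jgood_eq _ d m); first exact: good_sum.
move=> t at0; have F0 := F_gt0 at0; rewrite /Phi /wint.
transitivity ((\sum_(j < d) aa (t j)) * Cn n t / Ffun d t); last first.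
  by rewrite -FfunE mulrAC divff ?mul1r // gt_eqF.
rewrite mulr_suml mulr_suml; apply: eq_bigr => j _.
rewrite -mulrDl -mulrnAl mulN1r -mulNr -mulrDl; congr (_ / _).
have := Cn_second n j t; rewrite /aa; lra.
Qed.

End FundamentalSolution.

(** * The Mahler measure as a limit of determinants *)

Section RiemannSum1.
Variable R : realType.
Notation mu := (@lebesgue_measure R).

Lemma riemann_left (f : R -> R) (K : R) (n : nat) : 0 <= K -> (0 < n)%N ->
  (forall s t, `|f s - f t| <= K * `|s - t|) ->
  `|I01 f - n%:R^-1 * \sum_(i < n) f (i%:R / n%:R)| <= K / n%:R.
Proof.
move=> K0 n0 hf; have nr : 0 < n%:R :> R by rewrite ltr0n.
pose T (x : R) := Rintegral mu `[0%R, x] f.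
have cf : continuous f by apply: lip_cont hf.
have intf (a b : R) : mu.-integrable `[a, b] (EFin \o f).
  apply: continuous_compact_integrable; first exact: segment_compact.
  exact: continuous_subspaceT.
pose x (i : nat) : R := i%:R / n%:R.
have x0 : x 0%N = 0 by rewrite /x mul0r.
have xn : x n = 1 by rewrite /x divff // gt_eqF.
have dx i : x i.+1 - x i = n%:R^-1 by rewrite /x -natr1 mulrDl mul1r addrC addKr.
have xge i : 0 <= x i by rewrite /x divr_ge0.
have xle i : x i <= x i.+1 by rewrite -subr_ge0 dx invr_ge0.
have step i : `|T (x i.+1) - T (x i) - n%:R^-1 * f (x i)| <= K / n%:R * n%:R^-1.
  have -> : T (x i.+1) - T (x i) = Rintegral mu `](x i), (x i.+1)] f.
    by apply: Rintegral_itvB; [exact: intf|rewrite bnd_simp|rewrite bnd_simp].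
  have io : mu.-integrable `](x i), (x i.+1)] (EFin \o f).
    by apply: integrableS (intf (x i) (x i.+1)) => //; exact: subset_itv_oc_cc.
  have ic (c : R) : mu.-integrable `](x i), (x i.+1)] (EFin \o (fun=> c)).
    apply: (@integrableS _ _ _ _ (`[(x i), (x i.+1)]%classic : set (measurableTypeR R))) => //.
      exact: subset_itv_oc_cc.
    apply: continuous_compact_integrable; first exact: segment_compact.
    by apply: continuous_subspaceT => y; exact: cvg_cst.
  have cst (c : R) : Rintegral mu `](x i), (x i.+1)] (fun=> c) = c * n%:R^-1.
    rewrite Rintegral_cst //= lebesgue_measure_itv /= lte_fin -subr_gt0 dx invr_gt0 nr.
    by rewrite -EFinB /= dx.
  rewrite -[n%:R^-1 * _]mulrC -(cst (f (x i))) -RintegralB // -cst.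
  apply: le_trans (le_normr_Rintegral _ _) _ => //; first exact: (integrableB _ io (ic _)).
  apply: le_Rintegral => //.
    exact: (integrable_norm (integrableB _ io (ic _))).
  move=> y /=; rewrite in_itv /= => /andP[y1 y2]; apply: le_trans (hf _ _) _.
  rewrite ler_wpM2l // ger0_norm; last by rewrite subr_ge0 ltW.
  by rewrite -(dx i) lerD2r.
have -> : I01 f = \sum_(i < n) (T (x i.+1) - T (x i)).
  rewrite -(big_mkord xpredT (fun i => T (x i.+1) - T (x i))) telescope_sumr // x0 xn.
  by rewrite /T set_itv1 Rintegral_set1 subr0.
rewrite mulr_sumr -sumrB; apply: le_trans (ler_norm_sum _ _ _) _.
apply: (@le_trans _ _ (\sum_(i < n) K / n%:R * n%:R^-1)); first by apply: ler_sum => i _; exact: step.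
by rewrite sumr_const card_ord -[X in X <= _]mulr_natr -mulrA mulVf ?mulr1 // gt_eqF.
Qed.

Variable M : nat.
Hypothesis M0 : (0 < M)%N.
Local Notation n := (M.+1 + M.+1)%N.

(** With M = 2N+1 one has [ang a] = 2 pi [gp a]: these are the nodes at which the eigenvalues sample
    [Ffun]. They fill only half of the unit interval. *)
Definition gp (a : nat) : R := a.+1%:R / n%:R.

Lemma gp_itv (a : 'I_M) : 0 < gp a <= 2^-1.
Proof.
have nr : 0 < n%:R :> R by rewrite ltr0n.
rewrite /gp divr_gt0 //= ler_pdivrMr // natrD.
have : a.+1%:R <= M.+1%:R :> R by rewrite ler_nat ltnS ltnW.
lra.
Qed.

(** By the symmetry of f, the full Riemann sum with 2M+2 nodes is f(0) + f(1/2) + 2S. The two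
    exceptional values and the change of normalisation account for 2B. *)
Lemma riemann_half (f : R -> R) (K B : R) : 0 <= K ->
  (forall s t, `|f s - f t| <= K * `|s - t|) -> (forall s, `|f s| <= B) ->
  (forall s, f (1 - s) = f s) ->
  `|I01 f - M%:R^-1 * \sum_(a < M) f (gp a)| <= (K + 2 * B) / M.+1%:R.
Proof.
move=> K0 hf hB hs; have nr : 0 < n%:R :> R by rewrite ltr0n.
set S := \sum_(a < M) _.
have B0 : 0 <= B by apply: le_trans (hB 0).
have hS : `|S| <= M%:R * B.
  apply: le_trans (ler_norm_sum _ _ _) _.
  apply: (@le_trans _ _ (\sum_(a < M) B)); first by apply: ler_sum.
  by rewrite sumr_const card_ord mulr_natl.
have e : \sum_(i < n) f (i%:R / n%:R) = f 0 + f (2^-1) + 2 * S.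
  rewrite big_split_ord /=.
  have -> : \sum_(i < M.+1) f (i%:R / n%:R) = f 0 + S.
    by rewrite big_ord_recl mul0r; congr (_ + _); apply: eq_bigr.
  have -> : \sum_(i < M.+1) f ((M.+1 + i)%:R / n%:R) = S + f (2^-1).
    rewrite (reindex_inj rev_ord_inj) /=.
    have ev (i : 'I_M.+1) : f ((M.+1 + (M.+1 - i.+1))%:R / n%:R) = f (gp i).
      rewrite -hs; congr f; rewrite /gp.
      have : (i.+1%:R + (M.+1 + (M.+1 - i.+1))%:R = n%:R :> R)%R.
        by rewrite -natrD; congr (_%:R); have := ltn_ord i; lia.
      move=> e; have nz : n%:R != 0 :> R by rewrite gt_eqF.
      by rewrite -{1}(divff nz) -mulrBl -e addrK.
    under eq_bigr => i _ do rewrite ev.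
    rewrite big_ord_recr /=; congr (_ + f _); rewrite /gp natrD; field.
    by rewrite !nat1r -natrD pnatr_eq0.
  by ring.
have h1 := @riemann_left f K n K0 isT hf.
have -> : I01 f - M%:R^-1 * S =
   (I01 f - n%:R^-1 * \sum_(i < n) f (i%:R / n%:R)) + (n%:R^-1 * (f 0 + f (2^-1)) - S / (M%:R * M.+1%:R)).
  rewrite e natrD; have mz : M%:R != 0 :> R by rewrite pnatr_eq0 -lt0n.
  by rewrite -natr1; field; rewrite mz /= !natr1 -natrD !pnatr_eq0.
have Mr : 0 < M%:R :> R by rewrite ltr0n.
have M1 : 0 < M.+1%:R :> R by rewrite ltr0n.
apply: le_trans (ler_normD _ _) _.
have h2 : K / n%:R <= K / M.+1%:R.
  by rewrite ler_wpM2l // lef_pV2 ?posrE // ler_nat leq_addr.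
have h3 : `|n%:R^-1 * (f 0 + f (2^-1)) - S / (M%:R * M.+1%:R)| <= 2 * B / M.+1%:R.
  apply: le_trans (ler_normB _ _) _.
  have a1 : `|n%:R^-1 * (f 0 + f 2^-1)| <= B / M.+1%:R.
    rewrite normrM normfV (gtr0_norm nr) natrD.
    have := le_trans (ler_normD (f 0) (f 2^-1)) (lerD (hB _) (hB _)) => h.
    move: (M.+1%:R : R) M1 (`|_|) h => a a0 x hx.
    rewrite (_ : (a + a)^-1 * x = x / 2 / a); last by field; rewrite !gt_eqF ?addr_gt0.
    by rewrite ler_wpM2r ?invr_ge0 ?(ltW a0) //; lra.
  have a2 : `|S / (M%:R * M.+1%:R)| <= B / M.+1%:R.
    rewrite normrM normfV (gtr0_norm (mulr_gt0 Mr M1)) ler_pdivrMr ?mulr_gt0 //.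
    by apply: le_trans hS _; rewrite [X in _ <= X](_ : _ = M%:R * B) //; field; rewrite gt_eqF.
  by apply: le_trans (lerD a1 a2) _; rewrite -mulrDl (_ : B + B = 2 * B) //; ring.
by rewrite [X in _ <= X]mulrDl; apply: lerD h3; exact: le_trans h1 h2.
Qed.

(** Discrete counterpart of the integrability of [kern]: at a node p the power p^(-2/3) is at most
    3n times the increment of the cube root from the preceding node, and these increments telescope.
    Then n <= 4M gives 12. *)
Lemma sum_icbrt_gp : M%:R^-1 * \sum_(a < M) icbrt (aa (gp a)) <= 12.
Proof.
have nr : 0 < n%:R :> R by rewrite ltr0n.
have step (a : 'I_M) : icbrt (aa (gp a)) <= n%:R * 3 * (cbrt (a.+1%:R / n%:R) - cbrt (a%:R / n%:R)).
  have /andP[g0 g1] := gp_itv a.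
  apply: (@le_trans _ _ (icbrt (gp a ^+ 2))).
    by apply: le_icbrt; rewrite ?exprn_gt0 // aa_lower // g1 ltW.
  rewrite icbrt_sq //; set p : R := gp a; pose q : R := a%:R / n%:R.
  rewrite -/p -/q -[(_ / _)%R in X in _ <= X]/p.
  have q0 : 0 <= q by rewrite /q divr_ge0.
  have qp : q <= p by rewrite /p /q /gp ler_pM2r ?invr_gt0 // ler_nat.
  have e3 : n%:R * (cbrt p ^+ 3 - cbrt q ^+ 3) = 1.
    rewrite !cbrtK ?(ltW g0) // /p /q /gp -mulrBl -natr1 addrAC subrr add0r mulrC mul1r mulVf //.
  have c1 := cbrt_gt0 g0; have c2 : 0 <= cbrt q by exact: powR_ge0.
  have c3 := le_cbrt q0 qp.
  move: c1 c2 c3 e3; rewrite -/p; move: (cbrt p) (cbrt q) => x y x0 y0 yx e3.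
  rewrite -[X in X <= _]div1r ler_pdivrMr ?exprn_gt0 // -[X in X <= _]e3 -!mulrA ler_wpM2l //.
  rewrite -subr_ge0 (_ : _ - _ = (x - y) ^+ 2 * (2 * x + y)); last by ring.
  by rewrite mulr_ge0 ?sqr_ge0 // addr_ge0 ?mulr_ge0 // ltW.
have Mr : 0 < M%:R :> R by rewrite ltr0n.
rewrite mulrC ler_pdivrMr //; apply: le_trans (ler_sum _ (fun a _ => step a)) _.
rewrite -mulr_sumr -(big_mkord xpredT (fun a => cbrt (a.+1%:R / n%:R) - cbrt (a%:R / n%:R))).
rewrite telescope_sumr // mul0r.
have c0 : 0 <= cbrt (0 : R) by exact: powR_ge0.
have c1 : cbrt (M%:R / n%:R : R) <= 1.
  apply: cbrt_le1; rewrite divr_ge0 //= ler_pdivrMr // mul1r ler_nat; lia.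
have nM : n%:R <= 4 * M%:R :> R by rewrite -natrM ler_nat; lia.
nra.
Qed.

End RiemannSum1.

Section RiemannSum.
Variables (R : realType) (M : nat).
Hypothesis M0 : (0 < M)%N.
Implicit Types (t : nat -> R) (Phi Psi : (nat -> R) -> R).
Local Notation gp := (@gp R M).

Fixpoint av (k : nat) Phi t : R :=
  if k is k'.+1 then M%:R^-1 * \sum_(a < M) av k' Phi (upd k' (gp a) t) else Phi t.

Lemma avB k Phi Psi t : av k (fun t => Phi t - Psi t) t = av k Phi t - av k Psi t.
Proof.
elim: k t => //= k IH t; rewrite -mulrBr -sumrB; congr (_ * _).
by apply: eq_bigr => a _.
Qed.

Lemma mean_cst (c : R) : M%:R^-1 * \sum_(a < M) c = c.
Proof. by rewrite sumr_const card_ord -[X in _ * X]mulr_natl mulKf // pnatr_eq0 -lt0n. Qed.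

Lemma mean_norm (f : 'I_M -> R) (c : R) : (forall a, `|f a| <= c) ->
  `|M%:R^-1 * \sum_(a < M) f a| <= c.
Proof.
move=> h; rewrite -[X in _ <= X](@mean_cst) normrM ger0_norm ?invr_ge0 //.
by rewrite ler_wpM2l ?invr_ge0 //; apply: le_trans (ler_norm_sum _ _ _) _; exact: ler_sum.
Qed.

Lemma J_av (d : nat) (K B : R) Phi : 0 <= K -> lipOn d (fun=> True) K Phi ->
  (forall t, `|Phi t| <= B) -> (forall k s t, Phi (upd k (1 - s) t) = Phi (upd k s t)) ->
  forall k t, `|J k Phi t - av k Phi t| <= k%:R * ((K + 2 * B) / M.+1%:R).
Proof.
move=> K0 hL hB hs; elim=> [|k IH] t; first by rewrite subrr normr0 mul0r.
have sT m : stable (fun _ : nat -> R => True) m by [].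
rewrite /= -natr1 mulrDl mul1r [X in _ <= X]addrC.
have h1 := @riemann_half R M M0 (fun s => J k Phi (upd k s t)) K B K0.
have tri (a b c : R) : `|a - b| <= `|a - c| + `|c - b|.
  by rewrite (_ : a - b = (a - c) + (c - b)) ?ler_normD //; ring.
apply: le_trans (tri _ _ (M%:R^-1 * \sum_(a < M) J k Phi (upd k (gp a) t))) (lerD (h1 _ _ _) _).
- by apply: (slice_lip (sT k.+1) K0 _ (ltnSn k)) => //; apply: (lip_J (sT k) K0 hL).
- by move=> s; apply: (J_bound (sT k) K0 hL (B := fun=> B)).
- move=> s; rewrite -!J_upd //; congr J; apply/funext => t'; exact: hs.
rewrite -mulrBr -sumrB; apply: mean_norm => a; exact: IH.
Qed.

Definition ovr k (c : {ffun 'I_k -> 'I_M}) t : nat -> R :=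
  fun j => if insub j is Some i then gp (c i) else t j.

Lemma av_sum k Phi t : av k Phi t = (M%:R ^+ k)^-1 * \sum_(c : {ffun 'I_k -> 'I_M}) Phi (ovr c t).
Proof.
elim: k t => [|k IH] t /=.
  rewrite expr0 invr1 mul1r (big_pred1 [ffun i => Ordinal M0]).
    by congr Phi; apply/funext => j; rewrite /ovr; case: insubP.
  by move=> c; apply/esym/eqP/ffunP => -[].
under eq_bigr => a _ do rewrite IH.
rewrite -mulr_sumr mulrA exprS invfM; congr (_ * _).
rewrite pair_bigA /=.
pose h (p : 'I_M * {ffun 'I_k -> 'I_M}) : {ffun 'I_k.+1 -> 'I_M} :=
  [ffun i => if unlift ord_max i is Some j then p.2 j else p.1].
pose h' (c : {ffun 'I_k.+1 -> 'I_M}) := (c ord_max, [ffun j => c (lift ord_max j)]) : 'I_M * {ffun 'I_k -> 'I_M}.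
rewrite [RHS](reindex h) /=; last first.
  exists h' => [[a c] _|c _].
    rewrite /h' /h /= ffunE unlift_none; congr (_, _); apply/ffunP => j.
    by rewrite !ffunE liftK.
  by apply/ffunP => i; rewrite ffunE /=; case: unliftP => [j ->|->] //; rewrite ffunE.
apply: eq_bigr => -[a c] _ /=; congr Phi; apply/funext => j; rewrite /ovr /upd.
case: insubP => [i ik iE|jk].
  have jk1 : (j < k.+1)%N by exact: ltnW.
  rewrite (insubT (fun j => j < k.+1)%N jk1) ffunE /=; congr (gp _).
  case: unliftP => [i' e|/(congr1 val) /= e]; last by rewrite e ltnn in ik.
  congr (val (c _)); apply/val_inj; rewrite iE.
  by have := congr1 val e; rewrite /= /bump leqNgt ltn_ord.
case: insubP => [i ik iE|jk1].
  have ej : j = k by move: ik jk; rewrite ltnS leq_eqVlt => /orP[/eqP //|->].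
  rewrite ej eqxx ffunE; congr (gp _); case: unliftP => [i' e|//].
  have := congr1 val e; rewrite /= /bump leqNgt ltn_ord /= add0n iE ej => e'.
  by have := ltn_ord i'; rewrite -e' ltnn.
by rewrite gtn_eqF // ltnNge -ltnS.
Qed.

Lemma av_bound_out m Phi (c : R -> R) t :
  (forall t, 0 < aa (t m) -> `|Phi t| <= c (t m)) ->
  `|av m.+1 Phi t| <= M%:R^-1 * \sum_(a < M) c (gp a).
Proof.
move=> h /=.
have key k t' : (k <= m)%N -> 0 < aa (t' m) -> `|av k Phi t'| <= c (t' m).
  elim: k t' => [|k IH] t' km at' /=; first exact: h.
  apply: mean_norm => a; apply: le_trans (IH _ (ltnW km) _) _; by rewrite updN // gtn_eqF.
rewrite normrM ger0_norm ?invr_ge0 // ler_wpM2l ?invr_ge0 //.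
apply: le_trans (ler_norm_sum _ _ _) _; apply: ler_sum => a _.
have /andP[g0 g1] := @gp_itv R M a.
have ag : 0 < aa (gp a) by apply: aa_gt0; lra.
by have := key m (upd m (gp a) t) (leqnn m); rewrite updE; apply.
Qed.

End RiemannSum.

Section MahlerLimit.
Variables (R : realType) (m : nat).
Local Notation d := m.+1.
Implicit Types (t : nat -> R).

Lemma ln_dist (e x y : R) : 0 < e -> e <= x -> e <= y -> `|ln x - ln y| <= `|x - y| / e.
Proof.
move=> e0; wlog xy : x y / x <= y.
  move=> h ex ey; have [|/ltW yx] := leP x y; first by move=> xy; exact: h.
  by rewrite distrC [`|x - y|]distrC h.
move=> ex ey; have x0 := lt_le_trans e0 ex; have y0 := lt_le_trans e0 ey.
rewrite distrC [`|x - y|]distrC !ger0_norm ?subr_ge0 ?ler_ln ?posrE //.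
rewrite -ln_div ?posrE //.
have -> : y / x = 1 + (y - x) / x by field; rewrite gt_eqF.
apply: le_trans (le_ln1Dx _) _.
  by apply: (@lt_le_trans _ _ 0) => //; rewrite divr_ge0 ?subr_ge0 // ltW.
by rewrite ler_wpM2l ?subr_ge0 // lef_pV2 ?posrE.
Qed.

(** For e > 0 the integrand is bounded and Lipschitz everywhere, so its grid means converge; for e =
    0 it is the one of the theorem and of the determinant. *)
Definition lnF (e : R) t : R := ln (Ffun d t + e).

Lemma lnF_lip (P : (nat -> R) -> Prop) (e b : R) : 0 < b ->
  (forall t, P t -> b <= Ffun d t + e) -> lipOn d P (4 * pi / b) (lnF e).
Proof.
move=> b0 hP t t' Pt Pt'; apply: le_trans (ln_dist b0 (hP _ Pt) (hP _ Pt')) _.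
rewrite opprD addrACA subrr addr0 mulrAC ler_wpM2r ?invr_ge0 ?(ltW b0) //.
exact: (@F_lip R d P).
Qed.

Lemma F_ge0 t : 0 <= Ffun d t.
Proof. by rewrite FfunE sumr_ge0 // => j _; exact: aa_ge0. Qed.

(** From 1 + c^3 <= (1 + c)^3 and ln(1 + c) <= c, with c the cube root of e/x. The resulting
    singularity in x is the one handled by [kern] and by [sum_icbrt_gp]. *)
Lemma ln_cbrt (x e : R) : 0 < x -> 0 <= e -> `|ln (x + e) - ln x| <= 3 * cbrt e * icbrt x.
Proof.
move=> x0 e0; have xe : 0 < x + e by rewrite ltr_wpDr.
rewrite ger0_norm; last by rewrite subr_ge0 ler_ln ?posrE // lerDl.
rewrite -ln_div ?posrE //; have -> : (x + e) / x = 1 + e / x by field; rewrite gt_eqF.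
have q0 : 0 <= e / x by rewrite divr_ge0 // ltW.
have c0 : 0 <= cbrt (e / x) by exact: powR_ge0.
have h : ln (1 + e / x) <= ln ((1 + cbrt (e / x)) ^+ 3).
  rewrite ler_ln ?posrE ?exprn_gt0 ?ltr_wpDr // -{1}(cbrtK q0).
  move: (cbrt _) c0 => c c0; rewrite -subr_ge0 (_ : _ - _ = 3 * c + 3 * c ^+ 2); last by ring.
  by rewrite addr_ge0 // mulr_ge0 // sqr_ge0.
apply: le_trans h _; rewrite lnXn ?ltr_wpDr // -[_ *+ 3]mulr_natl -mulrA ler_pM2l //.
apply: le_trans (le_ln1Dx _) _; first exact: lt_le_trans c0.
rewrite /icbrt /cbrt powRM ?invr_ge0 ?(ltW x0) // ler_wpM2l ?powR_ge0 //.
by rewrite -powR_inv1 ?(ltW x0) // -powRrM mulrC powRrM powR_inv1 // powR_ge0.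
Qed.

Lemma lnF_lip_out (e b : R) : 0 <= e -> 0 < b -> exists2 K : R, 0 <= K & lipOn d (Pout m b) K (lnF e).
Proof.
move=> e0 b0; exists (4 * pi / b); first by rewrite divr_ge0 ?mulr_ge0 ?pi_ge0 // ltW.
by apply: lnF_lip => // t /Pout_F h; rewrite ler_wpDr.
Qed.

Lemma lnF_good e : 0 <= e -> good d m (lnF e).
Proof.
move=> e0; have hL b (b0 : 0 < b) := lnF_lip_out e0 b0; split=> //.
have c4 : 0 <= (4 * d)%:R + e :> R by rewrite addr_ge0.
exists (((4 * d)%:R + e) * 2 + 3); first by rewrite addr_ge0 // mulr_ge0.
apply: good_bounded; [by move=> b b0; exact: hL| |by rewrite addr_ge0 // mulr_ge0].
move=> t at0; have F0 := F_gt0 at0; have Fm : aa (t m) <= Ffun d t := aa_le_F t (@ord_max m).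
have x0 : 0 < Ffun d t + e by rewrite ltr_wpDr.
have h1 : lnF e t <= (4 * d)%:R + e.
  rewrite /lnF; have := @le_ln1Dx R (Ffun d t + e - 1) _; rewrite addrCA subrr addr0 => h.
  have {}h : ln (Ffun d t + e) <= Ffun d t + e - 1 by apply: h; lra.
  by apply: le_trans h _; have := F_le d t; lra.
have h2 : - (3 * icbrt (aa (t m))) <= lnF e t.
  have [l1|l1] := leP 1 (Ffun d t + e).
    by apply: (@le_trans _ _ 0); [rewrite oppr_le0 mulr_ge0 ?icbrt_ge0|exact: ln_ge0].
  (* Below 1 the logarithm is compared with ln 1 = 0, the increment being what is missing to 1. *)
  have := @ln_cbrt (Ffun d t + e) (1 - (Ffun d t + e)) x0 ltac:(lra).
  rewrite (_ : Ffun d t + e + (1 - (Ffun d t + e)) = 1); last by ring.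
  rewrite ln1 sub0r normrN => h.
  have h3 : cbrt (1 - (Ffun d t + e)) <= 1 by apply: cbrt_le1; lra.
  have h4 : icbrt (Ffun d t + e) <= icbrt (aa (t m)) by apply: le_icbrt => //; lra.
  have i0 := icbrt_ge0 (Ffun d t + e); have c0 : 0 <= cbrt (1 - (Ffun d t + e)) by exact: powR_ge0.
  move: h; rewrite ler_norml => /andP[h _]; apply: le_trans h; rewrite lerN2 -mulrA ler_pM2l //.
  by rewrite -[X in _ <= X]mul1r ler_pM.
have h5 := icbrt_le4 at0 (aa_le4 (t m)).
have i0 := icbrt_ge0 (aa (t m)).
rewrite ler_norml; apply/andP; split; nra.
Qed.

Lemma lnF_regularize e : 0 <= e ->
  `|J d (lnF e) (fun=> 0) - J d (lnF 0) (fun=> 0)| <= 18 * cbrt e.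
Proof.
move=> e0; have g1 := lnF_good e0; have g0 := lnF_good (lexx 0).
have g2 := good_Z (-1) g0; have g3 := good_D g1 g2.
have -> : J d (lnF e) (fun=> 0) - J d (lnF 0) (fun=> 0) =
    J d (fun t => lnF e t + -1 * lnF 0 t) (fun=> 0).
  by rewrite (@Jgood_D _ d m) // (@Jgood_Z _ d m) // mulN1r.
have c0 : 0 <= cbrt e by exact: powR_ge0.
have -> : 18 * cbrt e = 6 * (3 * cbrt e) by ring.
apply: (Jgood_bound g3); first by rewrite mulr_ge0.
apply: good_bounded; [exact: g3.1| |by rewrite mulr_ge0].
move=> t at0; have F0 := F_gt0 at0; rewrite mulN1r /lnF addr0.
apply: le_trans (ln_cbrt F0 e0) _; rewrite ler_wpM2l ?mulr_ge0 //.
by apply: le_icbrt => //; exact: (aa_le_F t (@ord_max m)).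
Qed.

Lemma av_regularize M e t : (0 < M)%N -> 0 <= e ->
  `|av M d (lnF e) t - av M d (lnF 0) t| <= 36 * cbrt e.
Proof.
move=> M0 e0; have c0 : 0 <= cbrt e by exact: powR_ge0.
rewrite -avB; apply: le_trans (av_bound_out (c := fun x => 3 * cbrt e * icbrt (aa x)) M0 _ _) _.
  move=> t' at0; have F0 := F_gt0 at0; rewrite /lnF addr0.
  apply: le_trans (ln_cbrt F0 e0) _; rewrite ler_wpM2l ?mulr_ge0 //.
  by apply: le_icbrt => //; exact: (aa_le_F t' (@ord_max m)).
rewrite -mulr_sumr mulrCA; have := sum_icbrt_gp R M0; set S := _ * _ => h.
have -> : 36 * cbrt e = 3 * cbrt e * 12 by ring.
by rewrite ler_wpM2l ?mulr_ge0.
Qed.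

Lemma eigval_F N (k : boxT d N) : eigval R k = Ffun d (ovr k (fun=> 0)).
Proof.
rewrite FfunE; apply: eq_bigr => j _; rewrite /ovr.
case: insubP => [i _ iE|]; last by rewrite ltn_ord.
have -> : i = j by apply/val_inj.
rewrite /aa; congr (_ - _ * cos _); rewrite /ang /gp natrD; field.
by rewrite -!natrD !pnatr_eq0.
Qed.

Lemma ln_npat_av N : ln ((npat d N)%:R : R) / (boxcard d N)%:R = av N.*2.+1 d (lnF 0) (fun=> 0).
Proof.
rewrite ln_npat // av_sum // mulrC /boxcard natrX; congr (_ * _).
by apply: eq_bigr => k _; rewrite /lnF addr0 eigval_F.
Qed.

Lemma combine_bounds (a1 a2 a3 a4 X Y c : R) : `|a2 - a1| <= 18 * c -> `|a4 - a3| <= 36 * c ->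
  `|a2 - a4| <= X -> X <= Y -> `|a1 - a3| <= 54 * c + Y.
Proof.
rewrite !ler_norml => /andP[? ?] /andP[? ?] /andP[? ?] ?.
by apply/andP; split; lra.
Qed.

(** For fixed e > 0 the integral and the grid mean of [lnF e] differ by O(1/N). Going back to e = 0
    costs 18 cbrt e in the integral and 36 cbrt e in the mean, uniformly in N. *)
Lemma mahler_limit :
  (fun N => ln ((npat d N)%:R : R) / (boxcard d N)%:R) @ \oo --> iint d (fun t => ln (Ffun d t)).
Proof.
have -> : iint d (fun t => ln (Ffun d t)) = J d (lnF 0) (fun=> 0).
  by rewrite iintE; congr J; apply/funext => t; rewrite /lnF addr0.
apply/cvgrPdist_le => /= r r0.
have [e e0 he] : exists2 e : R, 0 < e & 54 * cbrt e <= r / 2.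
  (* Makes 54 cbrt e equal to r/2, where 54 = 18 + 36. *)
  exists ((r / 108) ^+ 3); first by rewrite exprn_gt0 // divr_gt0.
  rewrite /cbrt -powR_mulrn ?divr_ge0 ?(ltW r0) // -powRrM divff ?pnatr_eq0 //.
  by rewrite powRr1 ?divr_ge0 ?(ltW r0) //; lra.
pose b := Num.max `|ln e| `|ln ((4 * d)%:R + e)|.
have hB t : `|lnF e t| <= b.
  have F0 := F_ge0 t; have F4 := F_le d t.
  have h1 : ln e <= lnF e t by rewrite ler_ln ?posrE ?ltr_wpDl // lerDr.
  have h2 : lnF e t <= ln ((4 * d)%:R + e) by rewrite ler_ln ?posrE ?ltr_wpDl // lerD2r.
  rewrite /b le_max ler_norml; have [p|p] := leP 0 (lnF e t).
    by apply/orP; right; rewrite (ger0_norm p) (ger0_norm (le_trans p h2)).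
  apply/orP; left; rewrite (ltr0_norm (le_lt_trans h1 p)) opprK h1 /=.
  by have := le_lt_trans h1 p; lra.
pose K : R := 4 * pi / e.
have K0 : 0 <= K by rewrite divr_ge0 ?mulr_ge0 ?pi_ge0 // ltW.
have hL : lipOn d (fun=> True) K (lnF e) by apply: lnF_lip => // t _; rewrite lerDr F_ge0.
have hs k s t : lnF e (upd k (1 - s) t) = lnF e (upd k s t).
  rewrite /lnF !FfunE; congr (ln (_ + _)); apply: eq_bigr => j _; rewrite /upd.
  by case: ifP => // _; rewrite aa_sym.
have key N : `|J d (lnF 0) (fun=> 0) - ln ((npat d N)%:R : R) / (boxcard d N)%:R| <=
    54 * cbrt e + d%:R * (K + 2 * b) / N.+1%:R.
  rewrite ln_npat_av.
  have h1 := lnF_regularize (ltW e0).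
  have h2 := @av_regularize N.*2.+1 e (fun=> 0) isT (ltW e0).
  have h3 := @J_av R N.*2.+1 isT d K b (lnF e) K0 hL hB hs d (fun=> 0).
  have b0 : 0 <= b by rewrite le_max normr_ge0.
  have h4 : d%:R * ((K + 2 * b) / (N.*2.+1).+1%:R) <= d%:R * (K + 2 * b) / N.+1%:R.
    have kb : 0 <= K + 2 * b by apply: addr_ge0 => //; exact: mulr_ge0.
    rewrite mulrA; apply: ler_wpM2l; first exact: mulr_ge0.
    rewrite lef_pV2 ?posrE ?ltr0n // ler_nat.
    by rewrite ltnS -addnn ltnW // ltnS leq_addr.
  exact: combine_bounds h1 h2 h3 h4.
have lim0 : (fun N => d%:R * (K + 2 * b) / N.+1%:R) @ \oo --> (0 : R).
  rewrite -[0](mulr0 (d%:R * (K + 2 * b))); apply: cvgM; first exact: cvg_cst.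
  exact: cvg_harmonic.
have r2 : 0 < r / 2 by rewrite divr_gt0.
near=> N; apply: le_trans (key N) _.
have : `|0 - d%:R * (K + 2 * b) / N.+1%:R| <= r / 2.
  by near: N; move/cvgrPdist_le: lim0; apply.
by rewrite sub0r normrN => /(le_trans (ler_norm _)) h; rewrite (splitr r); exact: lerD.
Unshelve. all: by end_near. Qed.

End MahlerLimit.

(** * Convolution with the homoclinic point *)

Section Rho.
Variable R : realType.
Implicit Types x y : R.

Lemma rho_itv x : 0 <= rho x < 1.
Proof. by rewrite /rho; have := floor_itv x; rewrite intrD mulr1z; lra. Qed.

Lemma sub_rho_int x : x - rho x \is a Num.int.
Proof. by rewrite /rho opprB addrC subrK intr_int. Qed.

Lemma rho_small x : 0 <= x < 1 -> rho x = x.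
Proof. by move=> h; rewrite /rho (floor_def (m := 0)) ?subr0 // add0r mulr1z. Qed.

Lemma rhoP x y : rho x = rho y <-> x - y \is a Num.int.
Proof.
split=> [e|h].
  have -> : x - y = (x - rho x) - (y - rho y) by rewrite e; ring.
  by rewrite rpredB // sub_rho_int.
have -> : x = y + (x - y) by ring.
by rewrite /rho floorDrz // intrD (floorK h); ring.
Qed.

Lemma rho0P x : rho x = 0 <-> x \is a Num.int.
Proof. by rewrite -{2}[x]subr0 -rhoP (@rho_small 0) ?lexx ?ltr01. Qed.

End Rho.

(** * Absolutely summable families on the lattice *)

Section AbsSum.
Variables (R : realType) (d : nat).
Local Notation Zd := (Zd d).
Local Notation evec := (@evec d).
Implicit Types (a b : Zd -> R) (s : seq Zd) (n m k : Zd).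

(** Summability through finite duplicate-free lists: translation and reflection become mere
    reindexings of the list. *)
Definition asum a := exists M : R, forall s, uniq s -> \sum_(n <- s) `|a n| <= M.
Definition tail a (K : nat) (e : R) :=
  forall s, uniq s -> (forall n, n \in s -> ~~ inbox K n) -> \sum_(n <- s) `|a n| <= e.

Lemma ell1_asum a : ell1 a -> asum a.
Proof.
move=> h; have e0 : (0 <= \esum_(n in [set: Zd]) (`|a n|)%:E)%E by apply: esum_ge0 => n _; rewrite lee_fin.
exists (fine (\esum_(n in [set: Zd]) (`|a n|)%:E)) => s us.
rewrite -lee_fin fineK; last by rewrite ge0_fin_numE.
rewrite -sumEFin fsbig_seq //.
apply: ereal_sup_ubound; exists [set` s] => //.
by split=> //; exact: finite_seq.
Qed.

Lemma asumD a b : asum a -> asum b -> asum (fun n => a n + b n).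
Proof.
move=> [M hM] [N hN]; exists (M + N) => s us.
apply: le_trans (lerD (hM s us) (hN s us)); rewrite -big_split.
by apply: ler_sum => n _; exact: ler_normD.
Qed.

Lemma asumM a b (C : R) : asum a -> (forall n, `|b n| <= C) -> asum (fun n => a n * b n).
Proof.
move=> [M hM] hb; have C0 : 0 <= C by apply: le_trans (hb 0).
exists (M * C) => s us; apply: (@le_trans _ _ (\sum_(n <- s) `|a n| * C)).
  by apply: ler_sum => n _; rewrite normrM ler_wpM2l.
by rewrite -mulr_suml ler_wpM2r // hM.
Qed.

Lemma asumZ a (c : R) : asum a -> asum (fun n => c * a n).
Proof.
move=> [M hM]; exists (`|c| * M) => s us.
under eq_bigr => n _ do rewrite normrM.
by rewrite -mulr_sumr ler_wpM2l // hM.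
Qed.

Lemma asum_shift a m : asum a -> asum (fun n => a (n + m)).
Proof.
move=> [M hM]; exists M => s us.
rewrite -(big_map (fun n => n + m) xpredT (fun n => `|a n|)).
by apply: hM; rewrite map_inj_uniq //; exact: addIr.
Qed.

Lemma asumN a : asum a -> asum (fun n => a (- n)).
Proof.
move=> [M hM]; exists M => s us.
rewrite -(big_map (fun n : Zd => - n) xpredT (fun n => `|a n|)).
by apply: hM; rewrite map_inj_uniq //; exact: oppr_inj.
Qed.

Lemma sub_box_ex s : exists K, {subset s <= box d K}.
Proof.
exists (\max_(n <- s) supnorm n) => n ns; rewrite mem_box /inbox.
by rewrite (leq_bigmax_seq (F := @supnorm d)).
Qed.

Lemma box_subset K N : (K <= N)%N -> {subset box d K <= box d N}.
Proof. by move=> KN n; rewrite !mem_box; exact: inboxS. Qed.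

Lemma tailP a (e : R) : asum a -> 0 < e -> exists K, tail a K e.
Proof.
move=> [M hM] e0; pose E : set R := [set r | exists2 s, uniq s & r = \sum_(n <- s) `|a n|].
have hE : has_sup E.
  split; first by exists 0, [::] => //; rewrite big_nil.
  by exists M => r [s us ->]; exact: hM.
have [r [s0 us0 ->] hr] := sup_adherent e0 hE.
have [K sK] := sub_box_ex s0; exists K => s us hs.
have u : uniq (s0 ++ s).
  rewrite cat_uniq us0 us andbT /= -all_predC; apply/allP => n /hs /=.
  by apply: contra => /sK; rewrite mem_box.
have : \sum_(n <- s0 ++ s) `|a n| <= sup E by apply: sup_ubound => //; [exact: hE.2|exists (s0 ++ s)].
rewrite big_cat /=; lra.
Qed.

Lemma tail_leK a K N e : (K <= N)%N -> tail a K e -> tail a N e.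
Proof. by move=> KN h s us hs; apply: h => // n /hs; apply: contra; exact: inboxS. Qed.

Lemma sum_tail a K e s : tail a K e -> uniq s -> {subset box d K <= s} ->
  `|\sum_(n <- s) a n - \sum_(n <- box d K) a n| <= e.
Proof.
move=> h us sK; rewrite (bigID (mem (box d K))) /= -[X in X + _ - _]big_filter.
have p : perm_eq [seq n <- s | n \in box d K] (box d K).
  apply: uniq_perm; rewrite ?filter_uniq ?box_uniq // => n; rewrite mem_filter.
  by case: (boolP (n \in box d K)) => // /sK ->.
rewrite (perm_big _ p) /= addrC addKr -big_filter.
apply: le_trans (ler_norm_sum _ _ _) _; apply: h; first by rewrite filter_uniq.
by move=> n; rewrite mem_filter mem_box => /andP[].
Qed.

Lemma zsumE a : zsum a = limn (fun N => \sum_(n <- box d N) a n).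
Proof. by congr (limn _); apply/funext => N; rewrite big_box. Qed.

(** Written as the difference of the series of a + |a| and |a|, whose box sums are monotone and
    bounded. *)
Lemma zsum_cvg a : asum a -> (fun N => \sum_(n <- box d N) a n) @ \oo --> zsum a.
Proof.
move=> ha; rewrite zsumE; set u := fun N => _.
have mono (b : Zd -> R) : (forall n, 0 <= b n) -> asum b -> cvgn (fun N => \sum_(n <- box d N) b n).
  move=> b0 [M hM]; apply: nondecreasing_is_cvgn.
    move=> N N' NN; rewrite [X in _ <= X](bigID (mem (box d N))) /= -[X in _ <= X + _]big_filter.
    have p : perm_eq [seq n <- box d N' | n \in box d N] (box d N).
      apply: uniq_perm; rewrite ?filter_uniq ?box_uniq // => n; rewrite mem_filter.
      by case: (boolP (n \in box d N)) => // /(box_subset NN) ->.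
    by rewrite (perm_big _ p) lerDl sumr_ge0.
  exists M => r [N _ <-]; apply: le_trans (hM _ (box_uniq _ _)).
  by apply: ler_sum => n _; exact: ler_norm.
have hn : asum (fun n => `|a n|).
  by have [M hM] := ha; exists M => s us; under eq_bigr => n _ do rewrite normr_id; exact: hM.
have c1 := mono _ (fun n => normr_ge0 (a n)) hn.
have c2 : cvgn (fun N => \sum_(n <- box d N) (a n + `|a n|)).
  by apply: mono; [move=> n; have := ler_norm (- a n); rewrite normrN; lra|exact: asumD].
have -> : u = (fun N => \sum_(n <- box d N) (a n + `|a n|) - \sum_(n <- box d N) `|a n|).
  by apply/funext => N; rewrite -sumrB; apply: eq_bigr => n _; rewrite addrK.
by apply: is_cvgB.
Qed.

Lemma zsum_lim a (l : R) : (fun N => \sum_(n <- box d N) a n) @ \oo --> l -> zsum a = l.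
Proof. by rewrite zsumE => /cvg_lim; apply; exact: Rhausdorff. Qed.

Lemma zsum_approx a K e s : asum a -> tail a K e -> uniq s -> {subset box d K <= s} ->
  `|zsum a - \sum_(n <- s) a n| <= 2 * e.
Proof.
move=> ha ht us sK; apply/ler_addgt0Pr => r r0.
have /cvgrPdist_le/(_ r r0) [N _ hN] := zsum_cvg ha.
have h1 := hN (maxn N K) (leq_maxl _ _).
have h2 := sum_tail ht (box_uniq d (maxn N K)) (box_subset (leq_maxr _ _)).
have h3 := sum_tail ht us sK.
move: h1 h2 h3 => /=; move: (zsum a) (\sum_(n <- s) _) (\sum_(n <- box d K) _) (\sum_(n <- box d _) _).
move=> x y z t; rewrite !ler_norml => /andP[? ?] /andP[? ?] /andP[? ?].
by apply/andP; split; lra.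
Qed.

Lemma zsumD a b : asum a -> asum b -> zsum (fun n => a n + b n) = zsum a + zsum b.
Proof.
move=> ha hb; apply: zsum_lim.
have -> : (fun N => \sum_(n <- box d N) (a n + b n)) =
    (fun N => \sum_(n <- box d N) a n + \sum_(n <- box d N) b n).
  by apply/funext => N; rewrite big_split.
by apply: cvgD; exact: zsum_cvg.
Qed.

Lemma zsumZ a c : asum a -> zsum (fun n => c * a n) = c * zsum a.
Proof.
move=> ha; apply: zsum_lim.
have -> : (fun N => \sum_(n <- box d N) (c * a n)) = (fun N => c * \sum_(n <- box d N) a n).
  by apply/funext => N; rewrite mulr_sumr.
by apply: cvgM; [exact: cvg_cst|exact: zsum_cvg].
Qed.

Lemma zsumN a : asum a -> zsum (fun n => - a n) = - zsum a.
Proof.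
by move=> ha; rewrite -mulN1r -zsumZ //; congr zsum; apply/funext => n; rewrite mulN1r.
Qed.

Lemma zsum_shift a m : asum a -> zsum (fun n => a (n + m)) = zsum a.
Proof.
move=> ha; apply: zsum_lim; apply/cvgrPdist_le => e e0.
have e2 : 0 < e / 2 by rewrite divr_gt0.
have [K hK] := tailP ha e2.
exists (K + supnorm m)%N => // N /= KN.
rewrite -(big_map (fun n => n + m) xpredT a).
have := @zsum_approx a K (e / 2) [seq n + m | n <- box d N] ha hK.
rewrite mulrC divfK //; apply.
  by rewrite map_inj_uniq ?box_uniq //; exact: addIr.
move=> n; rewrite mem_box => nK; apply/mapP; exists (n - m); last by rewrite subrK.
rewrite mem_box; apply: inboxS KN _; apply: inboxD => //.
by rewrite inboxN /inbox.
Qed.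

Lemma zsum_finite a s : uniq s -> (forall n, n \notin s -> a n = 0) -> zsum a = \sum_(n <- s) a n.
Proof.
move=> us hs; have [K sK] := sub_box_ex s.
apply: zsum_lim; apply: cvg_near_cst; exists K => // N /= KN.
rewrite (bigID (mem s)) /= [X in _ + X]big1 ?addr0; last by move=> n /hs.
rewrite -big_filter; apply: perm_big; apply: uniq_perm; rewrite ?filter_uniq ?box_uniq //.
move=> n; rewrite mem_filter; case: (boolP (n \in s)) => // /sK.
by move=> /(box_subset KN) ->.
Qed.

Definition cv (W x : Zd -> R) n : R := zsum (fun k => W k * x (n - k)).

Definition bounded (x : Zd -> R) := exists C : R, forall n, `|x n| <= C.

Lemma cv_asum W x n : asum W -> bounded x -> asum (fun k => W k * x (n - k)).
Proof. by move=> hW [C hC]; apply: asumM hW _ => k; exact: hC. Qed.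

Lemma cv_shift W x m n : asum W -> bounded x -> cv (fun k => W (k + m)) x n = cv W x (n + m).
Proof.
move=> hW hx; rewrite /cv -(zsum_shift m (cv_asum (n + m) hW hx)); congr zsum.
by apply/funext => k; rewrite opprD addrA addrAC addrK.
Qed.

Lemma cvDl W W' x n : asum W -> asum W' -> bounded x ->
  cv (fun k => W k + W' k) x n = cv W x n + cv W' x n.
Proof.
move=> h1 h2 hx; rewrite /cv -zsumD; try exact: cv_asum.
by congr zsum; apply/funext => k; rewrite mulrDl.
Qed.

Lemma cvDr W x y n : asum W -> bounded x -> bounded y ->
  cv W (fun k => x k + y k) n = cv W x n + cv W y n.
Proof.
move=> h1 hx hy; rewrite /cv -zsumD; try exact: cv_asum.
by congr zsum; apply/funext => k; rewrite mulrDr.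
Qed.

Lemma cvNr W x n : asum W -> bounded x -> cv W (fun k => - x k) n = - cv W x n.
Proof.
move=> h1 hx; rewrite /cv -zsumN; last exact: cv_asum.
by congr zsum; apply/funext => k; rewrite mulrN.
Qed.

Lemma boundedD x y : bounded x -> bounded y -> bounded (fun n => x n + y n).
Proof.
move=> [C hC] [D hD]; exists (C + D) => n; apply: le_trans (ler_normD _ _) _.
by rewrite lerD.
Qed.

Lemma boundedN x : bounded x -> bounded (fun n => - x n).
Proof. by move=> [C hC]; exists C => n; rewrite normrN. Qed.

(* Everything is reduced to translations: a finite combination of translates acts on either factor
   of the convolution product. *)
Lemma cv_act p W x n : asum W -> bounded x ->
  [/\ asum (act p W), bounded (act p x), cv (act p W) x n = act p (cv W x) n &
      cv W (act p x) n = act p (cv W x) n].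
Proof.
move=> hW hx; elim: p n => [|[k c] p IH] n.
  have e (y : Zd -> R) : act [::] y = fun=> 0 by apply/funext => l; rewrite /act big_nil.
  rewrite !e; have z0 : zsum (fun _ : Zd => 0 : R) = 0.
    by rewrite (@zsum_finite _ [::]) ?big_nil.
  split; first by exists 0 => s _; rewrite big1 // => l _; rewrite normr0.
  - by exists 0 => l; rewrite normr0.
  - by rewrite /cv -[RHS]z0; congr zsum; apply/funext => l; rewrite mul0r.
  - by rewrite /cv -[RHS]z0; congr zsum; apply/funext => l; rewrite mulr0.
have e (y : Zd -> R) : act ((k, c) :: p) y = fun l => c%:~R * y (l + (- k)) + act p y l.
  by apply/funext => l; rewrite /act big_cons mulrzl.
have [a1 a2 a3 a4] := IH n; rewrite !e.
have b1 : asum (fun l => c%:~R * W (l + - k)) by apply: asumZ; exact: asum_shift.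
have [C hC] := hx.
have b2 : bounded (fun l => c%:~R * x (l + - k)).
  by exists (`|c%:~R| * C) => l; rewrite normrM ler_wpM2l.
split; [exact: asumD|exact: boundedD| |].
  rewrite cvDl // a3; congr (_ + _); rewrite -cv_shift // /cv -zsumZ; last first.
    by apply: cv_asum => //; exact: asum_shift.
  by congr zsum; apply/funext => l; rewrite mulrA.
rewrite cvDr // a4; congr (_ + _); rewrite /cv -zsumZ; last exact: cv_asum.
by congr zsum; apply/funext => l; rewrite mulrCA addrAC.
Qed.

Lemma cv_coef p x n : cv (fun k => (coef p k)%:~R) x n = act p x n.
Proof.
pose s := undup (map fst p).
rewrite /cv (@zsum_finite _ s) ?undup_uniq //.
  rewrite (@act_coef _ _ p x n s) ?undup_uniq //; last by move=> k; rewrite mem_undup.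
  by apply: eq_bigr => k _; rewrite mulrzl.
by move=> k ks; rewrite coef_notin ?mul0r // -mem_undup.
Qed.

End AbsSum.

Section Homoclinic.
Variables (R : realType) (m : nat).
Hypothesis m0 : (0 < m)%N.
Local Notation d := m.+1.
Local Notation Zd := (Zd d).
Variable g : lpoly d.
Hypothesis hg : @in_Id R d g.

Definition Wg : Zd -> R := Defs.conv (lstar g) (@w R d).

(** Because [w] is even, g^* w is the reflection of g w, which is summable by hypothesis. *)
Lemma Wg_asum : asum Wg.
Proof.
have := asumN (ell1_asum hg); congr asum; apply/funext => n.
rewrite /Wg !convE act_lstar /act; apply: eq_bigr => kc _.
by rewrite -opprD w_even.
Qed.

Lemma lap_Wg n : lap Wg n = (coef (lstar g) n)%:~R.
Proof.
have e : Wg =1 act (lstar g) (@w R d) by move=> k; rewrite /Wg convE.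
rewrite -act_fpoly (eq_act _ e).
rewrite act_comm coefE -(act_morph (intr : int -> R)); apply: eq_act => k.
by rewrite act_fpoly lap_w // /zdelta; case: eqP.
Qed.

Lemma lap_cv x n : bounded x -> lap (cv Wg x) n = act (lstar g) x n.
Proof.
move=> hx; rewrite -act_fpoly; have [_ _ <- _] := cv_act (fpoly d) n Wg_asum hx.
rewrite -cv_coef; congr cv; apply/funext => k; by rewrite act_fpoly lap_Wg.
Qed.

Lemma cv_lap x n : bounded x -> cv Wg (lap x) n = act (lstar g) x n.
Proof.
move=> hx; rewrite -lap_cv // -act_fpoly; have [_ _ _ <-] := cv_act (fpoly d) n Wg_asum hx.
by congr cv; apply/funext => k; rewrite act_fpoly.
Qed.

Lemma act_int (p : lpoly d) (v : Zd -> R) n : (forall k, v k \is a Num.int) -> act p v n \is a Num.int.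
Proof. by move=> hv; apply: rpred_sum => kc _; rewrite rpredMz. Qed.

Lemma XfP (x : Zd -> R) : Xf x <-> (forall n, 0 <= x n < 1) /\ (forall n, lap x n \is a Num.int).
Proof.
have e n : lap x n = (2 * d)%:R * x n - \sum_(j < d) (x (n + evec j) + x (n - evec j)).
  by rewrite /lap mulr_natl.
by split=> -[h1 h2]; split=> // n; have := h2 n; rewrite ?e => /rho0P.
Qed.

Lemma lap_mod (x y : Zd -> R) n : (forall k, x k - y k \is a Num.int) -> lap x n \is a Num.int ->
  lap y n \is a Num.int.
Proof.
move=> h hx; have -> : lap y n = lap x n - lap (fun k => x k - y k) n by rewrite lapB subKr.
by rewrite rpredB // -act_fpoly act_int.
Qed.

Lemma xi_Xf (v : Zd -> int) : bounded (fun n => (v n)%:~R : R) -> Xf (xi R g v).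
Proof.
move=> hv; apply/XfP; split=> [n|n]; first exact: rho_itv.
apply: (@lap_mod (cv Wg (fun k => (v k)%:~R))) => [k|]; first exact: sub_rho_int.
by rewrite lap_cv // act_int // => k; exact: intr_int.
Qed.

End Homoclinic.

(** * Divisibility of the dual group *)

Section TorusExtension.
Variables (R : realType) (d : nat).
Local Notation Zd := (Zd d).
Local Notation evec := (@evec d).
Local Notation lpoly := (lpoly d).
Implicit Types (l p q : lpoly) (x y : Zd -> R) (n : Zd).

Lemma coef_nil n : coef [::] n = 0.
Proof. by rewrite /coef big_nil. Qed.

Definition lsub l (q : int) l' : lpoly := l ++ [seq (kc.1, - q * kc.2) | kc <- l'].

Lemma act_lsub (V : zmodType) l (q : int) l' (x : Zd -> V) n :
  act (lsub l q l') x n = act l x n - act l' x n *~ q.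
Proof.
rewrite act_cat; congr (_ + _); rewrite /act big_map mulrz_suml -sumrN; apply: eq_bigr => kc _ /=.
by rewrite -mulrzA mulNr mulrNz mulrC.
Qed.

Lemma coef_lsub l (q : int) l' n : coef (lsub l q l') n = coef l n - q * coef l' n.
Proof. by rewrite !coefE act_lsub mulrzz mulrC. Qed.

(** Modulo 1, the character of the additive group of Laurent polynomials attached to [x]. The
    reflection makes it an instance of [act]. *)
Definition pairing l x : R := act l (fun n => x (- n)) 0.

Lemma pairingE l x : pairing l x = \sum_(kc <- l) x kc.1 *~ kc.2.
Proof. by apply: eq_bigr => kc _; rewrite sub0r opprK. Qed.

Lemma pairing_lsub l (q : int) l' x : pairing (lsub l q l') x = pairing l x - pairing l' x *~ q.
Proof. exact: act_lsub. Qed.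

Lemma pairing_upd l x n0 (r : R) :
  pairing l (fun n => if n == n0 then r else x n) = pairing l x + (r - x n0) *~ coef l n0.
Proof.
elim: l => [|[k c] l IH]; first by rewrite !pairingE /coef !big_nil mulr0z addr0.
have e y : pairing ((k, c) :: l) y = y k *~ c + pairing l y by rewrite !pairingE big_cons.
rewrite !e IH /coef big_cons /= -/(coef l n0); case: eqP => [->|_]; last by rewrite addrA.
by rewrite mulrzDr mulrzBl; ring.
Qed.

Lemma eq_pairing l l' x : coef l =1 coef l' -> pairing l x = pairing l' x.
Proof. by move=> e; exact: eq_coef_act. Qed.

Lemma pairing0 l x : (forall n, coef l n = 0) -> pairing l x = 0.
Proof.
by move=> e; rewrite (@eq_pairing l [::]) ?pairingE ?big_nil // => n; rewrite e /coef big_nil.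
Qed.

Section Extension.
(* [H l b]: the value of the character at [l] is prescribed to be [b] modulo 1. *)
Variable H : lpoly -> R -> Prop.
Hypothesis Hsub : forall l b l' b' (q : int), H l b -> H l' b' -> H (lsub l q l') (b - b' *~ q).
Hypothesis Hcons : forall l b, H l b -> (forall n, coef l n = 0) -> b \is a Num.int.

Let P k x := forall l b, H l b -> (forall n, coef l n != 0 -> (pickle n < k)%N) -> pairing l x - b \is a Num.int.

(** Monomials are treated in the order of [pickle]; n0 is the next one. Among the prescribed
    polynomials in the monomials up to n0, take [l0] with nonzero coefficient [c] at n0 of least
    absolute value. By Euclidean division every other one is a multiple of [l0] plus a polynomial in
    earlier monomials, so the value at n0 has a single condition to satisfy. *)
Lemma extension_step k x : P k x ->
  exists x', P k.+1 x' /\ forall n, pickle n != k -> x' n = x n.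
Proof.
move=> Pk; have [[n0 en0]|nex] := pselect (exists n : Zd, pickle n = k); last first.
  exists x; split=> // l b Hl hl; apply: Pk => // n /hl; rewrite ltnS leq_eqVlt => /orP[/eqP e|//].
  by case: nex; exists n.
have uq n : pickle n = k -> n = n0.
  by move=> e; apply: (pcan_inj (@pickleK Zd)); rewrite e en0.
pose S (m : nat) := exists l b, [/\ H l b, forall n, coef l n != 0 -> (pickle n < k.+1)%N &
  m = `|coef l n0|%N] /\ coef l n0 != 0.
have [[m Sm]|noS] := pselect (exists m, S m); last first.
  exists x; split=> // l b Hl hl; apply: Pk => // n cn.
  have := hl n cn; rewrite ltnS leq_eqVlt => /orP[/eqP e|//].
  by case: noS; exists `|coef l n0|%N, l, b; split=> //; rewrite -(uq n e).
have [m0 Sm0 min0] : exists2 m0, S m0 & forall m, S m -> (m0 <= m)%N.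
  have ex : exists m, `[< S m >] by exists m; apply/asboolP.
  exists (ex_minn ex); case: ex_minnP => m0 /asboolP // _ h m' Sm'.
  by apply: h; apply/asboolP.
have [l0 [b0 [[H0 h0 em0] c0]]] := Sm0.
set c := coef l0 n0 in c0 em0.
have cr : c%:~R != 0 :> R by rewrite intr_eq0.
(* Solves the condition for [l0] by dividing by the integer [c]; this is where divisibility of the
   circle enters. *)
pose r := x n0 + (b0 - pairing l0 x) / c%:~R.
pose x' n := if n == n0 then r else x n.
have e0 : pairing l0 x' = b0.
  rewrite pairing_upd -/c -mulrzr /r addrAC subrr add0r divfK //; ring.
exists x'; split; last first.
  by move=> n nk; rewrite /x'; case: eqP => // e; rewrite e en0 eqxx in nk.
move=> l b Hl hl; pose q := (coef l n0 %/ c)%Z.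
have H1 := Hsub q Hl H0.
have s1 n : coef (lsub l q l0) n != 0 -> (pickle n < k.+1)%N.
  rewrite coef_lsub => h; have [e|e] := eqVneq (coef l n) 0; last exact: hl.
  by apply: h0; apply: contra_neq h => ->; rewrite e mulr0 subr0.
have e1 : coef (lsub l q l0) n0 = (coef l n0 %% c)%Z by rewrite coef_lsub.
have z1 : coef (lsub l q l0) n0 = 0.
  apply/eqP/negP => /negP nz.
  have := min0 `|coef (lsub l q l0) n0|%N; rewrite em0 => h.
  have {}h : (`|c| <= `|coef (lsub l q l0) n0|)%N by apply: h; exists (lsub l q l0), (b - b0 *~ q).
  by move: h; rewrite e1; have := ltz_mod (coef l n0) c0; have := modz_ge0 (coef l n0) c0; lia.
have s2 n : coef (lsub l q l0) n != 0 -> (pickle n < k)%N.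
  move=> h; have := s1 n h; rewrite ltnS leq_eqVlt => /orP[/eqP e|//].
  by rewrite (uq n e) z1 eqxx in h.
have := Pk _ _ H1 s2.
have <- : pairing (lsub l q l0) x' = pairing (lsub l q l0) x by rewrite pairing_upd z1 mulr0z addr0.
by rewrite pairing_lsub e0 opprB addrA subrK.
Qed.

(** A consistent prescription on a subgroup extends to a character. Each coordinate is fixed once
    its monomial has been treated, so the successive extensions have a pointwise limit. *)
Lemma torus_extension : exists x, forall l b, H l b -> pairing l x - b \is a Num.int.
Proof.
have /choice [F hF] : forall kx : nat * (Zd -> R), exists x',
    P kx.1 kx.2 -> P kx.1.+1 x' /\ forall n, pickle n != kx.1 -> x' n = kx.2 n.
  move=> [k x]; have [Pk|nP] := pselect (P k x); last by exists x.
  by have [x' hx'] := extension_step Pk; exists x'.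
pose xs := fix xs k : Zd -> R := if k is k'.+1 then F (k', xs k') else (fun=> 0).
have Pxs k : P k (xs k).
  elim: k => [|k IH]; last exact: (hF (k, xs k) IH).1.
  move=> l b Hl hl; have c0 n : coef l n = 0.
    by apply/eqP/negP => /negP /hl; rewrite ltn0.
  by rewrite pairing0 // sub0r rpredN (Hcons Hl).
pose x n := xs (pickle n).+1 n.
have xsE k n : (pickle n < k)%N -> xs k n = x n.
  elim: k => // k IH; rewrite ltnS leq_eqVlt => /orP[/eqP e|h]; first by rewrite /x e.
  by rewrite -IH //; apply: (hF (k, xs k) (Pxs k)).2; rewrite /= ltn_eqF.
exists x => l b Hl; pose k := (\max_(kc <- l) (pickle kc.1).+1)%N.
have hk kc : kc \in l -> (pickle kc.1 < k)%N.
  by move=> i; rewrite /k (leq_bigmax_seq (F := fun kc : Zd * int => (pickle kc.1).+1)).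
have -> : pairing l x = pairing l (xs k).
  by rewrite !pairingE !big_seq; apply: eq_bigr => kc /hk i; rewrite xsE.
apply: Pxs => // n cn; have : n \in map fst l by apply: contraR cn => /coef_notin ->.
by case/mapP => kc /hk i ->.
Qed.

End Extension.

End TorusExtension.

(** * Division with remainder by the Laplacian polynomial *)

Section Division.
Variables (d : nat) (i0 : 'I_d).
Local Notation Zd := (Zd d).
Local Notation evec := (@evec d).
Local Notation lpoly := (lpoly d).
Implicit Types (l p q r : lpoly) (n : Zd).

(** As a polynomial in the variable [i0], [fpoly d] has leading and trailing coefficient -1, so a
    remainder of degrees 0 and 1 in that variable can be reached from both sides. *)
Definition divisible p := exists q r, (forall n, coef p n = coef (lmul (fpoly d) q ++ r) n) /\
  (forall kc, kc \in r -> kc.1 i0 = 0 \/ kc.1 i0 = 1).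

Lemma div_ext p p' : coef p =1 coef p' -> divisible p -> divisible p'.
Proof. by move=> e [q [r [h1 h2]]]; exists q, r; split=> // n; rewrite -e. Qed.

Lemma div_lsub p p' c : divisible p -> divisible p' -> divisible (lsub p c p').
Proof.
move=> [q [r [h1 h2]]] [q' [r' [h1' h2']]]; exists (lsub q c q'), (lsub r c r'); split.
  move=> n; have ecat q0 r0 : coef (lmul (fpoly d) q0 ++ r0) n = act (fpoly d) (coef q0) n + coef r0 n.
    by rewrite coef_cat coef_lmul.
  rewrite coef_lsub h1 h1' !ecat coef_lsub.
  have -> : act (fpoly d) (coef (lsub q c q')) n =
      act (fpoly d) (fun k => coef q k - c * coef q' k) n.
    by apply: eq_act => k; rewrite coef_lsub.
  by rewrite actB actMl; ring.
by move=> kc; rewrite mem_cat => /orP[/h2 //|/mapP[kc' /h2' i ->]].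
Qed.

Lemma div_nil : divisible [::].
Proof.
exists [::], [::]; split=> // n; rewrite coef_cat coef_lmul act_fpoly !coef_nil addr0 /lap !coef_nil.
by rewrite mul0rn sub0r big1 ?oppr0 // => j _; rewrite !coef_nil addr0.
Qed.

Lemma div_sum (I : Type) (s : seq I) (F : I -> lpoly) : (forall i, divisible (F i)) ->
  divisible (flatten [seq F i | i <- s]).
Proof.
move=> h; elim: s => [|i s IH] /=; first exact: div_nil.
have := div_lsub (-1) (h i) IH; apply: div_ext => n.
by rewrite coef_lsub coef_cat mulN1r opprK.
Qed.

Definition mono n : lpoly := [:: (n, 1)].

Lemma coef_mono n k : coef (mono n) k = (k == n)%:Z.
Proof. by rewrite /coef /mono big_cons big_nil /= [n == k]eq_sym; case: eqP. Qed.

(* [u^n = - f u^m + 2d u^m - (the other neighbours of m)] when [n] is a neighbour of [m]. *)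
Lemma div_mono_step n m : divisible (mono m) ->
  (forall j, m + evec j != n -> divisible (mono (m + evec j))) ->
  (forall j, m - evec j != n -> divisible (mono (m - evec j))) ->
  (n = m + evec i0 \/ n = m - evec i0) -> divisible (mono n).
Proof.
move=> hm hp hq hn.
pose F j := (if m + evec j == n then [::] else mono (m + evec j)) ++
            (if m - evec j == n then [::] else mono (m - evec j)).
have hF j : divisible (F j).
  have a : divisible (if m + evec j == n then [::] else mono (m + evec j)).
    by case: ifPn => [_|/hp //]; exact: div_nil.
  have b : divisible (if m - evec j == n then [::] else mono (m - evec j)).
    by case: ifPn => [_|/hq //]; exact: div_nil.
  have := div_lsub (-1) a b; apply: div_ext => k.
  by rewrite coef_lsub coef_cat mulN1r opprK.
have hf : divisible (lmul (fpoly d) (mono m)).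
  by exists (mono m), [::]; split=> // k; rewrite cats0.
have h := div_lsub 1 (div_lsub 1 (div_lsub (- (2 * d)%:Z) div_nil hm) (div_sum (enum 'I_d) hF)) hf.
apply: div_ext h => k; rewrite !coef_lsub coef_lmul act_fpoly !mul1r !mulNr opprK.
rewrite coef_nil.
have cF : coef (flatten [seq F i | i <- enum 'I_d]) k =
    \sum_(j < d) ((coef (mono m) (k - evec j) + coef (mono m) (k + evec j)) -
       (m + evec j == n)%:Z * coef (mono n) k - (m - evec j == n)%:Z * coef (mono n) k).
  rewrite /coef big_flatten big_map big_enum /=; apply: eq_bigr => j _.
  rewrite -/(coef (F j) k) -/(coef (mono m) _) -/(coef (mono n) _) coef_cat !coef_mono.
  have e1 : (k - evec j == m) = (k == m + evec j) by rewrite subr_eq.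
  have e2 : (k + evec j == m) = (k == m - evec j) by rewrite -[k == m - _]subr_eq opprK.
  rewrite -/(coef (mono m) _) coef_mono e1 e2 {e1 e2}.
  case: ifPn => [/eqP e1|e1]; case: ifPn => [/eqP e2|e2]; rewrite ?coef_mono ?e1 ?e2.
  1-4: rewrite ?mul1r ?mul0r ?subr0 ?coef_nil.
  1-4: by move: (k == n) (k == m - evec j) (k == m + evec j) => [] [] [].
rewrite cF /lap sumrB sumrB -!mulr_suml.
have s1 : \sum_(j < d) (m + evec j == n)%:Z + \sum_(j < d) (m - evec j == n)%:Z = 1.
  have evj j j' : evec j = evec j' -> j = j'.
    by move/ffunP/(_ j); rewrite !ffunE eqxx; case: eqP.
  have evN j j' : evec j <> - evec j'.
    by move/ffunP/(_ j); rewrite !ffunE eqxx; case: eqP.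
  case: hn => ->.
    rewrite (bigD1 i0) //= eqxx big1 ?addr0; last first.
      move=> j jn; rewrite (inj_eq (addrI m)); case: eqP => // /evj e; by rewrite e eqxx in jn.
    rewrite big1 ?addr0 // => j _; rewrite (inj_eq (addrI m)); case: eqP => // e.
    by have := @evN i0 j; rewrite e.
  rewrite big1 ?add0r => [|j _]; last first.
    rewrite (inj_eq (addrI m)); case: eqP => // e; by have := @evN j i0; rewrite e.
  rewrite (bigD1 i0) //= eqxx big1 ?addr0 // => j jn.
  rewrite (inj_eq (addrI m)) (inj_eq oppr_inj); case: eqP => // /evj e; by rewrite e eqxx in jn.
have -> : \sum_(j < d) (coef (mono m) (k - evec j) + coef (mono m) (k + evec j)) =
    \sum_(j < d) (coef (mono m) (k + evec j) + coef (mono m) (k - evec j)).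
  by apply: eq_bigr => j _; rewrite addrC.
rewrite -[coef (mono m) k *+ _]mulr_natl natz.
move: (\sum_(j < d) (m + evec j == n)%:Z) (\sum_(j < d) (m - evec j == n)%:Z) s1 => A B s1.
have -> : A = 1 - B by rewrite -s1 addrK.
by ring.
Qed.

Lemma div_mono n : divisible (mono n).
Proof.
(* The slab grows by one on both sides. A monomial on a new face is reached through its neighbour
   one step inside, whose other neighbours all lie in the old slab. *)
have main (k : nat) : forall n, - k%:Z <= n i0 <= k%:Z + 1 -> divisible (mono n).
  elim: k => [|k IH] {}n hn.
    exists [::], (mono n); split=> [l|kc].
      rewrite coef_cat coef_lmul act_fpoly /lap !coef_nil mul0rn sub0r big1 ?oppr0 ?add0r //.
      by move=> j _; rewrite !coef_nil addr0.
    by rewrite inE => /eqP -> /=; lia.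
  have [h|h] := boolP (- k%:Z <= n i0 <= k%:Z + 1); first exact: IH.
  have [e|e] : n i0 = k%:Z + 2 \/ n i0 = - k%:Z - 1 by lia.
    apply: (@div_mono_step n (n - evec i0)); last by left; rewrite subrK.
    - by apply: IH; rewrite subevecE eqxx; lia.
    - move=> j nj; apply: IH; rewrite addevecE subevecE eqxx; case: eqP => [ej|_]; last by lia.
      by rewrite -ej subrK eqxx in nj.
    - by move=> j nj; apply: IH; rewrite !subevecE eqxx; case: eqP => _; lia.
  apply: (@div_mono_step n (n + evec i0)); last by right; rewrite addrK.
  - by apply: IH; rewrite addevecE eqxx; lia.
  - by move=> j nj; apply: IH; rewrite !addevecE eqxx; case: eqP => _; lia.
  - move=> j nj; apply: IH; rewrite subevecE addevecE eqxx; case: eqP => [ej|_]; last by lia.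
    by rewrite -ej addrK eqxx in nj.
by apply: (main `|n i0|%N); lia.
Qed.

Lemma div_all p : divisible p.
Proof.
elim: p => [|[k c] p IH]; first exact: div_nil.
have := div_lsub (- c) IH (div_mono k); apply: div_ext => n.
rewrite coef_lsub coef_mono mulNr opprK addrC [RHS]/coef big_cons /= -/(coef p n) [n == k]eq_sym.
by case: eqP => _; rewrite ?mulr1 // mulr0 add0r.
Qed.

End Division.

(** * Primality of the Laplacian polynomial *)

Section Primality.
Variables (R : realType) (d : nat) (i0 i1 : 'I_d).
Hypothesis i01 : i1 != i0.
Local Notation Zd := (Zd d).
Local Notation evec := (@evec d).
Local Notation lpoly := (lpoly d).
Implicit Types (l p q r : lpoly) (n : Zd).
Local Notation C := (complex R).

Section Evaluation.
Variables (zeta : C) (z : R) (B : nat).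
Hypotheses (zeta0 : zeta != 0) (z0 : z != 0).

Definition kap (n : Zd) : int := \sum_(j < d | j != i0) (B ^ j)%:Z * n j.

Lemma kapD n m : kap (n + m) = kap n + kap m.
Proof. by rewrite /kap -big_split; apply: eq_bigr => j _; rewrite ffunE mulrDr. Qed.

Lemma kapN n : kap (- n) = - kap n.
Proof. by rewrite /kap -sumrN; apply: eq_bigr => j _; rewrite ffunE mulrN. Qed.

(* With [zeta + zeta^-1 = 2d - trace], the character [chi] kills [fpoly d]; it separates the monomials
   of a bounded remainder because [kap] is a Kronecker substitution and [zeta] is not real. *)
Definition chi (n : Zd) : C := zeta ^ (- n i0) * (z%:C)%C ^ (- kap n).

Lemma zC0 : (z%:C)%C != 0 :> C.
Proof. by rewrite fmorph_eq0. Qed.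

Lemma chiD n m : chi (n + m) = chi n * chi m.
Proof.
by rewrite /chi ffunE kapD !opprD !expfzDr ?zC0 // mulrACA.
Qed.

Lemma chi0 : chi 0 = 1.
Proof. by rewrite /chi /kap ffunE oppr0 expr0z big1 ?oppr0 ?expr0z ?mulr1 // => j _; rewrite ffunE mulr0. Qed.

Definition ev p : C := act p chi 0.

Lemma act_chi p n : act p chi n = ev p * chi n.
Proof.
rewrite /ev /act mulr_suml; apply: eq_bigr => kc _.
by rewrite sub0r addrC chiD mulrzAl.
Qed.

Lemma ev_lmul p q : ev (lmul p q) = ev p * ev q.
Proof.
rewrite /ev act_lmul; under eq_act => n do rewrite act_chi.
by rewrite actMl mulrC.
Qed.

Lemma ev_coef p q : coef p =1 coef q -> ev p = ev q.
Proof. by move=> e; exact: eq_coef_act. Qed.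

Lemma ev_cat p q : ev (p ++ q) = ev p + ev q.
Proof. exact: act_cat. Qed.

Definition trace : R := \sum_(j < d | j != i0) (z ^+ (B ^ j) + z ^- (B ^ j)).

Lemma ev_fpoly : ev (fpoly d) = (2 * d)%:R - (zeta + zeta^-1) - (trace%:C)%C.
Proof.
rewrite /ev act_fpoly /lap chi0 -[1 *+ _]/((2 * d)%:R) -addrA -opprD; congr (_ - _).
rewrite (bigD1 i0) //=; congr (_ + _).
  rewrite !add0r /chi.
  have k0 : kap (evec i0) = 0.
    by rewrite /kap big1 // => j ji; rewrite ffunE (negbTE ji) mulr0.
  by rewrite kapN k0 !oppr0 expr0z !mulr1 !ffunE eqxx opprK expr1z addrC exprN1.
rewrite /trace raddf_sum; apply: eq_bigr => j ji.
have kj : kap (evec j) = (B ^ j)%:Z.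
  rewrite /kap (bigD1 j) //= ffunE eqxx mulr1 big1 ?addr0 // => k /andP[_ kj].
  by rewrite ffunE (negbTE kj) mulr0.
have ej : evec j i0 = 0 by rewrite ffunE eq_sym (negbTE ji).
have eN : (- evec j) i0 = 0 by rewrite ffunE ej oppr0.
have c1 : chi (evec j) = ((z ^- (B ^ j))%:C)%C.
  by rewrite /chi ej kj oppr0 expr0z mul1r -exprnN -rmorphXn -fmorphV.
have c2 : chi (- evec j) = ((z ^+ (B ^ j))%:C)%C.
  by rewrite /chi eN kapN kj oppr0 expr0z mul1r opprK -exprnP rmorphXn.
by rewrite !add0r c1 c2 addrC -raddfD.
Qed.

End Evaluation.

Section Specialization.
Variables (N B : nat) (r : lpoly).
Hypothesis rk : forall kc, kc \in r -> kc.1 i0 = 0 \/ kc.1 i0 = 1.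
Hypothesis rN : forall kc, kc \in r -> inbox N kc.1.
Hypothesis NB : (N.*2 < B)%N.

(** Reduction modulo B forces the lowest digit, smaller than B in absolute value, to vanish; then
    divide by B. *)
Lemma radix_inj (k : nat) (a : nat -> int) : (forall j, (`|a j| < B)%N) ->
  \sum_(j < k) (B ^ j)%:Z * a j = 0 -> forall j, (j < k)%N -> a j = 0.
Proof.
elim: k a => // k IH a ha; rewrite big_ord_recl expn0 mul1r => e.
have e1 : \sum_(i < k) (B ^ lift ord0 i)%:Z * a (lift ord0 i) =
    B%:Z * \sum_(i < k) (B ^ i)%:Z * a i.+1.
  by rewrite mulr_sumr; apply: eq_bigr => j _; rewrite mulrA -PoszM -expnS.
have a0 : a 0%N = 0.
  have : (B%:Z %| a 0%N)%Z.
    have -> : a 0%N = - (\sum_(i < k) (B ^ i)%:Z * a i.+1) * B%:Z.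
      by apply/eqP; rewrite -subr_eq0 mulNr opprK mulrC -e1 e.
    exact: dvdz_mull.
  by rewrite dvdzE /=; have := ha 0%N; case: (`|a 0%N|%N) (absz_eq0 (a 0%N)) => [/esym/eqP //|m _ h /dvdn_leq]; lia.
move=> [//|j] jk; apply: (IH (fun j => a j.+1)) => //.
have : B%:Z * (\sum_(i < k) (B ^ i)%:Z * a i.+1) = 0 by rewrite -e1 -[LHS]add0r -{1}a0 e.
by move/eqP; rewrite mulf_eq0 => /orP[|/eqP //]; lia.
Qed.

Lemma kap_inj (n m : Zd) : inbox N n -> inbox N m -> n i0 = m i0 -> kap B n = kap B m -> n = m.
Proof.
move=> /inboxP hn /inboxP hm e ek; apply/ffunP => i.
pose a (j : nat) : int := if insub j is Some j' then n j' - m j' else 0.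
have aE (j : 'I_d) : a j = n j - m j by rewrite /a valK.
have : a i = 0.
  apply: (@radix_inj d) => // [j|].
    rewrite /a; case: insubP => [j' _ _|_]; last by lia.
    by have := hn j'; have := hm j'; lia.
  rewrite (bigD1 i0) //= aE e subrr mulr0 add0r.
  move/eqP: ek; rewrite -subr_eq0 /kap -sumrB => /eqP ek; rewrite -[RHS]ek.
  by apply: eq_bigr => j _; rewrite aE mulrBr.
by rewrite aE => /eqP; rewrite subr_eq0 => /eqP.
Qed.

Definition part (e : int) (z : R) : R := \sum_(kc <- r | kc.1 i0 == e) kc.2%:~R * z ^ kap B kc.1.

Lemma abszM_add (M : nat) (k : int) : (`|k| <= M)%N -> Posz (absz (M%:Z + k)) = M%:Z + k.
Proof. by lia. Qed.

(** Multiplied by z^M to clear negative exponents, [part e] becomes a polynomial with infinitely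
    many roots. As [kap] separates the exponents of [r] with given [i0] coordinate, each coefficient
    of [r] there is a coefficient of this polynomial. *)
Lemma part_zero (e : int) (zs : nat -> R) : injective zs -> (forall k, zs k != 0) ->
  (forall k, part e (zs k) = 0) -> forall n, n i0 = e -> coef r n = 0.
Proof.
move=> zi z0 hz n ne.
have [nr|nr] := boolP (n \in map fst r); last exact: coef_notin.
pose M := (\max_(kc <- r) `|kap B kc.1|)%N.
have hM kc : kc \in r -> (`|kap B kc.1| <= M)%N.
  by move=> i; rewrite /M (leq_bigmax_seq (F := fun kc : Zd * int => `|kap B kc.1|%N)).
pose P : {poly R} := \sum_(kc <- r | kc.1 i0 == e) kc.2%:~R *: 'X^(absz (M%:Z + kap B kc.1)).
have hP z : z != 0 -> P.[z] = z ^+ M * part e z.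
  move=> zn; rewrite horner_sum mulr_sumr big_seq_cond [RHS]big_seq_cond; apply: eq_bigr => kc /andP[i _].
  rewrite hornerZ hornerXn mulrCA; congr (_ * _).
  by rewrite exprnP abszM_add ?hM // expfzDr // -exprnP.
have P0 : P = 0.
  apply: (@roots_geq_poly_eq0 _ _ [seq zs k | k <- iota 0 (size P)]).
  - by apply/allP => _ /mapP[k _ ->]; rewrite rootE hP // hz mulr0.
  - by rewrite map_inj_uniq // iota_uniq.
  - by rewrite size_map size_iota.
have : P`_(absz (M%:Z + kap B n)) = 0 by rewrite P0 coef0.
case/mapP: nr => kc0 i0r en; have nN : inbox N n by rewrite en; exact: rN.
have nM : (`|kap B n| <= M)%N by rewrite en; exact: hM.
rewrite coef_sum => e0; apply/eqP; rewrite -(@intr_eq0 R); apply/eqP; rewrite -[RHS]e0.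
rewrite /coef rmorph_sum /= big_seq_cond [RHS]big_seq_cond big_mkcond [RHS]big_mkcond /=.
apply: eq_bigr => kc _; have [i|//] := boolP (kc \in r); rewrite /=.
rewrite coefZ coefXn; have [e1|e1] := eqVneq kc.1 n; first by rewrite e1 ne !eqxx mulr1.
case: eqP => // e2; case: eqP => [e3|]; last by rewrite mulr0.
case/eqP: e1; apply: kap_inj => //; [exact: rN|by rewrite e2|].
move/(congr1 Posz): e3; rewrite !abszM_add ?hM // => /addrI //.
Qed.

Lemma ev_part (zeta : C) (z : R) : ev zeta z B r = (part 0 z)%:C%C + zeta * (part 1 z)%:C%C.
Proof.
have pE e : (part e z)%:C%C = \sum_(kc <- r) (if kc.1 i0 == e then kc.2%:~R * z ^ kap B kc.1 else 0)%:C%C :> C.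
  by rewrite /part big_mkcond raddf_sum.
rewrite !pE mulr_sumr -big_split /ev /act big_seq [RHS]big_seq.
apply: eq_bigr => kc /rk i; rewrite sub0r /chi kapN !ffunE !opprK /=.
have e1 : ((z%:C)%C ^ kap B kc.1) = ((z ^ kap B kc.1)%:C)%C.
  by case: (kap B kc.1) => m; rewrite ?NegzE -?exprnP ?exprnN ?fmorphV rmorphXn.
have e2 : ((kc.2%:~R * z ^ kap B kc.1)%:C)%C = kc.2%:~R * ((z ^ kap B kc.1)%:C)%C :> C.
  by rewrite rmorphM rmorph_int.
by case: i => ->; rewrite ?eqxx /= ?addr0 ?add0r e1 e2 -mulrzr ?expr0z ?expr1z ?mul1r; ring.
Qed.

End Specialization.

(** The upper bound is the chord of a convex function of t between t = 0 and t = 1. *)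
Lemma near1_pow (n : nat) (t : R) : 0 <= t <= 1 -> 1 <= (1 + t) ^+ n <= 1 + (2 ^+ n - 1) * t.
Proof.
move=> /andP[t0 t1]; elim: n => [|n /andP[IH1 IH2]]; first by rewrite expr0 subrr mul0r addr0 lexx.
have e0 : 1 <= 1 + t by rewrite lerDl.
rewrite exprS; apply/andP; split; first by rewrite mulr_ege1.
have p1 : 1 <= 2 ^+ n :> R by apply: exprn_ege1; lra.
have := ler_wpM2l (le_trans ler01 e0) IH2; rewrite exprS.
move: (2 ^+ n) ((1 + t) ^+ n) p1 IH1 => P y p1 y1 h; apply: le_trans h _.
have : 0 <= (P - 1) * t * (1 - t) by apply: mulr_ge0; [apply: mulr_ge0|]; lra.
by lra.
Qed.

(** Infinitely many points so close to 1 that even the exponents B^j leave each z^(B^j) + z^(-B^j)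
    just above 2. Then 2d - [trace] lies strictly between -2 and 2, and [zet] is nonreal of modulus
    1. *)
Definition zpt (B k : nat) : R := 1 + ((2 ^+ (B ^ d) * d.+1%:R * k.+1%:R)^-1).

Lemma zpt_inj B : injective (zpt B).
Proof.
move=> k k' /addrI /invr_inj /mulfI h; apply/eqP; rewrite -eqSS -(@eqr_nat R); apply/eqP; apply: h.
by rewrite mulf_neq0 ?pnatr_eq0 // expf_neq0 // pnatr_eq0.
Qed.

Lemma trace_zpt B k : (1 < B)%N -> 2 * d%:R - 2 < trace (zpt B k) B < 2 * d%:R + 2.
Proof.
move=> B1; set t : R := (2 ^+ (B ^ d) * d.+1%:R * k.+1%:R)^-1.
have P1 : 1 <= 2 ^+ (B ^ d) :> R by apply: exprn_ege1; lra.
have d1 : 1 <= d.+1%:R :> R by rewrite ler1n.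
have k1 : 1 <= k.+1%:R :> R by rewrite ler1n.
have t0 : 0 < t by rewrite invr_gt0 !mulr_gt0 ?ltr0n // exprn_gt0 // ltr0n.
have Pt : 2 ^+ (B ^ d) * t <= d.+1%:R^-1.
  rewrite /t !invfM mulrA mulrA divff ?mul1r ?gt_eqF ?exprn_gt0 ?ltr0n //.
  by rewrite ler_piMr ?invr_ge0 ?ler0n // invf_le1 ?ltr0n.
have di : d.+1%:R^-1 <= 1 :> R by rewrite invf_le1 ?ltr0n.
have t1 : t <= 1.
  apply: le_trans (le_trans Pt di); rewrite ler_peMl // ltW //.
have h (j : 'I_d) : 2 < (1 + t) ^+ (B ^ j) + (1 + t) ^- (B ^ j) <= 2 + d.+1%:R^-1.
  have /andP[y1 y2] := @near1_pow (B ^ j) t (introT andP (conj (ltW t0) t1)).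
  have {}y1 : 1 < (1 + t) ^+ (B ^ j) by rewrite exprn_egt1 // ?ltrDl // -lt0n expn_gt0 (ltnW B1).
  have {}y2 : (1 + t) ^+ (B ^ j) - 1 <= d.+1%:R^-1.
    apply: le_trans Pt; rewrite lerBlDl; apply: le_trans y2 _; rewrite lerD2l ler_pM2r //.
    apply: (@le_trans _ _ (2 ^+ (B ^ j))); first by rewrite gerBl.
    by rewrite ler_eXn2l ?ltr1n // leq_exp2l // ltnW.
  move: ((1 + t) ^+ (B ^ j)) y1 y2 => y y1 y2.
  have yi : y * y^-1 = 1 by rewrite divff // gt_eqF //; lra.
  have yi0 : 0 < y^-1 by rewrite invr_gt0; lra.
  have e : y + y^-1 - 2 = (y - 1) * (y - 1) * y^-1.
    by rewrite -{1}[y]mulr1; move: yi; move: (y^-1) => z yi; nra.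
  have p : 0 < (y - 1) * (y - 1) * y^-1 by rewrite !mulr_gt0 // subr_gt0.
  have yi1 : y^-1 < 1 by rewrite invf_lt1; lra.
  move: (d.+1%:R^-1) di y2 e p yi1 yi0 => D di y2 e p yi1 yi0.
  have : (y - 1) * (y - 1) * y^-1 <= (y - 1) * 1 * 1.
    by apply: ler_pM; try lra; [apply: mulr_ge0; lra|apply: ler_pM; lra].
  lra.
rewrite /trace -/(zpt B k).
have c1 : \sum_(j < d | j != i0) (2 : R) = 2 * d%:R - 2.
  have : \sum_(j < d) (2 : R) = 2 * d%:R by rewrite sumr_const card_ord -[LHS]mulr_natr.
  by rewrite (bigD1 i0) //= => <-; rewrite addrAC subrr add0r.
have c2 : \sum_(j < d | j != i0) (2 + d.+1%:R^-1 : R) <= 2 * d%:R - 2 + 1.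
  rewrite big_split /= c1 lerD2l.
  have : \sum_(j < d) (d.+1%:R^-1 : R) <= 1.
    rewrite sumr_const card_ord -[leLHS]mulr_natr mulrC ler_pdivrMr ?ltr0n // mul1r ler_nat; exact: leqnSn.
  rewrite (bigD1 i0) //=; apply: le_trans; rewrite lerDr invr_ge0 ler0n //.
apply/andP; split.
  (* The second variable [i1] contributes strictly more than 2, which keeps [zet] off the real
     axis. *)
  rewrite -c1 (bigD1 i1) //= [ltRHS](bigD1 i1) //=; apply: ltr_leD.
    by have /andP[] := h i1.
  by apply: ler_sum => j _; have /andP[/ltW] := h j.
apply: (@le_lt_trans _ _ (2 * d%:R - 2 + 1)); last by lra.
by apply: le_trans c2; apply: ler_sum => j _; have /andP[] := h j.
Qed.

Definition zet (B k : nat) : C :=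
  let c := 2 * d%:R - trace (zpt B k) B in Complex (c / 2) (Num.sqrt (1 - (c / 2) ^+ 2)).

Lemma zetP B k : (1 < B)%N -> [/\ zet B k != 0, ev (zet B k) (zpt B k) B (fpoly d) = 0 & complex.Im (zet B k) != 0].
Proof.
move=> B1; have /andP[h1 h2] := trace_zpt k B1.
set c := 2 * d%:R - trace (zpt B k) B; have hc : -2 < c < 2 by rewrite /c; lra.
have s0 : 0 < 1 - (c / 2) ^+ 2.
  have -> : 1 - (c / 2) ^+ 2 = (1 - c / 2) * (1 + c / 2) by ring.
  by apply: mulr_gt0; lra.
have sq : Num.sqrt (1 - (c / 2) ^+ 2) ^+ 2 = 1 - (c / 2) ^+ 2 by rewrite sqr_sqrtr // ltW.
have sp : 0 < Num.sqrt (1 - (c / 2) ^+ 2) by rewrite sqrtr_gt0.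
have zE : zet B k = Complex (c / 2) (Num.sqrt (1 - (c / 2) ^+ 2)) by [].
move: (Num.sqrt _) sq sp zE => s sq sp zE.
have z1 : zet B k * Complex (c / 2) (- s) = 1.
  by rewrite zE; apply/eqP; rewrite eq_complex /=; apply/andP; split; apply/eqP; [move: sq; rewrite !expr2; lra|ring].
have zn0 : zet B k != 0 by apply: contra_eq_neq z1 => ->; rewrite mul0r eq_sym oner_neq0.
have zi : (zet B k)^-1 = Complex (c / 2) (- s).
  by rewrite -[RHS]mul1r -(mulVf zn0) -mulrA z1 mulr1.
split=> //; last by rewrite zE /= gt_eqF.
have zp0 : zpt B k != 0.
  by rewrite /zpt gt_eqF // ltr_wpDr // ?invr_ge0 ?mulr_ge0 ?exprn_ge0 ?ler0n.
rewrite ev_fpoly // zi zE.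
have -> : Complex (c / 2) s + Complex (c / 2) (- s) = (c%:C)%C.
  by apply/eqP; rewrite eq_complex /=; apply/andP; split; apply/eqP; [lra|rewrite subrr].
rewrite -[(2 * d)%:R](rmorph_nat (real_complex R)) -!rmorphB /c natrM.
by have -> : 2 * d%:R - (2 * d%:R - trace (zpt B k) B) - trace (zpt B k) B = 0 by ring.
Qed.

(** Divide p by f. At the chosen zeros of f the remainder takes the value part 0 + zeta part 1 with
    real parts and nonreal zeta, so both parts vanish at infinitely many points and the remainder is
    0. [B0] is taken large enough for base B to separate the exponents of the remainder. *)
Lemma ev_ideal (p : lpoly) : exists B0 : nat, forall B, (B0 <= B)%N -> forall ks : nat -> nat, injective ks ->
  (forall k, ev (zet B (ks k)) (zpt B (ks k)) B p = 0) -> in_ideal_f p.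
Proof.
have [q [r [hp hr]]] := div_all i0 p.
pose N := (\max_(kc <- r) supnorm kc.1)%N.
have rN kc : kc \in r -> inbox N kc.1.
  by move=> i; rewrite /inbox /N (leq_bigmax_seq (F := fun kc : Zd * int => supnorm kc.1)).
exists (N.*2.+2) => B hB ks ki h0; have B1 : (1 < B)%N by lia.
have NB : (N.*2 < B)%N by lia.
have zp0 k : zpt B k != 0.
  by rewrite /zpt gt_eqF // ltr_wpDr // ?invr_ge0 ?mulr_ge0 ?exprn_ge0 ?ler0n.
have hpart k : part B r 0 (zpt B (ks k)) = 0 /\ part B r 1 (zpt B (ks k)) = 0.
  have [z0 zf zI] := zetP (ks k) B1; have := h0 k.
  rewrite (ev_coef _ _ _ hp) ev_cat ev_lmul // zf mul0r add0r ev_part //.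
  case: (zet B (ks k)) zI => a b /= b0; move/eqP; rewrite eq_complex /= => /andP[/eqP e1 /eqP e2].
  have p1 : part B r 1 (zpt B (ks k)) = 0.
    move: e2; rewrite mulr0 !add0r => /eqP; rewrite mulf_eq0 (negbTE b0) => /eqP //.
  by split=> //; move: e1; rewrite p1 !mulr0 subr0 addr0.
have r0 n : coef r n = 0.
  have [nr|] := boolP (n \in map fst r); last exact: coef_notin.
  have zi : injective (fun k => zpt B (ks k)) by move=> k k' /zpt_inj /ki.
  case/mapP: (nr) => kc /hr i en.
  have [e|e] : n i0 = 0 \/ n i0 = 1 by rewrite en.
    by apply: (part_zero rN NB zi (e := 0) _ _ e) => // k; case: (hpart k).
  by apply: (part_zero rN NB zi (e := 1) _ _ e) => // k; case: (hpart k).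
by exists q => n; rewrite hp coef_cat r0 addr0.
Qed.

(** At every chosen zero of f, c or g vanishes. If g vanished at infinitely many of them it would
    lie in the ideal; so c vanishes at all but finitely many. *)
Lemma fpoly_prime (a c g : lpoly) : ~ in_ideal_f g ->
  (forall n, coef (lmul a (fpoly d)) n + coef (lmul c g) n = 0) -> in_ideal_f c.
Proof.
move=> hg hac; have [B1 hB1] := ev_ideal g; have [B2 hB2] := ev_ideal c.
pose B := maxn 2 (maxn B1 B2); have B_gt1 : (1 < B)%N by rewrite leq_max.
have e k : ev (zet B k) (zpt B k) B c = 0 \/ ev (zet B k) (zpt B k) B g = 0.
  have [z0 zf _] := zetP k B_gt1.
  have zp0 : zpt B k != 0.
    by rewrite /zpt gt_eqF // ltr_wpDr // ?invr_ge0 ?mulr_ge0 ?exprn_ge0 ?ler0n.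
  have h n : coef (lmul a (fpoly d) ++ lmul c g) n = coef [::] n by rewrite coef_cat hac coef_nil.
  have := ev_coef (zet B k) (zpt B k) B h; rewrite ev_cat !ev_lmul // zf mulr0 add0r.
  rewrite [RHS]/ev /act big_nil => /eqP; rewrite mulf_eq0 => /orP[] /eqP; by [left|right].
have [[K hK]|no] := pselect (exists K, forall k, (K <= k)%N -> ev (zet B k) (zpt B k) B g != 0).
  apply: (hB2 B _ (fun k => K + k)%N) => [|k k' /addnI //|k]; first by rewrite /B; lia.
  by case: (e (K + k)%N) => // /eqP h; have := hK _ (leq_addr k K); rewrite h.
exfalso; apply: hg.
have inf K : exists2 k, (K <= k)%N & ev (zet B k) (zpt B k) B g = 0.
  apply: contrapT => h; apply: no; exists K => k hk; apply/negP => /eqP e0; apply: h; by exists k.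
have /choice [F hF] K : exists k, (K <= k)%N /\ ev (zet B k) (zpt B k) B g = 0.
  by have [k] := inf K; exists k.
pose ks := fix ks k := if k is k'.+1 then F (ks k').+1 else F 0%N.
have mono : {homo ks : m n / (m < n)%N}.
  by apply: homo_ltn => [? ? ?|k /=]; [exact: ltn_trans|exact: (hF _).1].
apply: (hB1 B _ ks) => [|k k' ekk|k]; first by rewrite /B; lia.
  case: (ltngtP k k') => // /mono; rewrite ekk ltnn //.
by case: k => [|k]; exact: (hF _).2.
Qed.

End Primality.

(** * Surjectivity of g^* on points with integral Laplacian *)

Section DivisibleGroup.
Variables (R : realType) (d : nat) (i0 i1 : 'I_d).
Hypothesis i01 : i1 != i0.
Local Notation Zd := (Zd d).

Lemma lap_opp (V : zmodType) (y : Zd -> V) n : lap (fun k => y (- k)) n = lap y (- n).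
Proof.
rewrite /lap; congr (_ - _); apply: eq_bigr => j _; rewrite addrC.
by rewrite !opprD opprK.
Qed.

Lemma act_mono (V : zmodType) (y : Zd -> V) n k : act (mono n) y k = y (k - n).
Proof. by rewrite /act /mono big_cons big_nil addr0 mulr1z. Qed.

(* Multiplication by [lstar g] is onto on the characters killed by [fpoly d]: on the subgroup
   generated by [fpoly d] and [g] the prescription is consistent because [fpoly d] is prime. *)
Lemma lstar_surj (g : lpoly d) (x : Zd -> R) : ~ in_ideal_f g -> (forall n, lap x n \is a Num.int) ->
  exists y : Zd -> R, (forall n, lap y n \is a Num.int) /\
    (forall n, act (lstar g) y n - x n \is a Num.int).
Proof.
move=> hg hx.
pose H (l : lpoly d) (b : R) := exists a c : lpoly d,
  (forall n, coef l n = coef (lmul a (fpoly d)) n + coef (lmul c g) n) /\ b = pairing c x.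
have [|l b [a [c [e1 ->]]] e0|y hy] := @torus_extension R d H.
- move=> l b l' b' q [a [c [e1 e2]]] [a' [c' [e1' e2']]]; exists (lsub a q a'), (lsub c q c').
  split; last by rewrite pairing_lsub e2 e2'.
  move=> n; rewrite coef_lsub e1 e1' !coef_lmul !act_lsub !mulrzz; ring.
- have [h hh] : in_ideal_f c by apply: (fpoly_prime R i01 hg (a := a)) => n; rewrite -e1 e0.
  rewrite (eq_pairing x hh) /pairing act_lmul act_comm; apply: rpred_sum => k _.
  by rewrite act_fpoly lap_opp rpredMz.
exists y; split=> n.
  have /hy : H (lmul (mono n) (fpoly d)) 0.
    exists (mono n), [::]; split=> [k|]; last by rewrite pairingE big_nil.
    by rewrite [coef (lmul [::] _) _]coef_nil addr0.
  by rewrite subr0 /pairing act_lmul act_mono act_fpoly lap_opp sub0r opprK.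
have /hy : H (lmul (mono n) g) (x n).
  exists [::], (mono n); split=> [k|]; first by rewrite [coef (lmul [::] _) _]coef_nil add0r.
  by rewrite pairingE big_cons big_nil addr0.
congr (is_true (_ - _ \in Num.int)).
rewrite act_lstar /pairing act_lmul act_mono.
by apply: eq_bigr => kc _; rewrite sub0r opprB opprK addrC.
Qed.

End DivisibleGroup.

(** * Surjectivity on the abelian sandpile shift *)

Section Layer.
Variables (R : realType) (d : nat).
Local Notation Zd := (Zd d).
Local Notation evec := (@evec d).
Implicit Types (n k : Zd) (N : nat).

(** A box point m reached from outside in direction j has |m_j| >= N. Hence the quadratic bound of
    [box_bound_abs], C ((N+1)^2 - m_j^2), is only linear in N there. *)
Lemma supp_layer N (z : Zd -> R) C : 0 <= C -> supp N z ->
  (forall n, inbox N n -> `|lap z n| <= C * 2) ->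
  forall n j, ~~ inbox N n -> `|z (n + evec j)| <= C * 2 * N.+1%:R /\ `|z (n - evec j)| <= C * 2 * N.+1%:R.
Proof.
move=> C0 sz hl n j nN.
have main (m : Zd) : (forall k : 'I_d, k != j -> m k = n k) -> `|m j - n j| <= 1 -> `|z m| <= C * 2 * N.+1%:R.
  move=> e1 e2; have [mN|mN] := boolP (inbox N m); last first.
    by rewrite sz // normr0 !mulr_ge0.
  have hj : (N <= `|m j|)%N.
    have : `[< exists k : 'I_d, (N < `|n k|)%N >].
      apply/negbNE; apply: contra nN => /asboolPn h; apply/inboxP => k.
      by rewrite leqNgt; apply/negP => lt; apply: h; exists k.
    move=> /asboolP [k hk]; have [ekj|nk] := eqVneq k j; last first.
      by have /inboxP/(_ k) := mN; rewrite e1 // leqNgt hk.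
    by move: hk e2; rewrite ekj; lia.
  have := @box_bound_abs _ _ N z 0 C j C0 hl _ m mN.
  have bd k : ~~ inbox N k -> inbox N.+1 k -> `|z k| <= 0 by move=> /sz ->; rewrite normr0.
  move=> /(_ bd); rewrite add0r -lerBrDr => h; apply: le_trans h _.
  rewrite -mulrBr -mulrA ler_wpM2l //.
  have : N%:R ^+ 2 <= (m j)%:~R ^+ 2 :> R.
    by rewrite -[N%:R]/((N%:Z)%:~R) -!rmorphXn /= ler_int; move: hj; nia.
  by rewrite -natr1; lra.
split; apply: main => [k kj|].
- by rewrite addevecE (negbTE kj) addr0.
- by rewrite addevecE eqxx addrAC subrr.
- by rewrite subevecE (negbTE kj) subr0.
- by rewrite subevecE eqxx addrAC subrr.
Qed.

Lemma lap_layer N (z : Zd -> R) C : 0 <= C -> supp N z ->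
  (forall n, inbox N n -> `|lap z n| <= C * 2) ->
  forall n, ~~ inbox N n -> `|lap z n| <= (4 * d)%:R * C * N.+1%:R.
Proof.
move=> C0 sz hl n nN; rewrite /lap sz // mul0rn sub0r normrN.
apply: le_trans (ler_norm_sum _ _ _) _.
apply: (@le_trans _ _ (\sum_(j < d) (C * 2 * N.+1%:R + C * 2 * N.+1%:R))).
  apply: ler_sum => j _; have [h1 h2] := supp_layer C0 sz hl j nN.
  by apply: le_trans (ler_normD _ _) _; rewrite lerD.
by rewrite sumr_const card_ord -[leLHS]mulr_natl natrM; lra.
Qed.

Lemma lap_out N (V : zmodType) (z : Zd -> V) n : supp N z -> ~~ inbox N.+1 n -> lap z n = 0.
Proof.
move=> sz nN; have o m : inbox 1 m -> z (n + m) = 0.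
  move=> m1; apply: sz; apply: contra nN => h.
  by rewrite -(addrK m n) -addn1 inboxD // inboxN.
rewrite /lap sz ?mul0rn ?sub0r; last by apply: contra nN; exact: inboxS.
by rewrite big1 ?oppr0 // => j _; rewrite !o ?addr0 ?inboxN ?inbox_evec.
Qed.

Lemma sum_subset (T : eqType) (f : T -> R) (s t : seq T) : (forall x, 0 <= f x) -> uniq s -> uniq t ->
  {subset s <= t} -> \sum_(x <- s) f x <= \sum_(x <- t) f x.
Proof.
move=> f0 us ut st; rewrite [leRHS](bigID (mem s)) /= -[X in _ <= X + _]big_filter.
have p : perm_eq [seq x <- t | x \in s] s.
  apply: uniq_perm; rewrite ?filter_uniq // => x; rewrite mem_filter.
  by case: (boolP (x \in s)) => // /st ->.
by rewrite (perm_big _ p) lerDl sumr_ge0.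
Qed.

(* Otherwise [S] would gain at least [e / 2] on every dyadic block from [T] to [2T]. *)
Lemma slow_increment (S : nat -> R) (B e : R) (M : nat) :
  {homo S : a b / (a <= b)%N >-> a <= b} -> (forall N, 0 <= S N <= B) -> 0 < e ->
  exists2 N, (M <= N)%N & N.+1%:R * (S N.+1 - S N) <= e.
Proof.
move=> mono hS e0; apply: contrapT => no.
have inc N : (M <= N)%N -> e < N.+1%:R * (S N.+1 - S N).
  by move=> MN; rewrite ltNge; apply/negP => h; apply: no; exists N.
have dbl T : (0 < T)%N -> (M <= T)%N -> e / 2 <= S (T + T)%N - S T.
  move=> T0 MT.
  have aux j : (j <= T)%N -> j%:R * e <= (T + T)%:R * (S (T + j)%N - S T).
    elim: j => [|j IH] jT; first by rewrite addn0 subrr mul0r mulr0.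
    have /IH {}IH : (j <= T)%N by lia.
    have h := inc (T + j)%N (leq_trans MT (leq_addr _ _)).
    have le1 : (T + j).+1%:R * (S (T + j).+1 - S (T + j)%N) <= (T + T)%:R * (S (T + j).+1 - S (T + j)%N).
      by rewrite ler_wpM2r ?ler_nat ?subr_ge0 ?mono //; lia.
    rewrite -natr1 addnS; move: h le1 IH; move: (_.+1%:R * _) => X.
    move: ((T + T)%:R) (S (T + j).+1) (S (T + j)%N) (S T) => A b c a; lra.
  have := aux T (leqnn T); rewrite natrD; move: (S (T + T)%N - S T) => D h.
  have Tp : 0 < T%:R :> R by rewrite ltr0n.
  rewrite ler_pdivrMr // -(ler_pM2l Tp); lra.
pose T j := (M.+1 * 2 ^ j)%N.
have grow j : j%:R * (e / 2) <= S (T j).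
  elim: j => [|j IH]; first by rewrite mul0r; have /andP[] := hS (T 0%N).
  have e1 : T j.+1 = (T j + T j)%N by rewrite /T expnS; lia.
  have p : (0 < 2 ^ j)%N by rewrite expn_gt0.
  have := dbl (T j) ltac:(rewrite /T; lia) ltac:(rewrite /T; nia).
  rewrite e1 -[j.+1%:R]natr1 mulrDl mul1r; move: IH; move: (S _) (S _) (j%:R * _) => X Y Z; lra.
have e2 : 0 < e / 2 by rewrite divr_gt0.
have := grow (Num.truncn (B / (e / 2))).+1.
have /andP[_ hB] := hS (T (Num.truncn (B / (e / 2))).+1).
have := truncnS_gt (B / (e / 2)); rewrite ltr_pdivrMr //; lra.
Qed.

Lemma zsum_norm_le (a : Zd -> R) (E : R) : asum a ->
  (forall s, uniq s -> \sum_(n <- s) `|a n| <= E) -> `|zsum a| <= 3 * E.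
Proof.
move=> ha hE; have t : tail a 0 E by move=> s us _; exact: hE.
have := zsum_approx ha t (box_uniq d 0) (fun n h => h).
have := le_trans (ler_norm_sum _ _ _) (hE _ (box_uniq d 0)).
rewrite !ler_norml; lra.
Qed.

Lemma int_closed (a : R) : (forall e, 0 < e -> exists2 z, z \is a Num.int & `|a - z| <= e) -> a \is a Num.int.
Proof.
move=> h; have [z1 i1 h1] := h (1 / 4) ltac:(lra).
have -> : a = z1; last by [].
apply/eqP; rewrite -subr_eq0 -normr_le0 leNgt; apply/negP => lt.
have [z2 i2 h2] := h (`|a - z1| / 2) ltac:(lra).
have e : z1 = z2.
  apply/eqP; rewrite -subr_eq0; apply/negPn/negP => nz.
  have := norm_intr_ge1 (rpredB i1 i2) nz; have := ler_distD a z1 z2; rewrite (distrC z1 a).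
  by move: h1 h2; move: `|a - z1| `|a - z2| `|z1 - z2| => x y z; lra.
by move: h2 lt; rewrite -e; lra.
Qed.

End Layer.

(** * Compactness of the recurrent shift *)

Section Limit.
Variable d : nat.
Local Notation Zd := (Zd d).
Implicit Types (n : Zd).

Lemma ultra_bounded_const (U : set_system nat) (f : nat -> nat) B : UltraFilter U ->
  U [set k | (f k <= B)%N] -> exists v, U [set k | f k = v].
Proof.
move=> UU; elim: B => [|B IH] hB.
  by exists 0%N; apply: filterS hB => k /=; rewrite leqn0 => /eqP.
have [h|h] := in_ultra_setVsetC [set k | f k = B.+1] UU; first by exists B.+1.
apply: IH; apply: filterS (filterI hB h) => k [] /=; lia.
Qed.

Lemma ultra_seq (U : set_system nat) (T : eqType) (P : T -> set nat) (s : seq T) : UltraFilter U ->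
  (forall x, x \in s -> U (P x)) -> U [set k | forall x, x \in s -> P x k].
Proof.
move=> UU; elim: s => [|x s IH] h; first by apply: filterS filterT => k _ x.
have h1 := h x (mem_head _ _).
have {}IH := IH (fun y ys => h y (mem_behead (s := x :: s) ys)).
by apply: filterS (filterI h1 IH) => k [a b] y; rewrite inE => /predU1P[->|/b].
Qed.

(* [v] is a pointwise limit of [u] along an ultrafilter. *)
Lemma Rinf_compact (u : nat -> Zd -> nat) : (forall k, Rinf (u k)) ->
  exists2 v, Rinf v & forall (s : seq Zd) K, exists2 k, (K <= k)%N & {in s, u k =1 v}.
Proof.
move=> hu; have [U [UU hU]] := ultraFilterLemma (F := \oo : set_system nat) _.
have /choice [v hv] : forall n, exists v, U [set k | u k n = v].
  move=> n; apply: (@ultra_bounded_const _ _ (2 * d).-1) => //.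
  by apply: filterS filterT => k _; have [h _] := hu k; exact: h.
have agree (s : seq Zd) : U [set k | {in s, u k =1 v}].
  by apply: filterS (ultra_seq (s := s) UU (fun n _ => hv n)) => k h n /h.
exists v; last first.
  move=> s K; have c : U [set k | (K <= k)%N] by apply: hU; exists K.
  by have [k [a b]] := filter_ex (filterI c (agree s)); exists k.
split=> [n|F F0].
  by have [k /= <-] := filter_ex (hv n); have [] := hu k.
have [k hk] := filter_ex (agree F); have [_ /(_ F F0) [n nF le]] := hu k.
by exists n => //; rewrite -hk.
Qed.

End Limit.

(** * Approximate and exact preimages *)

Section Surjectivity.
Variables (R : realType) (m : nat).
Hypothesis m0 : (0 < m)%N.
Local Notation d := m.+1.
Local Notation Zd := (Zd d).
Variable g : lpoly d.
Hypothesis hg : @in_Id R d g.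
Local Notation W := (Wg R g).

Lemma frac_le (c C : R) : 0 <= c -> 0 <= C -> c / (C + 1) * C <= c.
Proof.
move=> c0 C0; have C1 : 0 < C + 1 by lra.
by rewrite mulrAC ler_pdivrMr // ler_wpM2l //; lra.
Qed.

(* The weights of the layers are the increments of a bounded sequence, so infinitely many of them
   are small enough to beat the linear growth of [y] on the first layer outside the box. *)
Lemma cv_layer (r : nat) (C1 C2 e : R) (M : nat) : 0 <= C1 -> 0 <= C2 -> 0 < e ->
  exists2 N, (M <= N)%N & forall y : Zd -> R,
    (forall n, inbox N n -> y n = 0) -> (forall n, ~~ inbox N n -> `|y n| <= C1 * N.+1%:R) ->
    (forall n, ~~ inbox N.+1 n -> `|y n| <= C2) -> bounded y ->
    forall n, inbox r n -> `|cv W y n| <= e.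
Proof.
move=> C10 C20 e0.
have Was := Wg_asum hg.
(* One summable majorant of |W(n-k)| for all n in the window at once, so that a single N serves the
   whole window. *)
pose b k := \sum_(n <- box d r) `|W (n - k)|.
have bas : asum b.
  rewrite /b; elim: (box d r) => [|n s IH].
    by exists 0 => s _; rewrite big1 // => k _; rewrite big_nil normr0.
  under [fun k => _]eq_fun => k do rewrite big_cons.
  apply: asumD IH; have [B hB] := asum_shift (- n) (asumN Was).
  exists B => t ut; apply: le_trans (hB t ut); apply: ler_sum => k _.
  by rewrite normr_id opprD opprK addrC.
have b0 k : 0 <= b k by apply: sumr_ge0.
have bW n k : inbox r n -> `|W (n - k)| <= b k.
  rewrite -mem_box => nr; rewrite /b (bigD1_seq n) ?box_uniq //= lerDl.
  exact: sumr_ge0.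
have [B hB] := bas.
pose S N := \sum_(k <- box d N) b k.
(* The layer and the region beyond it receive e/6 each; the missing factor 3 is lost in
   [zsum_norm_le]. Adding 1 avoids division by zero. *)
pose e1 := e / 6 / (C2 + 1); pose e2 := e / 6 / (C1 + 1).
have e10 : 0 < e1 by rewrite !divr_gt0 //; lra.
have e20 : 0 < e2 by rewrite !divr_gt0 //; lra.
have [K hK] := tailP bas e10.
have monoS : {homo S : a b / (a <= b)%N >-> a <= b}.
  by move=> p q pq; apply: sum_subset => //; [exact: box_uniq|exact: box_uniq|exact: box_subset].
have bS N : 0 <= S N <= B.
  rewrite sumr_ge0 //=; apply: le_trans (hB _ (box_uniq d N)).
  by apply: ler_sum => k _; exact: ler_norm.
have [N MN hN] := slow_increment (M + K) monoS bS e20.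
exists N; first by lia.
move=> y y0 y1 y2 by_ n nr.
have -> : e = 3 * (e / 6 + e / 6) by lra.
apply: zsum_norm_le => [|s us]; first exact: cv_asum.
have -> : \sum_(k <- s) `|W k * y (n - k)| = \sum_(k <- [seq n - k | k <- s]) `|W (n - k)| * `|y k|.
  by rewrite big_map; apply: eq_bigr => k _; rewrite subKr normrM.
set t := [seq _ | _ <- _].
have ut : uniq t by rewrite map_inj_uniq // => k k' /addrI /oppr_inj.
rewrite (bigID (fun k => inbox N.+1 k)) /=; apply: lerD; last first.
  apply: (@le_trans _ _ (\sum_(k <- t | ~~ inbox N.+1 k) b k * C2)).
    by apply: ler_sum => k kN; apply: ler_pM => //; [exact: bW|exact: y2].
  rewrite -mulr_suml -big_filter.
  have KN : tail b N.+1 e1 by apply: tail_leK hK; lia.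
  have := KN _ (filter_uniq (fun k => ~~ inbox N.+1 k) ut).
  have i k : k \in [seq k <- t | ~~ inbox N.+1 k] -> ~~ inbox N.+1 k by rewrite mem_filter => /andP[].
  move=> /(_ i) h; have {}h := le_trans (ler_sum _ (fun k _ => ler_norm (b k))) h.
  by apply: le_trans (ler_wpM2r C20 h) _; apply: frac_le => //; lra.
apply: (@le_trans _ _ (\sum_(k <- box d N.+1 | ~~ inbox N k) b k * (C1 * N.+1%:R))).
  rewrite (bigID (fun k => inbox N k)) /= big1 ?add0r; last first.
    by move=> k /andP[_ /y0 ->]; rewrite normr0 mulr0.
  apply: (@le_trans _ _ (\sum_(k <- t | inbox N.+1 k && ~~ inbox N k) b k * (C1 * N.+1%:R))).
    by apply: ler_sum => k /andP[_ kN]; apply: ler_pM => //; [exact: bW|exact: y1].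
  rewrite -[leLHS]big_filter -[leRHS]big_filter.
  apply: (sum_subset (f := fun k => b k * (C1 * N.+1%:R))); rewrite ?filter_uniq ?box_uniq //.
    by move=> k; rewrite !mulr_ge0.
  by move=> k; rewrite !mem_filter mem_box => /andP[/andP[-> ->]].
rewrite -mulr_suml.
have -> : \sum_(k <- box d N.+1 | ~~ inbox N k) b k = S N.+1 - S N.
  apply/eqP; rewrite eq_sym subr_eq addrC /S [X in X == _](bigID (inbox N)) /= -big_filter; apply/eqP.
  congr (_ + _); apply: perm_big; apply: uniq_perm; rewrite ?filter_uniq ?box_uniq // => k.
  by rewrite mem_filter !mem_box; apply: andb_idr; exact: inboxS.
rewrite mulrCA [_ * N.+1%:R]mulrC.
apply: le_trans (ler_wpM2l C10 hN) _; rewrite mulrC; apply: frac_le => //; lra.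
Qed.

Lemma approx_Rinf (x : Zd -> R) (r : nat) (e : R) : (forall n, 0 <= x n < 1) -> (forall n, lap x n \is a Num.int) ->
  0 < e -> exists2 u : Zd -> nat, Rinf u &
    forall n, inbox r n -> exists2 z, z \is a Num.int & `|cv W (lap x) n - cv W (fun k => (u k)%:R) n - z| <= e.
Proof.
move=> x01 hx e0; pose D : R := d%:R; have D0 : 0 <= D by rewrite ler0n.
have bx : bounded x by exists 1 => n; have := x01 n; rewrite ler_norml; lra.
pose v n := Num.floor (lap x n).
have hv n : (v n)%:~R = lap x n by exact/floorK.
have bv n : `|lap x n| <= 4 * D.
  rewrite lapE; apply: le_trans (ler_norm_sum _ _ _) _.
  apply: (@le_trans _ _ (\sum_(j < d) 4)).
    apply: ler_sum => j _; have := x01 n; have := x01 (n + evec j); have := x01 (n - evec j).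
    by rewrite ler_norml; lra.
  by rewrite sumr_const card_ord -[leLHS]mulr_natr.
(* Here 6D bounds |lap x| + |u| (4D and 2D). Thus |lap h| <= 2 * 3D inside the box, and [lap_layer]
   with C = 3D gives the term 4D * 3D on the layer. *)
have [N _ hN] := @cv_layer r (6 * D + 4 * D * (3 * D)) (6 * D) e 0 ltac:(nra) ltac:(lra) e0.
have [h [u0 [sh ru e1]]] := recurrent_exists N ord0 v.
pose u n := if inbox N n then u0 n else (2 * d).-1.
have Ru : Rinf u := recurrent_extend ord0 ru.
exists u => // n nr.
pose uR k : R := (u k)%:R; pose hR k : R := (h k)%:~R.
have shR : supp N hR by move=> k /sh e2; rewrite /hR e2.
have uD k : `|uR k| <= 2 * D.
  have [/(_ k) le _] := Ru; rewrite ger0_norm /uR /D -?natrM ?ler_nat //.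
  by apply: leq_trans le (leq_pred _).
have lapR k : lap hR k = (lap h k)%:~R by rewrite /hR (lap_morph (intr : int -> R)).
have e2 k : inbox N k -> lap hR k = lap x k - uR k.
  by move=> kN; rewrite lapR -hv /uR /u kN pmulrn -intrB e1 // subKr.
have bl k : inbox N k -> `|lap hR k| <= 3 * D * 2.
  move=> /e2 ->; apply: le_trans (ler_normB _ _) _.
  by have := bv k; have := uD k; lra.
pose y k := lap x k - uR k - lap hR k.
have y0 k : inbox N k -> y k = 0 by move=> kN; rewrite /y e2 // subrr.
have N1 : 1 <= N.+1%:R :> R by rewrite ler1n.
have D3 : 0 <= 3 * D by lra.
have y1 k : ~~ inbox N k -> `|y k| <= (6 * D + 4 * D * (3 * D)) * N.+1%:R.
  move=> kN; have h1 := lap_layer D3 shR bl kN.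
  have h2 : `|y k| <= `|lap x k| + `|uR k| + `|lap hR k|.
    by apply: le_trans (ler_normB _ _) _; rewrite lerD2r ler_normB.
  apply: le_trans h2 _; rewrite mulrDl; apply: lerD; last by rewrite natrM in h1.
  by apply: (@le_trans _ _ (6 * D)); [have := bv k; have := uD k; lra|rewrite ler_peMr //; lra].
have y2 k : ~~ inbox N.+1 k -> `|y k| <= 6 * D.
  move=> kN; rewrite /y (lap_out shR kN) subr0; apply: le_trans (ler_normB _ _) _.
  by have := bv k; have := uD k; lra.
have by_ : bounded y.
  exists ((6 * D + 4 * D * (3 * D)) * N.+1%:R) => k; have [/y0 ->|/y1 //] := boolP (inbox N k).
  by rewrite normr0 mulr_ge0 //; nra.
have bu : bounded uR by exists (2 * D).
have bxl : bounded (lap x) by exists (4 * D).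
have bh : bounded hR.
  exists (3 * D * N.+1%:R ^+ 2) => k; have [kN|/shR ->] := boolP (inbox N k); last first.
    by rewrite normr0 mulr_ge0 // sqr_ge0.
  have := @box_bound_abs _ _ N hR 0 (3 * D) ord0 D3 bl _ k kN; rewrite add0r => h3.
  apply: le_trans (h3 _) => [|l lN _]; first by rewrite lerDl mulr_ge0 // sqr_ge0.
  by rewrite shR // normr0.
have blh : bounded (lap hR).
  have := boundedD (boundedD bxl (boundedN bu)) (boundedN by_); congr bounded.
  by apply/funext => k; rewrite /y; ring.
have Was := Wg_asum hg.
exists (act (lstar g) hR n); first by apply: act_int => k; exact: intr_int.
rewrite -(cv_lap m0 hg) //.
have -> : cv W (lap x) n = cv W uR n + cv W (lap hR) n + cv W y n.
  rewrite -!cvDr //; last exact: boundedD.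
  by congr cv; apply/funext => k; rewrite /y; ring.
have -> (a b c : R) : a + b + c - a - b = c by ring.
exact: hN.
Qed.

Lemma xi_Rinf : ~ in_ideal_f g -> [set xi R g (fun n => (v n)%:Z) | v in @Rinf d] = @Xf R d.
Proof.
move=> ng; apply/seteqP; split => [_ [v Rv <-]|x /XfP [x01 hx]].
  apply: (xi_Xf m0 hg); exists (2 * d)%:R => n; rewrite -[_%:~R]/((v n)%:R) normr_nat ler_nat.
  by apply: leq_trans (leq_pred _); have [h _] := Rv; exact: h.
have i01 : @ord_max m != ord0 by rewrite -val_eqE /= -lt0n.
have [y [hy yx]] := lstar_surj i01 ng hx.
pose x' n := rho (y n).
have x'01 n : 0 <= x' n < 1 by exact: rho_itv.
have yx' n : y n - x' n \is a Num.int by exact: sub_rho_int.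
have hx' n : lap x' n \is a Num.int by apply: (lap_mod (x := y)).
have bx' : bounded x' by exists 1 => n; have := x'01 n; rewrite ler_norml; lra.
have xx' n : cv W (lap x') n - x n \is a Num.int.
  rewrite (cv_lap m0 hg) // -[_ - _](_ : act (lstar g) y n - x n - act (lstar g) (fun k => y k - x' k) n = _).
    by rewrite rpredB // act_int.
  by rewrite actB; ring.
have Was := Wg_asum hg.
have /choice [u hu] : forall r : nat, exists u : Zd -> nat, Rinf u /\ forall n, inbox r n ->
    exists2 z, z \is a Num.int & `|cv W (lap x') n - cv W (fun k => (u k)%:R) n - z| <= r.+1%:R^-1.
  move=> r; have [|u Ru h] := @approx_Rinf x' r (r.+1%:R^-1) x'01 hx'; first by rewrite invr_gt0.
  by exists u.
have [v Rv agree] := Rinf_compact (fun r => (hu r).1).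
exists v => //; apply/funext => n; rewrite -[RHS]rho_small //; apply/rhoP.
have -> : cv W (fun k => ((v k)%:Z)%:~R) n - x n =
    (cv W (lap x') n - x n) - (cv W (lap x') n - cv W (fun k => ((v k)%:Z)%:~R) n) by ring.
rewrite rpredB //; apply: int_closed => e e0.
pose D : R := (2 * d)%:R; have D0 : 0 < D by rewrite ltr0n.
(* Coordinates outside the box [K] may disagree by up to D; with the factor 3 of [zsum_norm_le] they
   then contribute at most e/2. *)
have e2 : 0 < e / 2 / 3 / D by rewrite !divr_gt0.
have [K hK] := tailP Was e2.
(* The lower bound on r puts n in the window of [u r] and makes its error 1/(r+1) at most e/2. *)
have [r Kr hr] := agree [seq n - k | k <- box d K] (maxn (supnorm n) (Num.truncn (2 / e))).
have [|z iz hz] := (hu r).2 n; first by apply: leq_trans Kr; exact: leq_maxl.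
exists z => //.
have bD (u0 : Zd -> nat) : Rinf u0 -> forall k, (u0 k)%:R <= D.
  by move=> [h _] k; rewrite ler_nat; apply: leq_trans (h k) (leq_pred _).
have close : `|cv W (fun k => (u r k)%:R) n - cv W (fun k => (v k)%:R) n| <= e / 2.
  have b1 : bounded (fun k => (u r k)%:R : R) by exists D => k; rewrite normr_nat bD //; exact: (hu r).1.
  have b2 : bounded (fun k => (v k)%:R : R) by exists D => k; rewrite normr_nat bD.
  rewrite -cvNr // -cvDr //; last exact: boundedN.
  have -> : e / 2 = 3 * (e / 2 / 3) by lra.
  apply: zsum_norm_le => [|s us]; first exact: (cv_asum n Was (boundedD b1 (boundedN b2))).
  rewrite (bigID (inbox K)) /= big1 ?add0r; last first.
    move=> k kK; rewrite hr ?subrr ?mulr0 ?normr0 //; apply/mapP; exists k => //; by rewrite mem_box.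
  have := hK [seq k <- s | ~~ inbox K k] (filter_uniq _ us); rewrite big_filter => h.
  apply: (@le_trans _ _ (\sum_(k <- s | ~~ inbox K k) `|W k| * D)).
    apply: ler_sum => k _; rewrite normrM ler_wpM2l //.
    have := bD _ (hu r).1 (n - k); have := bD _ Rv (n - k).
    have : 0 <= (u r (n - k))%:R :> R by rewrite ler0n.
    have : 0 <= (v (n - k))%:R :> R by rewrite ler0n.
    by rewrite ler_norml; lra.
  rewrite -mulr_suml -ler_pdivlMr //; apply: h => k.
  by rewrite mem_filter => /andP[].
have r2 : r.+1%:R^-1 <= e / 2.
  rewrite -[leRHS]invrK lef_pV2 ?posrE ?invr_gt0 ?divr_gt0 // invf_div.
  apply: le_trans (ltW (truncnS_gt _)) _; rewrite ler_nat ltnS.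
  by apply: leq_trans Kr; exact: leq_maxr.
move: hz close; rewrite -[fun k => ((v k)%:Z)%:~R]/(fun k => (v k)%:R).
move: (cv W (lap x') n) (cv W (fun k => (u r k)%:R) n) (cv W (fun k => (v k)%:R) n) => a b c h1 h2.
have -> : a - c - z = (a - b - z) + (b - c) by ring.
apply: le_trans (ler_normD _ _) _; have -> : e = e / 2 + e / 2 by lra.
by apply: lerD => //; exact: le_trans h1 r2.
Qed.

End Surjectivity.

(** * Entropy and pattern counts *)

Section Limsup.
Variable R : realType.
Implicit Types (u a : nat -> R).

Lemma limn_esup_le u a (l : R) : a @ \oo --> l -> (forall N, u N <= a N) ->
  (limn_esup (fun N => (u N)%:E) <= l%:E)%E.
Proof.
move=> /cvgrPdist_le al ua; apply/lee_addgt0Pr => e e0.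
have [N0 _ hN] := al e e0; apply: ge_ereal_inf.
exists (ereal_sup [set (u N)%:E | N in [set N | (N0 <= N)%N]]); first by exists [set N | (N0 <= N)%N] => //; exists N0.
apply: ge_ereal_sup => _ [N /= /hN h <-]; rewrite -EFinD lee_fin.
by move: h => /=; have := ua N; rewrite ler_norml; lra.
Qed.

Lemma limn_esup_ge u a (l : R) : a @ \oo --> l -> (forall N, a N <= u N) ->
  (l%:E <= limn_esup (fun N => (u N)%:E))%E.
Proof.
move=> /cvgrPdist_le al au; apply: le_ereal_inf_tmp => _ [V [N0 _ hV] <-].
apply/lee_addgt0Pr => e e0; have [N1 _ hN] := al e e0.
have := hN (maxn N0 N1) (leq_maxr _ _) => /= h.
have : ((u (maxn N0 N1))%:E <= ereal_sup [set (u N)%:E | N in V])%E.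
  by apply: ereal_sup_ubound; exists (maxn N0 N1) => //; apply: hV; exact: leq_maxl.
move=> h2; apply: le_trans (leeD2r e%:E h2).
by rewrite -EFinD lee_fin; have := au (maxn N0 N1); move: h; rewrite ler_norml; lra.
Qed.

End Limsup.

Section Bowen.
Variables (R : realType) (d : nat) (T : Type) (X : set (Zd d -> T)) (delta : T -> T -> R).
Local Notation Zd := (Zd d).
Hypothesis delta01 : forall a b, 0 <= delta a b <= 1.

Lemma pdist_ub (x y : Zd -> T) :
  has_ubound [set r | exists n, r = (2^-1) ^+ supnorm n * delta (x n) (y n)].
Proof.
exists 1 => _ [n ->]; have /andP[d0 d1] := delta01 (x n) (y n).
by apply: mulr_ile1; rewrite ?exprn_ge0 ?exprn_ile1 //; lra.
Qed.

Lemma bowen_ge N (x y : Zd -> T) m : inbox N m -> delta (x m) (y m) <= bowen_dist delta N x y.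
Proof.
move=> /bpt_surj[c <-]; rewrite /bowen_dist; apply: le_trans (le_bigmax _ _ c).
apply: ub_le_sup; first exact: pdist_ub.
exists 0; rewrite /Defs.shift addr0 (_ : supnorm 0 = 0%N) ?expr0 ?mul1r //.
by apply: big1 => i _; rewrite ffunE.
Qed.

Lemma half_pow_small (e : R) : 0 < e -> exists K, (2^-1) ^+ K <= e.
Proof.
move=> e0; exists (Num.truncn e^-1).+1; set k := (Num.truncn e^-1).+1.
have h : k%:R <= 2 ^+ k :> R by rewrite -natrX ler_nat ltnW // ltn_expl.
rewrite exprVn -[leRHS]invrK lef_pV2 ?posrE ?invr_gt0 ?exprn_gt0 //.
exact: le_trans (ltW (truncnS_gt _)) h.
Qed.

(** A site farther than K from the base point has weight at most 2^(-K) <= e, so a distance above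
    [e] is witnessed within K of the box. *)
Lemma bowen_gt e K N (x y : Zd -> T) : (2^-1) ^+ K <= e -> e < bowen_dist delta N x y ->
  exists2 m, inbox (N + K) m & e < delta (x m) (y m).
Proof.
move=> eK; rewrite /bowen_dist.
have e0 : 0 < e by apply: lt_le_trans eK; rewrite exprn_gt0 // invr_gt0.
move=> /bigmax_gtP -[|[c _ h]]; first by move/(lt_trans e0); rewrite ltxx.
have [|_ [n ->] hn] := sup_gt _ h; first by exists ((2^-1) ^+ supnorm (0 : Zd) * delta (Defs.shift (bpt c) x 0) (Defs.shift (bpt c) y 0)); exists 0.
have /andP[d0 d1] := delta01 (Defs.shift (bpt c) x n) (Defs.shift (bpt c) y n).
have p1 : (2^-1) ^+ supnorm n <= 1 :> R by rewrite exprn_ile1 //; lra.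
exists (bpt c + n); last first.
  by apply: lt_le_trans hn _; rewrite ler_piMl.
apply: inboxD; first exact: inbox_bpt.
rewrite /inbox leqNgt; apply/negP => lt.
have : (2^-1) ^+ supnorm n <= (2^-1) ^+ K :> R.
  by apply: ler_wiXn2l; rewrite ?(ltnW lt) //; lra.
have p0 : 0 <= (2^-1) ^+ supnorm n :> R by rewrite exprn_ge0.
have := ler_wpM2l p0 d1; rewrite mulr1 => h1 h2.
by have := lt_le_trans hn (le_trans h1 (le_trans h2 eK)); rewrite ltxx.
Qed.

Definition separated N e k (p : 'I_k -> Zd -> T) :=
  (forall i, X (p i)) /\ (forall i j, i != j -> e < bowen_dist delta N (p i) (p j)).

Lemma sepnum_le N e (B : nat) : (forall k (p : 'I_k -> Zd -> T), separated N e p -> (k <= B)%N) ->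
  sepnum X delta N e <= B%:R.
Proof.
move=> h; apply: ge_sup.
  have p0 : 'I_0 -> Zd -> T by case.
  by exists 0; exists 0%N => //; exists p0; split => -[].
by move=> _ [k [p hp] <-]; rewrite ler_nat; exact: h hp.
Qed.

(** The uniform bound [B] is what makes the supremum a genuine one: [sup] of an unbounded set is a
    default value. *)
Lemma sepnum_ge N e (B k : nat) (p : 'I_k -> Zd -> T) :
  (forall k (p : 'I_k -> Zd -> T), separated N e p -> (k <= B)%N) ->
  separated N e p -> k%:R <= sepnum X delta N e.
Proof.
move=> h hp; apply: ub_le_sup; last by exists k => //; exists p.
by exists B%:R => _ [k' [p' hp'] <-]; rewrite ler_nat; exact: h hp'.
Qed.

End Bowen.

Section EntropyBounds.
Variables (R : realType) (m : nat).
Hypothesis m0 : (0 < m)%N.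
Local Notation d := m.+1.
Local Notation Zd := (Zd d).
Local Notation mahler := (iint d (fun t => ln (@Ffun R d t))).

Lemma boxcard_gt0 N : (0 < boxcard d N)%N.
Proof. by rewrite expn_gt0. Qed.

Lemma boxcard_ratio K : (fun N => (boxcard d (N + K))%:R / (boxcard d N)%:R : R) @ \oo --> (1 : R).
Proof.
have e N : (boxcard d (N + K))%:R / (boxcard d N)%:R = (1 + (2 * K)%:R * (N.*2.+1)%:R^-1) ^+ d :> R.
  rewrite /boxcard !natrX -expr_div_n; congr (_ ^+ _).
  have : (N.*2.+1)%:R != 0 :> R by rewrite pnatr_eq0.
  have -> : ((N + K).*2.+1 = N.*2.+1 + 2 * K)%N by lia.
  by rewrite natrD; move=> h; field.
rewrite (_ : (fun N => _) = fun N => (1 + (2 * K)%:R * (N.*2.+1)%:R^-1) ^+ d); last exact/funext.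
rewrite -[X in _ --> X](expr1n _ d).
have c : (fun N : nat => 1 + (2 * K)%:R * (N.*2.+1)%:R^-1 : R) @ \oo --> (1 : R).
  rewrite -[X in _ --> X]addr0 -[X in 1 + X](mulr0 (2 * K)%:R).
  apply: cvgD; first exact: cvg_cst.
  apply: cvgM; first exact: cvg_cst.
  apply/cvgrPdist_le => e0 e0p; exists (Num.truncn e0^-1) => // N /= hN.
  rewrite sub0r normrN ger0_norm ?invr_ge0 // -[leRHS]invrK lef_pV2 ?posrE ?invr_gt0 //.
  apply: (@le_trans _ _ (Num.truncn e0^-1).+1%:R); first exact/ltW/truncnS_gt.
  by rewrite ler_nat ltnS; lia.
elim: d => [|k IH].
  by rewrite expr0 (_ : (fun _ => _) = fun=> 1); [exact: cvg_cst|apply/funext => N; rewrite expr0].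
by rewrite exprS (_ : (fun _ => _) = fun N => (1 + (2 * K)%:R / N.*2.+1%:R) * (1 + (2 * K)%:R / N.*2.+1%:R) ^+ k); [exact: cvgM|apply/funext => N; rewrite exprS].
Qed.

Lemma upper_limit (K J : nat) : (fun N => (ln ((npat d (N + K))%:R : R) +
    ((boxcard d (N + K).+1)%:R - (boxcard d (N + K))%:R) * ln J%:R) / (boxcard d N)%:R) @ \oo --> mahler.
Proof.
have e N : (ln ((npat d (N + K))%:R : R) +
    ((boxcard d (N + K).+1)%:R - (boxcard d (N + K))%:R) * ln J%:R) / (boxcard d N)%:R =
    (ln (npat d (N + K))%:R / (boxcard d (N + K))%:R) * ((boxcard d (N + K))%:R / (boxcard d N)%:R) +
    ((boxcard d (N + K.+1))%:R / (boxcard d N)%:R - (boxcard d (N + K))%:R / (boxcard d N)%:R) * ln J%:R.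
  have h1 : (boxcard d N)%:R != 0 :> R by rewrite pnatr_eq0 -lt0n boxcard_gt0.
  have h2 : (boxcard d (N + K))%:R != 0 :> R by rewrite pnatr_eq0 -lt0n boxcard_gt0.
  by rewrite addnS; field; rewrite h1 h2.
rewrite (funext e) -[X in _ --> X]addr0; apply: cvgD.
  rewrite -[X in _ --> X]mulr1; apply: cvgM; last exact: boxcard_ratio.
  by have := @mahler_limit R m; rewrite -(cvg_shiftn K).
rewrite -[X in _ --> X](mul0r (ln J%:R)); apply: cvgM; last exact: cvg_cst.
by rewrite -[X in _ --> X](subrr (1 : R)); apply: cvgB; exact: boxcard_ratio.
Qed.

(* The factor [J ^ _] disappears in the limit: a box boundary has no exponential weight. *)
Lemma htop_mahler (T : Type) (X : set (Zd -> T)) (delta : T -> T -> R) :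
  (forall e, 0 < e -> exists K J, (0 < J)%N /\ forall N k (p : 'I_k -> Zd -> T),
    separated X delta N e p ->
    (k <= npat d (N + K) * J ^ (boxcard d (N + K).+1 - boxcard d (N + K)))%N) ->
  (exists2 e, 0 < e & forall N, exists p : 'I_(npat d N) -> Zd -> T, separated X delta N e p) ->
  htop X delta = mahler%:E.
Proof.
move=> hup [e0 e00 hlow]; apply/eqP; rewrite eq_le; apply/andP; split.
  apply: ge_ereal_sup => _ [e /= e1 <-]; have [K [J [J0 hK]]] := hup e e1.
  apply: limn_esup_le (upper_limit K J) _ => N.
  rewrite ler_pM2r ?invr_gt0 ?ltr0n ?boxcard_gt0 //.
  have np : (0 < npat d (N + K))%N by apply: (npat_gt0 R).
  have bm : (boxcard d (N + K) <= boxcard d (N + K).+1)%N by rewrite leq_exp2r //; lia.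
  have -> : ln (npat d (N + K))%:R + ((boxcard d (N + K).+1)%:R - (boxcard d (N + K))%:R) * ln J%:R =
      ln (npat d (N + K) * J ^ (boxcard d (N + K).+1 - boxcard d (N + K)))%:R :> R.
    rewrite natrM natrX lnM ?posrE ?ltr0n ?exprn_gt0 ?ltr0n // lnXn ?ltr0n //.
    by rewrite -natrB // mulr_natl.
  have := sepnum_le (hK N); set B := (_ * _)%N => le.
  have B0 : (0 < B)%N by rewrite muln_gt0 np expn_gt0 J0.
  have [s0|s0] := leP (sepnum X delta N e) 0.
    (* At nonpositive arguments [ln] takes the value 0. *)
    by rewrite ln0 // ln_ge0 // ler1n.
  by rewrite ler_ln ?posrE // ltr0n.
apply: le_ereal_sup_tmp; exists (limn_esup (fun N => (ln (sepnum X delta N e0) / (boxcard d N)%:R)%:E)).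
  by exists e0.
apply: limn_esup_ge (@mahler_limit R m) _ => N.
rewrite ler_pM2r ?invr_gt0 ?ltr0n ?boxcard_gt0 //.
have [K [J [J0 hK]]] := hup e0 e00; have [p hp] := hlow N.
have le := sepnum_ge (hK N) hp.
have np : 0 < (npat d N)%:R :> R by rewrite ltr0n; apply: (npat_gt0 R).
by rewrite ler_ln ?posrE // (lt_le_trans np).
Qed.

End EntropyBounds.

Lemma card_le_code k (T : finType) (A : {pred T}) (F : 'I_k -> T) :
  injective F -> (forall i, F i \in A) -> (k <= #|A|)%N.
Proof.
move=> Fi FA; rewrite -{1}(card_ord k) -(card_codom Fi); apply: subset_leq_card.
by apply/fintype.subsetP => _ /codomP[i ->].
Qed.

(** * Entropy of the recurrent shift *)

Section EntropyRinf.
Variables (R : realType) (m : nat).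
Hypothesis m0 : (0 < m)%N.
Local Notation d := m.+1.
Local Notation Zd := (Zd d).
Local Notation mahler := (iint d (fun t => ln (@Ffun R d t))).

Lemma discr_dist01 a b : 0 <= @discr_dist R a b <= 1.
Proof. by rewrite /discr_dist; case: ifP => _; rewrite lexx ler01. Qed.

Lemma htop_Rinf : htop (@Rinf d) (@discr_dist R) = mahler%:E.
Proof.
apply: (htop_mahler m0).
  move=> e e0; have [K hK] := half_pow_small e0; exists K, 1%N; split=> // N k p [pX psep].
  rewrite exp1n muln1.
  have /choice [F hF] : forall i, exists q : {ffun boxT d (N + K) -> 'I_(2 * d)},
      is_recpat q /\ forall c, (q c : nat) = p i (bpt c).
    move=> i; have [q q1 q2] := recurrent_pattern (ltn0Sn m) (Rinf_recurrent (N + K) (pX i)).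
    by exists q.
  rewrite npatE //; apply: (card_le_code (F := F)) => [i j eF|i]; last exact: (hF i).1.
  apply/eqP/negPn/negP => ij; have := psep i j ij.
  move=> /(bowen_gt discr_dist01 hK) [n /bpt_surj[c <-]].
  by rewrite /discr_dist -!(hF _).2 eF eqxx ltNge ltW.
exists (1 / 2); first lra.
move=> N; rewrite npatE //.
pose x (i : 'I_#|[pred p : {ffun boxT d N -> 'I_(2 * d)} | is_recpat p]|) (n : Zd) :=
  if inbox N n then patfun (enum_val i) n else (2 * d).-1.
exists x; split=> [i|i j ij].
  apply: (recurrent_extend ord0); have h : is_recpat (enum_val i) := enum_valP i.
  exact/asboolP.
have [c hc] : exists c, enum_val i c != enum_val j c.
  apply/existsP; rewrite -negb_forall; apply: contra ij => /forallP h.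
  by apply/eqP/enum_val_inj/ffunP => c; apply/eqP; exact: h.
apply: lt_le_trans (bowen_ge discr_dist01 _ _ (inbox_bpt c)).
rewrite /x inbox_bpt !patfun_bpt /discr_dist; case: eqP => [/val_inj e|_]; last by lra.
by rewrite e eqxx in hc.
Qed.

End EntropyRinf.

(** * Entropy of the harmonic model *)

Section Circle.
Variable R : realType.
Implicit Types a b t e : R.

Lemma int_norm_lt1 a : a \is a Num.int -> `|a| < 1 -> a = 0.
Proof.
move=> ia a1; apply/eqP/negPn/negP => /(norm_intr_ge1 ia).
by rewrite leNgt a1.
Qed.

Lemma circ_dist01 a b : 0 <= circ_dist a b <= 1.
Proof.
have /andP[r0 r1] := rho_itv (a - b); rewrite /circ_dist ge_min le_min r0 (ltW r1) /=.
by rewrite subr_ge0 ltW.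
Qed.

Lemma circ_dist_le a b t e : a - b - t \is a Num.int -> `|t| <= e -> circ_dist a b <= e.
Proof.
move=> it te; have /andP[r0 r1] := rho_itv (a - b); have ir := sub_rho_int (a - b).
rewrite /circ_dist leNgt; apply/negP; rewrite lt_min => /andP[h1 h2].
have : rho (a - b) - t = 0.
  apply: int_norm_lt1.
    have -> : rho (a - b) - t = (a - b - t) - (a - b - rho (a - b)) by ring.
    by rewrite rpredB.
  by move: te; rewrite ler_norml ltr_norml; lra.
by move: te; rewrite ler_norml; lra.
Qed.

Lemma circ_dist_rep a b e : circ_dist a b <= e -> exists2 t, `|t| <= e & a - b - t \is a Num.int.
Proof.
have /andP[r0 r1] := rho_itv (a - b); have ir := sub_rho_int (a - b).
rewrite /circ_dist ge_min => /orP[h|h].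
  by exists (rho (a - b)) => //; rewrite ger0_norm.
exists (rho (a - b) - 1); first by rewrite ler0_norm; lra.
have -> : a - b - (rho (a - b) - 1) = a - b - rho (a - b) + 1 by ring.
by rewrite rpredD // rpred1.
Qed.

End Circle.

Section BoundaryLayer.
Variable d : nat.

Definition layer M : seq (Zd d) := [seq n <- box d M.+1 | ~~ inbox M n].

Lemma size_layer M : size (layer M) = (boxcard d M.+1 - boxcard d M)%N.
Proof.
rewrite -!size_box; set s := box d M.+1.
have p : perm_eq [seq n <- s | inbox M n] (box d M).
  apply: uniq_perm; rewrite ?filter_uniq ?box_uniq // => n.
  by rewrite mem_filter !mem_box; apply: andb_idr; exact: inboxS.
have := count_predC (inbox M) s; rewrite -!size_filter (perm_size p) => <-.
by rewrite addKn.
Qed.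

End BoundaryLayer.

Section EntropyXf.
Variables (R : realType) (m : nat).
Hypothesis m0 : (0 < m)%N.
Local Notation d := m.+1.
Local Notation Zd := (Zd d).
Local Notation evec := (@evec d).
Local Notation mahler := (iint d (fun t => ln (@Ffun R d t))).

Lemma Xf_code M (x : Zd -> R) : Xf x -> exists (q : {ffun boxT d M -> 'I_(2 * d)}) (h : Zd -> int),
  [/\ is_recpat q, supp M h & forall n, inbox M n -> lap x n = (patfun q n)%:R + (lap h n)%:~R].
Proof.
move=> /XfP [_ hx].
have [h [u [sh ru e]]] := recurrent_exists M ord0 (fun n => Num.floor (lap x n)).
have [q rq eq] := recurrent_pattern (ltn0Sn m) ru.
exists q, h; split=> // _ /bpt_surj[c <-]; rewrite patfun_bpt eq.
rewrite -[lap x _]floorK // -[(u _)%:R]/((u (bpt c))%:Z%:~R) e ?inbox_bpt // -intrD.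
by rewrite subrK.
Qed.

Lemma sepnum_Xf e J M k (p : 'I_k -> Zd -> R) : (forall i, Xf (p i)) -> 0 < e -> J.+1%:R^-1 <= e ->
  (forall i j, i != j -> exists2 n, inbox M n & e < circ_dist (p i n) (p j n)) ->
  (k <= npat d M * J.+1 ^ (boxcard d M.+1 - boxcard d M))%N.
Proof.
move=> pX e0 Je psep.
have /choice [q hq] := fun i => Xf_code M (pX i).
pose cell (i : 'I_k) : {ffun 'I_(size (layer d M)) -> 'I_J.+1} :=
  [ffun l : 'I__ => inord (Num.truncn (J.+1%:R * p i (nth 0 (layer d M) l)))].
have x01 i n : 0 <= p i n < 1 by have /XfP[] := pX i.
have cellP i j : cell i = cell j -> forall n, n \in layer d M -> `|p i n - p j n| <= J.+1%:R^-1.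
  move=> /ffunP ec n nl; have il : (index n (layer d M) < size (layer d M))%N by rewrite index_mem.
  have Jp : 0 < J.+1%:R :> R by rewrite ltr0n.
  have := congr1 val (ec (Ordinal il)); rewrite !ffunE /= nth_index //.
  have tr i0 : (Num.truncn (J.+1%:R * p i0 n) < J.+1)%N.
    have /andP[a b] := x01 i0 n.
    rewrite -(ltr_nat R); have /andP[h _] := truncn_itv (mulr_ge0 (ltW Jp) a).
    by apply: le_lt_trans h _; rewrite gtr_pMr.
  rewrite !inordK // => et.
  have b i0 : (Num.truncn (J.+1%:R * p i0 n))%:R <= J.+1%:R * p i0 n < (Num.truncn (J.+1%:R * p i0 n))%:R + 1.
    have /andP[a _] := x01 i0 n.
    by have /andP[h1 h2] := truncn_itv (mulr_ge0 (ltW Jp) a); rewrite h1 /= natr1.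
  have : `|J.+1%:R * (p i n - p j n)| <= 1.
    have := b i; have := b j; rewrite et mulrBr ler_norml; lra.
  by rewrite normrM (gtr0_norm Jp) mulrC -ler_pdivlMr // mul1r.
rewrite npatE // -size_layer -[X in (_ * X ^ _)%N]card_ord -(card_ord (size _)) -card_ffun -cardX.
apply: (card_le_code (F := fun i => (q i, cell i))) => [i j [eq ec]|i]; last first.
  by have [h [rq _ _]] := hq i; apply/andP; split.
apply/eqP/negPn/negP => ij; have [n nM] := psep i j ij; apply/negP; rewrite -leNgt.
have [h [_ sh eh]] := hq i; have [h' [_ sh' eh']] := hq j.
(* Subtracting the integral function h - h', supported in the box, changes neither the classes
   modulo 1 nor the values on the layer, but makes the difference harmonic in the box when the
   recurrent patterns agree. *)
pose z n : R := p i n - p j n - (h n - h' n)%:~R.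
apply: (@circ_dist_le _ _ _ (z n)); first by rewrite /z subKr intr_int.
apply: le_trans Je.
have := @box_bound_abs _ _ M z (J.+1%:R^-1) 0 ord0 (lexx 0) _ _ n nM.
rewrite !mul0r !addr0; apply.
  move=> l lM; have -> : lap z l = 0; last by rewrite normr0.
  have e1 : lap (fun n => (h n - h' n)%:~R : R) l = (lap h l)%:~R - (lap h' l)%:~R.
    by rewrite (lap_morph (intr : int -> R) (fun n => h n - h' n)) lapB /= intrB.
  by rewrite /z lapB e1 lapB eh // eh' // eq; ring.
move=> l lM lM1; rewrite /z sh // sh' // subrr subr0; apply: cellP => //.
by rewrite mem_filter lM mem_box.
Qed.

(* Just beyond an extremal point of the support of [A], [lap A] is minus the value of [A] there. *)
Lemma lap_supp N (A : Zd -> int) (s : seq Zd) : (forall n, n \notin s -> A n = 0) ->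
  (forall n, ~~ inbox N.+1 n -> lap A n = 0) -> supp N A.
Proof.
move=> As hA; have [|/hasPn nz] := boolP (has (fun n => A n != 0) s); last first.
  move=> n _; have [/nz|/As //] := boolP (n \in s); by rewrite negbK => /eqP.
move=> has0; have [n1 [An1 max1]] : exists n1 : Zd, A n1 != 0 /\ forall n, A n != 0 -> (supnorm n <= supnorm n1)%N.
  have [|n1] := @seq_argmax _ _ (fun n : Zd => (supnorm n)%:Z) [seq n <- s | A n != 0].
    by rewrite -has_filter.
  rewrite mem_filter => /andP[An1 n1s] max1; exists n1; split=> // n An.
  by rewrite -lez_nat max1 // mem_filter An; apply: contraR An => /As ->.
have big n : (supnorm n1 < supnorm n)%N -> A n = 0.
  by move=> lt; apply/eqP/negPn/negP => /max1; rewrite leqNgt lt.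
have [i hi] : exists i : 'I_d, supnorm n1 = `|n1 i|%N.
  have [|i e] := @bigop.eq_bigmax 'I_d (fun i => `|n1 i|%N); first by rewrite card_ord.
  by exists i; rewrite /supnorm e.
have coord (n : Zd) j : (`|n j| <= supnorm n)%N by rewrite (leq_bigmax (F := fun j => `|n j|%N)).
have bigj (n : Zd) (j : 'I_d) : (supnorm n1 < `|n j|)%N -> A n = 0.
  by move=> h; apply: big; apply: leq_trans h (coord n j).
suff le : (supnorm n1 <= N)%N by move=> n nN; apply: big; apply: leq_ltn_trans le _; rewrite ltnNge.
rewrite leqNgt; apply/negP => lt.
have [pos|neg] := leP 0 (n1 i).
  have o : ~~ inbox N.+1 (n1 + evec i).
    apply/negP => /inboxP/(_ i); rewrite addevecE eqxx; lia.
  have := hA _ o; rewrite /lap (bigj _ i) ?addevecE ?eqxx; last by lia.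
  rewrite mul0rn sub0r (bigD1 i) //= addrK (bigj (n1 + evec i + evec i) i) ?addevecE ?eqxx; last by lia.
  rewrite add0r big1 ?addr0 => [/eqP|j ji]; first by rewrite oppr_eq0 (negbTE An1).
  by rewrite !(bigj _ i) ?addr0 // ?addevecE ?subevecE ?addevecE eqxx eq_sym (negbTE ji); lia.
have o : ~~ inbox N.+1 (n1 - evec i).
  apply/negP => /inboxP/(_ i); rewrite subevecE eqxx; lia.
have := hA _ o; rewrite /lap (bigj _ i) ?subevecE ?eqxx; last by lia.
rewrite mul0rn sub0r (bigD1 i) //= subrK (bigj (n1 - evec i - evec i) i) ?subevecE ?eqxx; last by lia.
rewrite addr0 big1 ?addr0 => [/eqP|j ji]; first by rewrite oppr_eq0 (negbTE An1).
by rewrite !(bigj _ i) ?addr0 // ?addevecE ?subevecE ?subevecE eqxx eq_sym (negbTE ji); lia.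
Qed.

(** The character is prescribed as 0 on multiples of f and as [y] on monomials of the box N+1. If f
    a + c = 0 with c supported in that box, [lap_supp] puts the support of a in the box N, where
    [lap y] is integral; so the two prescriptions agree. *)
Lemma Xf_extension N (y : Zd -> R) : (forall n, inbox N n -> lap y n \is a Num.int) ->
  exists2 x, Xf x & forall n, inbox N.+1 n -> x n - y n \is a Num.int.
Proof.
move=> hy.
pose H (l : lpoly d) (b : R) := exists a c : lpoly d,
  [/\ forall n, coef l n = coef (lmul (fpoly d) a) n + coef c n, forall kc, kc \in c -> inbox N.+1 kc.1 & b = pairing c y].
have [|l b [a [c [e1 hc ->]]] e0|x hx] := @torus_extension R d H.
- move=> l b l' b' q [a [c [e1 hc e2]]] [a' [c' [e1' hc' e2']]]; exists (lsub a q a'), (lsub c q c').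
  split; last by rewrite pairing_lsub e2 e2'.
    move=> n; rewrite !coef_lsub e1 e1' !coef_lmul !act_fpoly.
    have -> : lap (coef (lsub a q a')) n = lap (coef a) n - q * lap (coef a') n.
      by rewrite (eq_lap (coef_lsub a q a') n) lapB lapMl.
    by ring.
  by move=> kc; rewrite mem_cat => /orP[/hc //|/mapP[kc' /hc' i ->]].
- have sa : supp N (coef a).
    apply: (@lap_supp N (coef a) (map fst a)) => [n|n nN]; first exact: coef_notin.
    have := e1 n; rewrite e0 coef_lmul act_fpoly (@coef_notin _ c) ?addr0 //.
    by apply/mapP => -[kc /hc i en]; rewrite en i in nN.
  have -> : pairing c y = - pairing (lmul (fpoly d) a) y.
    apply/eqP; rewrite -addr_eq0; apply/eqP; rewrite addrC /pairing -act_cat.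
    by apply: pairing0 => n; rewrite coef_cat -e1 e0.
  rewrite rpredN /pairing act_lmul act_comm (@act_coef _ _ a _ 0 (undup (map fst a))) ?undup_uniq //; last first.
    by move=> k; rewrite mem_undup.
  apply: rpred_sum => k _; rewrite act_fpoly lap_opp sub0r opprK.
  have [/hy h|/sa ->] := boolP (inbox N k); first exact: rpredMz.
  by rewrite mulr0z; exact: rpred0.
have hl n : lap x n \is a Num.int.
  have /hx : H (lmul (fpoly d) (mono n)) 0.
    exists (mono n), [::]; split=> [k|//|]; first by rewrite coef_nil addr0.
    by rewrite pairingE big_nil.
  by rewrite subr0 /pairing act_lmul act_comm act_mono act_fpoly lap_opp sub0r opprK.
exists (fun n => rho (x n)).
  apply/XfP; split=> n; first exact: rho_itv.
  by apply: (lap_mod (x := x)) => // k; exact: sub_rho_int.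
move=> n nN; have -> : rho (x n) - y n = (x n - y n) - (x n - rho (x n)) by ring.
rewrite rpredB ?sub_rho_int //.
have /hx : H (mono n) (y n).
  exists [::], (mono n); split=> [k||].
  - by rewrite coef_lmul act_fpoly (eq_lap (y := fun=> 0) (@coef_nil d) k) /lap mul0rn sub0r big1 ?oppr0 ?add0r // => j _; rewrite addr0.
  - by move=> kc; rewrite inE => /eqP ->.
  - by rewrite pairingE big_cons big_nil addr0.
by rewrite pairingE big_cons big_nil addr0.
Qed.

Lemma htop_Xf : htop (@Xf R d) (@circ_dist R) = mahler%:E.
Proof.
apply: (htop_mahler m0).
  move=> e e0; have [K hK] := half_pow_small e0; exists K, (Num.truncn e^-1).+1; split=> // N k p [pX psep].
  apply: (sepnum_Xf pX e0).
    by rewrite -[leRHS]invrK lef_pV2 ?posrE ?invr_gt0 // ltW // truncnS_gt.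
  by move=> i j ij; have [n nN h] := bowen_gt (@circ_dist01 R) hK (psep i j ij); exists n.
(* A function bounded by e has Laplacian at most 4de = 1/2 in absolute value, so the Laplacian
   vanishes wherever it is integral. *)
pose e : R := (8 * d%:R)^-1.
have d0 : 0 < d%:R :> R by rewrite ltr0n.
have e0 : 0 < e by rewrite invr_gt0 mulr_gt0.
have ed : d%:R * (4 * e) = 1 / 2 by rewrite /e; field; rewrite gt_eqF.
exists e => // N; rewrite npatE //.
set Q := [pred q : {ffun boxT d N -> 'I_(2 * d)} | is_recpat q].
have /choice [y hy] : forall i : 'I_#|Q|, exists y : Zd -> R, supp N y /\
    forall n, inbox N n -> lap y n = (patfun (enum_val i) n)%:R.
  by move=> i; have [y sy hy] := @dirichlet_solve R d N (ltn0Sn m) (fun n => (patfun (enum_val i) n)%:R); exists y.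
have /choice [x hx] : forall i, exists x, Xf x /\ forall n, inbox N.+1 n -> x n - y i n \is a Num.int.
  move=> i; have [|x Xx hx] := @Xf_extension N (y i); last by exists x.
  by move=> n nN; rewrite (hy i).2 // rpred_nat.
exists x; split=> [i|i j ij]; first exact: (hx i).1.
rewrite ltNge; apply/negP => le.
pose z n := y i n - y j n.
(* If two points were e-close on the box, [z] would be e-close to an integral function [k] supported
   there. The patterns would then differ by exactly [lap k], and uniqueness of the recurrent
   representative would make them equal. *)
have /choice [k hk] : forall n, exists k : int, (~~ inbox N n -> k = 0) /\ `|z n - k%:~R| <= e.
  move=> n; have [nN|nN] := boolP (inbox N n); last first.
    by exists 0; split=> //; rewrite /z !(proj1 (hy _)) // !subrr normr0 ltW.
  have [t te it] := circ_dist_rep (le_trans (bowen_ge (@circ_dist01 R) (x i) (x j) nN) le).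
  have nN1 : inbox N.+1 n by apply: inboxS nN.
  have zi : z n - t \is a Num.int.
    have -> : z n - t = (x i n - x j n - t) - (x i n - y i n) + (x j n - y j n) by rewrite /z; ring.
    by apply: rpredD; [apply: rpredB => //|]; exact: (hx _).2.
  by exists (Num.floor (z n - t)); split=> //; rewrite floorK // subKr.
have sk : supp N k by move=> n; exact: (hk n).1.
have lk n : inbox N n -> (patfun (enum_val j) n)%:Z = (patfun (enum_val i) n)%:Z - lap k n.
  move=> nN; pose t n := z n - (k n)%:~R.
  have et : lap t n = (patfun (enum_val i) n)%:R - (patfun (enum_val j) n)%:R - (lap k n)%:~R.
    by rewrite /t lapB (lap_morph (intr : int -> R)) /z lapB !(proj2 (hy _)).
  have : lap t n = 0.
    apply: int_norm_lt1; first by rewrite et !rpredB ?rpred_nat ?intr_int.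
    rewrite lapE; apply: le_lt_trans (ler_norm_sum _ _ _) _.
    apply: (@le_lt_trans _ _ (\sum_(l < d) (4 * e))).
      apply: ler_sum => l _; have := (hk n).2; have := (hk (n + evec l)).2; have := (hk (n - evec l)).2.
      by rewrite -!/(t _) !ler_norml; lra.
    by rewrite sumr_const card_ord -[ltLHS]mulr_natl ed; lra.
  rewrite et => /eqP; rewrite subr_eq0 => /eqP e1.
  have : (patfun (enum_val i) n)%:Z - (patfun (enum_val j) n)%:Z = lap k n.
    by apply: (@intr_inj R); rewrite -e1 intrB.
  by move=> <-; rewrite subKr.
have rec (l : 'I_#|Q|) : recurrent N (patfun (enum_val l)).
  by have h : is_recpat (enum_val l) := enum_valP l; exact/asboolP.
have k0 := recurrent_unique ord0 sk (rec i) (rec j) lk.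
move/eqP: ij; apply; apply: enum_val_inj; apply/ffunP => c; apply: val_inj => /=.
have := lk (bpt c) (inbox_bpt c); rewrite !patfun_bpt /lap !k0 mul0rn sub0r big1 ?oppr0 ?subr0.
  by case.
by move=> l _; rewrite !k0 addr0.
Qed.

End EntropyXf.

Theorem theorem5p1 (R : realType) (d : nat) (hd : (2 <= d)%N) :
  (forall g : lpoly d, @in_Id R d g -> ~ in_ideal_f g ->
     [set @xi R d g (fun n => (v n)%:Z) | v in @Rinf d] = @Xf R d) /\
  (let mahler : R := iint d (fun t => ln (Ffun d t)) in
   htop (@Rinf d) (@discr_dist R) = mahler%:E /\
   (fun N => ln ((npat d N)%:R : R) / (boxcard d N)%:R) @ \oo --> mahler /\
   htop (@Xf R d) (@circ_dist R) = mahler%:E).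
Proof.
case: d hd => [//|m] hd; have m0 : (0 < m)%N by [].
split=> [g hg ng|]; first exact: (xi_Rinf m0 hg ng).
by split; [exact: htop_Rinf|split; [exact: mahler_limit|exact: htop_Xf]].
Qed.
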